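(* Let $\mathfrak s$ be a (fundamental transitive) semisimple graded $CR$ algebra and $\mathfrak l$ a graded irreducible representation of $\mathfrak s$. Then $\mathfrak s\oplus\mathfrak l$ is a partial Levi--Tanaka extension of $\mathfrak s$ if and only if (i) $\mathfrak l_{-1}\neq0$; (ii) $\mathfrak l_{-2}\neq0$; (iii) there exists $k\in\mathbb R$ such that $\mathrm{ad}(J_{\mathfrak s}-ik\pi)=0$ on $\mathfrak l_0\oplus\mathfrak l_{-2}$.
   Context: Lie algebras and modules are real and finite dimensional. A gradation of a module $\mathfrak l$ over a $\mathbb Z$-graded Lie algebra $\mathfrak s=\bigoplus_p\mathfrak s_p$ is a decomposition $\mathfrak l=\bigoplus_{p\in\mathbb Z}\mathfrak l_p$ with $[\mathfrak s_p,\mathfrak l_q]\subset\mathfrak l_{p+q}$, where $[X,Y]=X\cdot Y$. The Abelian extension $\mathfrak s\oplus\mathfrak l$ has the bracket of $\mathfrak s$, $[X,Y]=X\cdot Y$ for $X\in\mathfrak s,Y\in\mathfrak l$, and $[\mathfrak l,\mathfrak l]=0$. A graded module $\mathfrak l$ is transitive if $[\mathfrak s_{-1},Y]\ne\{0\}$ for all $Y\in\mathfrak l_p\setminus\{0\}$, $p\ge0$; nondegenerate if $[\mathfrak s_{-1},Y]\neq\{0\}$ for all $Y\in\mathfrak l_{-1}\setminus\{0\}$; fundamental if $\mathfrak l_{p-1}=[\mathfrak s_{-1},\mathfrak l_p]$ for all $p<0$. A graded Lie algebra has one of these properties if its adjoint module does. A graded $CR$ algebra is a graded real Lie algebra $\mathfrak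 s$ with a linear $J:\mathfrak s_{-1}\to\mathfrak s_{-1}$ such that $J^2=-\mathrm{Id}$, $[JX,JY]=[X,Y]$ for $X,Y\in\mathfrak s_{-1}$, and $[A,JX]=J[A,X]$ for $A\in\mathfrak s_0,X\in\mathfrak s_{-1}$. A graded $\mathfrak s$-module $\mathfrak l$ is $CR$ if it admits a complex structure $J$ on $\mathfrak l_{-1}$ making $\mathfrak s\oplus\mathfrak l$ a graded $CR$ algebra. $\mathfrak s\oplus\mathfrak l$ is a partial Levi--Tanaka extension of the semisimple graded $CR$ algebra $\mathfrak s$ if $\mathfrak l$ is graded, transitive and $CR$, and the graded algebra $\mathfrak s\oplus\mathfrak l$ is fundamental and nondegenerate. For $\mathfrak s$ fundamental transitive semisimple graded $CR$, $J_{\mathfrak s}\in\mathfrak s_0$ denotes the element with $[J_{\mathfrak s},X]=JX$ for all $X\in\mathfrak s_{-1}$ (it exists). $\pi$ denotes the projection of $\mathfrak s\oplus\mathfrak l$ onto $\mathfrak l$ along $\mathfrak s$. Condition (iii) says that $J_{\mathfrak s}$ acts on $\mathfrak l_0\oplus\mathfrak l_{-2}$ as multiplication by $ik$: if $\mathfrak l$ is of complex type ($\mathrm{End}_{\mathfrak s}(\mathfrak l)\simeq\mathbb C$), $i$ is the imaginary unit of $\mathrm{End}_{\mathfrak s}(\mathfrak l)$; if $\mathfrak l$ is of real or quaternionic type ($\mathrm{End}_{\mathfrak s}(\mathfrak l)\simeq\mathbb R$ or $\mathbb H$), the equality is read in the complexification of $\mathfrak l$ (which forces $k=0$ when $\mathfrak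 l_{-2}\ne0$).
   Formalization: Added hypothesis: no nonzero X in s_{-1} with [X, s_{-1}] = 0 acts trivially on l. Without it ''if'' fails: s = sl(2,C) (degrees -1,0,1) + su(1,2), l = adjoint module of su(1,2). Every partial Levi–Tanaka extension satisfies it. *)

(* Defs.v *)
From HB Require Import structures.
From mathcomp Require Import all_boot all_order all_algebra.
From mathcomp Require Import reals complex.

Set Implicit Arguments.
Unset Strict Implicit.
Unset Printing Implicit Defensive.

Import Order.TTheory GRing.Theory Num.Theory.
Local Open Scope ring_scope.

(** * Lie algebras and modules *)

Record lieAlgebra (R : realType) := LieAlgebra {
  lie_sort :> vectType R;
  lie_br : lie_sort -> lie_sort -> lie_sort;
  lie_br_linearl : forall y, linear (lie_br^~ y);
  lie_br_linearr : forall x, linear (lie_br x);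
  lie_brxx : forall x, lie_br x x = 0;
  lie_jacobi : forall x y z,
    lie_br x (lie_br y z) + lie_br y (lie_br z x) + lie_br z (lie_br x y) = 0 }.

Record lieModule (R : realType) (s : lieAlgebra R) := LieModule {
  mod_sort :> vectType R;
  mod_act : s -> mod_sort -> mod_sort;
  mod_act_linearl : forall y, linear (mod_act^~ y);
  mod_act_linearr : forall x, linear (mod_act x);
  mod_actbr : forall x x' y,
    mod_act (lie_br x x') y
    = mod_act x (mod_act x' y) - mod_act x' (mod_act x y) }.

Arguments lie_br {R _} _ _.
Arguments mod_act {R s _} _ _.

Section ModuleTheory.
Variables (R : realType) (s : lieAlgebra R) (l : lieModule s).
Implicit Types (x : s) (y : l).

Lemma mod_actDl x x' y : mod_act (x + x') y = mod_act x y + mod_act x' y.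
Proof. by have := mod_act_linearl y 1 x x'; rewrite !scale1r. Qed.

Lemma mod_actDr x y y' : mod_act x (y + y') = mod_act x y + mod_act x y'.
Proof. by have := mod_act_linearr x 1 y y'; rewrite !scale1r. Qed.

Lemma mod_act0l y : mod_act (0 : s) y = 0.
Proof. by apply: (addrI (mod_act 0 y)); rewrite -mod_actDl !addr0. Qed.

Lemma mod_act0r x : mod_act x (0 : l) = 0.
Proof. by apply: (addrI (mod_act x 0)); rewrite -mod_actDr !addr0. Qed.

Lemma mod_actZl a x y : mod_act (a *: x) y = a *: mod_act x y.
Proof. by have := mod_act_linearl y a x 0; rewrite mod_act0l !addr0. Qed.

Lemma mod_actZr a x y : mod_act x (a *: y) = a *: mod_act x y.
Proof. by have := mod_act_linearr x a y 0; rewrite mod_act0r !addr0. Qed.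

Lemma mod_actBr x y y' : mod_act x (y - y') = mod_act x y - mod_act x y'.
Proof. by rewrite mod_actDr -scaleN1r mod_actZr scaleN1r. Qed.

End ModuleTheory.

Section Adjoint.
Variables (R : realType) (s : lieAlgebra R).
Implicit Types x y : s.

Lemma lie_brDl x x' y : lie_br (x + x') y = lie_br x y + lie_br x' y.
Proof. by have := lie_br_linearl y 1 x x'; rewrite !scale1r. Qed.

Lemma lie_brDr x y y' : lie_br x (y + y') = lie_br x y + lie_br x y'.
Proof. by have := lie_br_linearr x 1 y y'; rewrite !scale1r. Qed.

Lemma lie_brC x y : lie_br x y = - lie_br y x.
Proof.
apply/eqP; rewrite -addr_eq0; apply/eqP.
by have := lie_brxx (x + y); rewrite lie_brDl !lie_brDr !lie_brxx add0r addr0.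
Qed.

Lemma lie_brNr x y : lie_br x (- y) = - lie_br x y.
Proof.
have br0 : lie_br x 0 = 0.
  by apply: (addrI (lie_br x 0)); rewrite -lie_brDr !addr0.
by apply/eqP; rewrite -addr_eq0 -lie_brDr addNr br0.
Qed.

Lemma adjoint_actbr x x' y :
  lie_br (lie_br x x') y = lie_br x (lie_br x' y) - lie_br x' (lie_br x y).
Proof.
have /eqP := lie_jacobi x x' y.
by rewrite (lie_brC y x) (lie_brC y (lie_br x x')) lie_brNr subr_eq0 => /eqP ->.
Qed.

Definition adjoint : lieModule s :=
  LieModule (@lie_br_linearl R s) (@lie_br_linearr R s) adjoint_actbr.

End Adjoint.

(** * The Abelian extension [s (+) l], on the carrier [s * l] *)

Section AbelianExtension.
Variables (R : realType) (s : lieAlgebra R) (l : lieModule s).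
Local Notation sl := (s * l : vectType R)%type.
Implicit Types u v w : sl.

Definition ext_br u v : sl :=
  (lie_br u.1 v.1, mod_act u.1 v.2 - mod_act v.1 u.2).

Lemma ext_br_linearl v : linear (ext_br^~ v).
Proof.
move=> a u u'; congr pair => /=; first exact: lie_br_linearl.
by rewrite mod_actDl mod_actZl mod_actDr mod_actZr scalerBr opprD addrACA.
Qed.

Lemma ext_br_linearr u : linear (ext_br u).
Proof.
move=> a v v'; congr pair => /=; first exact: lie_br_linearr.
by rewrite mod_actDl mod_actZl mod_actDr mod_actZr scalerBr opprD addrACA.
Qed.

Lemma ext_brxx u : ext_br u u = 0.
Proof. by rewrite /ext_br lie_brxx subrr. Qed.

Lemma ext_jacobi u v w :
  ext_br u (ext_br v w) + ext_br v (ext_br w u) + ext_br w (ext_br u v) = 0.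
Proof.
have cycl (V : zmodType) (a b c d e f : V) :
    (a - b - (c - f)) + (c - d - (e - b)) + (e - f - (a - d)) = 0.
  have E (a' b' c' d' : V) : a' - b' - (c' - d') = (a' + d') - (b' + c').
    by rewrite opprB opprD addrACA.
  have T (P Q S : V) : P - Q + (Q - S) + (S - P) = 0.
    by rewrite !addrA subrK subrK subrr.
  by rewrite !E (addrC c b) (addrC e d) (addrC f a) T.
congr pair => /=; first exact: lie_jacobi.
rewrite !mod_actbr !mod_actBr; exact: cycl.
Qed.

Definition abelian_extension : lieAlgebra R :=
  LieAlgebra ext_br_linearl ext_br_linearr ext_brxx ext_jacobi.

End AbelianExtension.

(** * Semisimplicity and irreducibility *)

(** [mod_brv U V] is the linear span of the [X . Y], for [X] in [U] and [Y] in
    [V]; see [mod_brv_subP]. *)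
Definition mod_brv (R : realType) (s : lieAlgebra R) (l : lieModule s)
    (U : {vspace s}) (V : {vspace l}) : {vspace l} :=
  (\sum_(x <- vbasis U) \sum_(y <- vbasis V) <[mod_act x y]>)%VS.

Lemma mod_brv_subP (R : realType) (s : lieAlgebra R) (l : lieModule s)
    (U : {vspace s}) (V W : {vspace l}) :
  reflect (forall x y, x \in U -> y \in V -> mod_act x y \in W)
          (mod_brv U V <= W)%VS.
Proof.
apply: (iffP idP) => [sUVW x y xU yV | sUVW]; last first.
  rewrite /mod_brv big_seq; apply: (big_ind (fun A => A <= W)%VS).
  - exact: sub0v.
  - by move=> A B; rewrite subv_add => -> ->.
  move=> x /vbasis_mem xU; rewrite big_seq.
  apply: (big_ind (fun A => A <= W)%VS); first exact: sub0v.
    by move=> A B; rewrite subv_add => -> ->.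
  by move=> y /vbasis_mem yV; rewrite -memvE sUVW.
have basisW i j : mod_act (vbasis U)`_i (vbasis V)`_j \in W.
  have [iU|iU] := ltnP i (size (vbasis U)); last first.
    by rewrite (nth_default _ iU) mod_act0l mem0v.
  have [jV|jV] := ltnP j (size (vbasis V)); last first.
    by rewrite (nth_default _ jV) mod_act0r mem0v.
  apply: (subvP sUVW); rewrite /mod_brv.
  rewrite (big_rem _ (mem_nth 0 iU)) (big_rem _ (mem_nth 0 jV)) /=.
  by rewrite memvE -addvA addvSl.
have actW i v : v \in V -> mod_act (vbasis U)`_i v \in W.
  move=> /coord_vbasis ->.
  apply: (big_ind (fun v => mod_act (vbasis U)`_i v \in W)).
  - by rewrite mod_act0r mem0v.
  - by move=> a b; rewrite mod_actDr; exact: memvD.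
  by move=> j _; rewrite mod_actZr memvZ ?basisW.
rewrite (coord_vbasis xU).
apply: (big_ind (fun u => mod_act u y \in W)).
- by rewrite mod_act0l mem0v.
- by move=> a b; rewrite mod_actDl; exact: memvD.
by move=> i _; rewrite mod_actZl memvZ ?actW.
Qed.

Section Semisimple.
Variables (R : realType) (s : lieAlgebra R).

Definition lie_ideal (I : {vspace s}) : Prop :=
  forall x y, y \in I -> lie_br x y \in I.

Definition derived_series (I : {vspace s}) (n : nat) : {vspace s} :=
  iter n (fun D : {vspace s} => mod_brv (l := adjoint s) D D) I.

Definition solvable_lie (I : {vspace s}) : Prop :=
  exists n, derived_series I n = 0%VS.

Definition semisimple : Prop :=
  forall I : {vspace s}, lie_ideal I -> solvable_lie I -> I = 0%VS.

End Semisimple.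

Definition irreducible (R : realType) (s : lieAlgebra R) (l : lieModule s)
  : Prop :=
  (fullv : {vspace l}) <> 0%VS
  /\ forall W : {vspace l}, (forall x y, y \in W -> mod_act x y \in W) ->
       W = 0%VS \/ W = fullv.

(** * Gradations *)

Definition direct_decomposition (R : realType) (V : vectType R)
    (g : int -> {vspace V}) : Prop :=
  exists P : seq int,
    [/\ uniq P,
        forall p, p \notin P -> g p = 0%VS,
        (\sum_(p <- P) g p)%VS = fullv
      & forall v : int -> V, (forall p, v p \in g p) ->
          \sum_(p <- P) v p = 0 -> forall p, v p = 0].

Section Graded.
Variables (R : realType) (s : lieAlgebra R) (l : lieModule s).
Variables (gs : int -> {vspace s}) (gl : int -> {vspace l}).

Definition graded_module : Prop :=
  direct_decomposition gl
  /\ forall p q x y, x \in gs p -> y \in gl q -> mod_act x y \in gl (p + q).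

Definition transitive_module : Prop :=
  forall p y, 0 <= p -> y \in gl p -> y <> 0 ->
    exists2 x, x \in gs (-1) & mod_act x y <> 0.

Definition nondegenerate_module : Prop :=
  forall y, y \in gl (-1) -> y <> 0 ->
    exists2 x, x \in gs (-1) & mod_act x y <> 0.

Definition fundamental_module : Prop :=
  forall p, p < 0 -> gl (p - 1) = mod_brv (gs (-1)) (gl p).

End Graded.

Section GradedAlgebra.
Variables (R : realType) (s : lieAlgebra R) (g : int -> {vspace s}).

Definition graded_lie := graded_module (l := adjoint s) g g.
Definition transitive_lie := transitive_module (l := adjoint s) g g.
Definition nondegenerate_lie := nondegenerate_module (l := adjoint s) g g.
Definition fundamental_lie := fundamental_module (l := adjoint s) g g.

(** A linear map on [V] is encoded by a map on the whole space, of which only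
    the values on [V] are used. *)
Definition graded_CR (J : s -> s) : Prop :=
  graded_lie
  /\ [/\ forall x, x \in g (-1) -> J x \in g (-1),
         forall a x x', x \in g (-1) -> x' \in g (-1) ->
           J (a *: x + x') = a *: J x + J x',
         forall x, x \in g (-1) -> J (J x) = - x,
         forall x x', x \in g (-1) -> x' \in g (-1) ->
           lie_br (J x) (J x') = lie_br x x'
       & forall A x, A \in g 0 -> x \in g (-1) ->
           lie_br A (J x) = J (lie_br A x)].

(** [z] is the element written [J_s]; it is unique when [s] is transitive. *)
Definition CR_element (J : s -> s) (z : s) : Prop :=
  z \in g 0 /\ forall x, x \in g (-1) -> lie_br z x = J x.

End GradedAlgebra.

(** * Partial Levi--Tanaka extensions *)

Section Extension.
Variables (R : realType) (s : lieAlgebra R) (l : lieModule s).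
Variables (gs : int -> {vspace s}) (J : s -> s) (gl : int -> {vspace l}).

Definition ext_grade (p : int) : {vspace abelian_extension l} :=
  (linfun (fst : (s * l)%type -> s) @^-1: gs p
   :&: linfun (snd : (s * l)%type -> l) @^-1: gl p)%VS.

Lemma mem_ext_grade p (u : abelian_extension l) :
  (u \in ext_grade p) = (u.1 \in gs p) && (u.2 \in gl p).
Proof. by rewrite memv_cap -!memv_preim !lfunE. Qed.

Definition CR_module : Prop :=
  exists Jl : l -> l,
    graded_CR (s := abelian_extension l) ext_grade
      (fun u => (J u.1, Jl u.2)).

Definition partial_Levi_Tanaka : Prop :=
  [/\ graded_module gs gl, transitive_module gs gl, CR_module,
      fundamental_lie ext_grade & nondegenerate_lie ext_grade].

(** No nonzero element of [s_{-1}] both commutes with [s_{-1}] and acts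
    trivially on [l].  This holds as soon as [s] is nondegenerate or [l] is
    faithful, and it is implied by [partial_Levi_Tanaka]. It cannot be
    recovered from the conditions on the degrees of [l] and on [J_s]: let
    [s] be the sum of [sl(2,C)], graded in degrees -1, 0, 1, and of [su(1,2)],
    graded in degrees -2, ..., 2, and let [l] be the adjoint module of the
    second factor. Then [l_{-1}] and [l_{-2}] are nonzero and [J_s] vanishes on
    [l_0 (+) l_{-2}], but the degree -1 part of [sl(2,C)] commutes with
    [s_{-1} (+) l_{-1}], so that [s (+) l] is degenerate. *)
Definition effective_on_degenerate : Prop :=
  forall x, x \in gs (-1) ->
    (forall x', x' \in gs (-1) -> lie_br x' x = 0) ->
    (forall y : l, mod_act x y = 0) -> x = 0.

Lemma partial_Levi_Tanaka_effective :
  partial_Levi_Tanaka -> effective_on_degenerate.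
Proof.
move=> [_ _ _ _ nd] x xs xc xl; apply/eqP/negPn/negP => /eqP x0.
have [||[x' y']] := nd ((x, 0) : abelian_extension l).
- by rewrite mem_ext_grade xs mem0v.
- by case.
rewrite mem_ext_grade => /andP[/= x's _]; apply.
by rewrite /= /ext_br /= xc // xl mod_act0r subrr.
Qed.

End Extension.

(** * The type of an irreducible module *)

Section Types.
Variables (R : realType) (s : lieAlgebra R) (l : lieModule s).

Definition commutes_with_action (phi : 'End(l)) : Prop :=
  forall (x : s) y, phi (mod_act x y) = mod_act x (phi y).

(** [f] is an isomorphism onto [End_s(l)] of the real algebra with underlying
    vector space [A], product [mul] and unit [one]. *)
Definition End_iso (A : lmodType R) (mul : A -> A -> A) (one : A)
    (f : A -> 'End(l)) : Prop :=
  [/\ linear f, f one = \1%VF,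
      forall a b, f (mul a b) = (f a \o f b)%VF,
      injective f
    & forall phi, commutes_with_action phi <-> exists a, phi = f a].

(** [Rcomplex R] is [R[i]] with its structure of real vector space. *)
Definition complex_End_iso (f : Rcomplex R -> 'End(l)) : Prop :=
  End_iso *%R 1 f.

(** Hamilton's quaternions [a + b j], as pairs [(a, b)] of complex numbers. *)
Definition quat_mul (u v : (Rcomplex R * Rcomplex R)%type)
    : (Rcomplex R * Rcomplex R)%type :=
  (u.1 * v.1 - u.2 * conjc v.2, u.1 * v.2 + u.2 * conjc v.1).

Definition real_type : Prop := exists f : R^o -> 'End(l), End_iso *%R 1 f.

Definition quaternionic_type : Prop := exists f, End_iso quat_mul (1, 0) f.

(** [(u, v)] stands for the element [u + iv] of the complexification of [l]. *)
Definition cscale (z : R[i]) (w : (l * l)%type) : (l * l)%type :=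
  (complex.Re z *: w.1 - complex.Im z *: w.2,
   complex.Im z *: w.1 + complex.Re z *: w.2).

Definition cact (x : s) (w : (l * l)%type) : (l * l)%type :=
  (mod_act x w.1, mod_act x w.2).

Definition acts_as_ik (x : s) (U : {vspace l}) (k : R) : Prop :=
  (exists2 f, complex_End_iso f &
     forall y, y \in U -> mod_act x y = k *: f (Complex 0 1) y)
  \/ ((real_type \/ quaternionic_type) /\
      forall w, w.1 \in U -> w.2 \in U -> cact x w = cscale (Complex 0 k) w).

End Types.

(* Main.v *)
Require Import Defs.
From HB Require Import structures.
From mathcomp Require Import all_boot all_order all_algebra.
From mathcomp Require Import reals complex.
From mathcomp Require Import boolp ring zify.

Set Implicit Arguments.
Unset Strict Implicit.
Unset Printing Implicit Defensive.

Import Order.TTheory GRing.Theory Num.Theory.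
Local Open Scope ring_scope.
Import passmx.

(** The Killing form of [s] is nondegenerate, so every homogeneous element of
    nonzero degree lies in a graded sl2-triple; consequently [s] is generated by
    its components of degree -1, 0, 1.

    If [s (+) l] is a partial Levi-Tanaka extension, the operator equal to [J_s]
    on [l_0] and [l_{-2}] and to [J_s - J] on [l_{-1}] commutes with [s_0] and
    with [s_{-1}]. It also commutes with [s_1]: over the complex numbers, an
    eigenvector [e] of [J_s] in [s_1] lies in an sl2-triple whose [f] is an
    eigenvector in [s_{-1}], and comparing the weights of [h] on the two
    eigenspaces of [J] in [l_{-1}] shows that [e] kills the eigenspace with the
    same eigenvalue. Propagating the operator by [s_{-1}] below degree -2 and by
    [s_1] above degree 0 gives an endomorphism [Phi] of the module [l]. It is
    central in [End_s(l)], because endomorphisms preserve degrees and commute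
    with [J_s]. By the theorem of Frobenius [Phi = a + b i], and [a = 0] because
    [Phi] has trace zero: [J_s] has trace zero, and the spectrum of [J_s - Phi]
    is purely imaginary, since the sum of the eigenspaces whose eigenvalues have
    a given real part is a submodule while [J_s - Phi] vanishes on [l_{-2}].

    Conversely, [J := J_s - i k] is the required complex structure on [l_{-1}];
    the other properties express that the submodule generated by a homogeneous
    subspace is all of [l]. *)

(** * Traces and complex eigenvalues *)

(** The criterion of Cartan is reached without constructing a Jordan decomposition: one polynomial
    in [ad x] acts on each generalized eigenspace by the conjugate eigenvalue, and its being a
    derivation is what the trace computation needs. The spectral theory of sl2 is replaced by two
    facts: a product of operators [h - j] vanishes on the kernel of [e], and [h - c] is injective
    there for suitable [c]. They hold modulo any subspace stable under [e] and [f], and [h] need not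
    be diagonalized. Complexifications are kept as real spaces of pairs, so that the statements
    about real Lie algebras and modules apply to them unchanged. Extending an operator from three
    degrees to [l] raises a problem of well-definedness. It is avoided by propagating the graph, as
    a relation inside [l (+) l]; irreducibility then shows that the relation is the graph of a
    map. *)

Definition mklin (K : fieldType) (V W : vectType K) (f : V -> W) (lf : linear f)
  : {linear V -> W} := HB.pack f (GRing.isLinear.Build K V W *:%R f lf).

Section LinearAlgebra.
Variables (K : fieldType) (V : vectType K).

(** Comprehension for subspaces, used throughout in place of explicit spans. A subspace inside [P]
    is enlarged by one vector of [P] at a time; [n] bounds its codimension. *)
Lemma vspace_of_pred (P : V -> Prop) :
  P 0 -> (forall a u v, P u -> P v -> P (a *: u + v)) ->
  exists W : {vspace V}, forall v, v \in W <-> P v.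
Proof.
move=> P0 PD.
suff ext n (W : {vspace V}) : (\dim {:V} - \dim W <= n)%N ->
    (forall v, v \in W -> P v) -> exists W' : {vspace V}, forall v, v \in W' <-> P v.
  apply: (ext (\dim {:V}) 0%VS); first exact: leq_subr.
  by move=> v; rewrite memv0 => /eqP->.
elim: n W => [|n IHn] W dimW sWP.
  exists W => v; split; first exact: sWP.
  suff -> : W = fullv by rewrite memvf.
  by apply/eqP; rewrite eqEdim subvf -subn_eq0 -leqn0.
have [sPW|/existsNP[v /not_implyP[Pv /negP vW]]] := pselect (forall v, P v -> v \in W).
  by exists W => v; split; [exact: sWP | exact: sPW].
apply: (IHn (W + <[v]>)%VS); last first.
  move=> _ /memv_addP[w wW [_ /vlineP[k ->] ->]].
  by rewrite addrC; apply: PD => //; exact: sWP.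
have lt_dim : (\dim W < \dim (W + <[v]>))%N.
  rewrite ltn_neqAle dimvS ?addvSl // andbT; apply: contra vW => /eqP eq_dim.
  have /eqP-> : W == (W + <[v]>)%VS by rewrite eqEdim addvSl -eq_dim leqnn.
  by rewrite (subvP (addvSr _ _)) // memv_line.
by lia.
Qed.

(** The functional is a coordinate of the component along a complement of [W], chosen nonzero at
    [v]. *)
Lemma separating_functional (W : {vspace V}) v : v \notin W ->
  exists g : 'Hom(V, K^o), (forall w, w \in W -> g w = 0) /\ g v != 0.
Proof.
move=> vW; pose u := v - projv W v.
have u0 : u != 0.
  by apply: contra vW; rewrite subr_eq0 => /eqP->; exact: memv_proj.
have [i ci] : exists i, coord (vbasis (fullv : {vspace V})) i u != 0.
  apply/existsP; apply: contraR u0; rewrite negb_exists => /forallP c0.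
  rewrite (coord_vbasis (memvf u)) big1 // => i _.
  by have := c0 i; rewrite negbK => /eqP->; rewrite scale0r.
pose g0 w := coord (vbasis (fullv : {vspace V})) i (w - projv W w) : K^o.
have lin_g0 : linear g0.
  move=> a x y; rewrite /g0 linearP opprD addrACA -scalerBr linearP; exact: erefl.
exists (linfun (mklin lin_g0)).
split=> [w wW|]; rewrite (lfunE (mklin lin_g0)) //=.
by rewrite /g0 projv_id // subrr linear0.
Qed.

End LinearAlgebra.


Section Trace.
Variable K : fieldType.
Implicit Types U V W : vectType K.

Definition bas V := vbasis (fullv : {vspace V}).

Lemma basP V : basis_of fullv (bas V). Proof. exact: vbasisP. Qed.

Definition endmx V (f : 'End(V)) := mxof (bas V) (bas V) f.

Definition lftr V (f : 'End(V)) : K := \tr (endmx f).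

Lemma lftrD V (f g : 'End(V)) : lftr (f + g) = lftr f + lftr g.
Proof. by rewrite /lftr /endmx linearD /= mxtraceD. Qed.

Lemma lftrZ V a (f : 'End(V)) : lftr (a *: f) = a * lftr f.
Proof. by rewrite /lftr /endmx linearZ /= mxtraceZ. Qed.

Lemma lftr0 V : lftr (0 : 'End(V)) = 0.
Proof. by rewrite /lftr /endmx linear0 mxtrace0. Qed.

Lemma lftrB V (f g : 'End(V)) : lftr (f - g) = lftr f - lftr g.
Proof. by rewrite lftrD -scaleN1r lftrZ mulN1r. Qed.

Lemma lftr1 V : lftr (\1%VF : 'End(V)) = (\dim {:V})%:R.
Proof. by rewrite /lftr /endmx mxof1 ?mxtrace1 // (basis_free (basP V)). Qed.

Lemma lftr_comp V W (f : 'Hom(V, W)) (g : 'Hom(W, V)) :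
  lftr (f \o g)%VF = lftr (g \o f)%VF.
Proof.
rewrite /lftr /endmx (@mxof_comp _ _ _ _ (bas W) (bas V)) ?basP //.
by rewrite (@mxof_comp _ _ _ _ (bas V) (bas W)) ?basP // mxtrace_mulC.
Qed.

End Trace.

Section ClosedEigen.
Variable C : numClosedFieldType.

Lemma char_poly_split n (A : 'M[C]_n) :
  exists2 r : seq C, char_poly A = \prod_(z <- r) ('X - z%:P) & size r = n.
Proof.
have [r] := closed_field_poly_normal (char_poly A).
have /monicP-> := char_poly_monic A; rewrite scale1r => Ar.
exists r => //; have := size_char_poly A.
by rewrite Ar size_prod_XsubC => -[].
Qed.

(** The list [r] carries the algebraic multiplicities: it is the list of roots of the characteristic
    polynomial. *)
Lemma mxtrace_eigen n (A : 'M[C]_n) :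
  exists2 r : seq C, \tr A = \sum_(z <- r) z &
    forall z, (z \in r) = eigenvalue A z.
Proof.
have [r Ar sr] := char_poly_split A; exists r; last first.
  by move=> z; rewrite eigenvalue_root_char Ar root_prod_XsubC.
case: n A Ar sr => [|n] A Ar sr.
  by rewrite (size0nil sr) big_nil /mxtrace big_ord0.
apply: oppr_inj; rewrite -char_poly_trace // Ar.
by rewrite -coefPn_prod_XsubC ?sr.
Qed.

Lemma mxtrace_ge0_eigen0 n (A : 'M[C]_n) :
  (forall a, eigenvalue A a -> 0 <= a) -> \tr A = 0 ->
  forall a, eigenvalue A a -> a = 0.
Proof.
move=> ev; have [r -> memr] := mxtrace_eigen A.
have r0 z : z \in r -> 0 <= z by rewrite memr; exact: ev.
move=> /eqP; rewrite big_seq psumr_eq0 // => /allP sr a; rewrite -memr => ar.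
by have := sr _ ar; rewrite ar => /eqP.
Qed.

End ClosedEigen.

Section ComplexEigen.
Variable R : rcfType.
Local Notation C := R[i].

Lemma mxtrace_Re0 n (A : 'M[C]_n) :
  (forall a, eigenvalue A a -> complex.Re a = 0) -> complex.Re (\tr A) = 0.
Proof.
move=> ev; have [r -> memr] := mxtrace_eigen A.
rewrite raddf_sum big_seq big1 // => z; rewrite memr; exact: ev.
Qed.

Variable V : vectType R.
Implicit Type g : 'End(V).

(** Matrices act on row vectors from the right, so that composition is reversed. *)
Definition cmx g : 'M[C]_(\dim {:V}) := map_mx (real_complex R) (endmx g).

Lemma cmx_trace g : \tr (cmx g) = (lftr g)%:C%C.
Proof. by rewrite /cmx trace_map_mx. Qed.

(** [u] and [v] are the real and imaginary parts of a complex eigenvector. *)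
Lemma cmx_eigen g a : eigenvalue (cmx g) a ->
  exists u v, [/\ (u != 0) || (v != 0),
    g u = complex.Re a *: u - complex.Im a *: v &
    g v = complex.Im a *: u + complex.Re a *: v].
Proof.
move=> /eigenvalueP[w wA w0].
pose re := map_mx (@complex.Re R) w; pose im := map_mx (@complex.Im R) w.
have reM : re *m endmx g = map_mx (@complex.Re R) (w *m cmx g).
  apply/rowP => j; rewrite !mxE raddf_sum; apply: eq_bigr => i _; rewrite !mxE.
  by case: (w 0 i) => x y /=; rewrite mulr0 subr0.
have imM : im *m endmx g = map_mx (@complex.Im R) (w *m cmx g).
  apply/rowP => j; rewrite !mxE raddf_sum; apply: eq_bigr => i _; rewrite !mxE.
  by case: (w 0 i) => x y /=; rewrite mulr0 add0r.
exists (vecof (bas V) re), (vecof (bas V) im); split.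
- rewrite !vecof_eq0 ?basP // -negb_and; apply: contra w0 => /andP[/eqP r0 /eqP i0].
  apply/eqP/rowP => j; move/rowP: r0 => /(_ j); move/rowP: i0 => /(_ j).
  by rewrite !mxE; case: (w 0 j) => x y /= -> ->.
- rewrite (@hom_vecof _ _ _ (bas V) (bas V)) ?basP // reM wA -!linearZ -linearB;
    congr (vecof _ _).
  by apply/rowP => j; rewrite !mxE; case: (a) (w 0 j) => [x y] [x' y'].
- rewrite (@hom_vecof _ _ _ (bas V) (bas V)) ?basP // imM wA -!linearZ -linearD; congr (vecof _ _).
  by apply/rowP => j; rewrite !mxE; case: (a) (w 0 j) => [x y] [x' y'] /=; rewrite addrC.
Qed.

Lemma cmx_eigen_exists : (0 < \dim {:V})%N ->
  forall g, exists a, eigenvalue (cmx g) a.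
Proof. by move=> V0 g; exact: eigenvalue_closed. Qed.

End ComplexEigen.

(** * The conjugate of the semisimple part of a derivation *)

Section ConjugateDerivation.
Variables (C : numClosedFieldType) (n : nat) (D : 'M[C]_n.+1).
Implicit Types (u w : 'rV[C]_n.+1) (p q : {poly C}).

Lemma coprimep_XsubC_prod (rs : seq C) z m : z \notin rs ->
  coprimep (('X - z%:P) ^+ m) (\prod_(y <- rs) ('X - y%:P) ^+ m).
Proof.
elim: rs => [|y rs IHrs]; first by rewrite big_nil coprimep1.
rewrite inE negb_or big_cons coprimepMr => /andP[zy /IHrs->]; rewrite andbT.
apply/coprimep_expl/coprimep_expr; rewrite coprimep_XsubC root_XsubC.
by rewrite eq_sym.
Qed.

(** Chinese remainders, one root at a time: the Bezout term [b * q] is 1 modulo the new power and 0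
    modulo those already treated. *)
Lemma conj_interpolation (rs : seq C) m : uniq rs ->
  exists p, forall z, z \in rs -> ('X - z%:P) ^+ m %| p - (z^*)%:P.
Proof.
elim: rs => [|z rs IHrs] /=; first by exists 0.
move=> /andP[zrs /IHrs[p pE]].
pose q := \prod_(y <- rs) ('X - y%:P) ^+ m.
have /Bezout_eq1_coprimepP[[a b] /= ab1] := coprimep_XsubC_prod m zrs.
exists (p + q * (b * ((z^*)%:P - p))) => y; rewrite inE => /orP[/eqP->|yrs].
  have -> : p + q * (b * ((z^*)%:P - p)) - (z^*)%:P
      = (p - (z^*)%:P) * a * ('X - z%:P) ^+ m.
    by rewrite -mulrA (canRL (addrK _) ab1) -/q; ring.
  exact: dvdp_mulIr.
have -> : p + q * (b * ((z^*)%:P - p)) - (y^*)%:P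
    = (p - (y^*)%:P) + q * (b * ((z^*)%:P - p)) by ring.
apply: dvdp_add; first exact: pE.
by apply: dvdp_mulr; rewrite /q (big_rem _ yrs) /= dvdp_mulIl.
Qed.

Lemma horner_mx_XsubC_exp z m :
  horner_mx D (('X - z%:P) ^+ m) = (D - z%:M) ^+ m.
Proof. by rewrite rmorphXn rmorphB /= horner_mx_X horner_mx_C. Qed.

Lemma coprimep_row0 p q u : coprimep p q ->
  u *m horner_mx D p = 0 -> u *m horner_mx D q = 0 -> u = 0.
Proof.
move=> /Bezout_eq1_coprimepP[[a b] /= ab1] up uq.
rewrite -[u]mulmx1 -[1%:M](rmorph1 (horner_mx D)) -ab1 (mulrC a) (mulrC b).
by rewrite rmorphD !rmorphM /= mulmxDr -!mulmxE !mulmxA up uq !mul0mx addr0.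
Qed.

(** Primary decomposition as an induction principle: by Bezout, a vector killed by the product is a
    sum of generalized eigenvectors. *)
Lemma row_ind_geigen (Q : 'rV[C]_n.+1 -> Prop) (rs : seq C) m : uniq rs ->
  Q 0 -> (forall u w, Q u -> Q w -> Q (u + w)) ->
  (forall z u, z \in rs -> u *m (D - z%:M) ^+ m = 0 -> Q u) ->
  forall u, u *m horner_mx D (\prod_(z <- rs) ('X - z%:P) ^+ m) = 0 -> Q u.
Proof.
move=> + Q0 QD; elim: rs => [|z rs IHrs] /= + Qz u.
  by rewrite big_nil rmorph1 mulmx1 => _ ->.
move=> /andP[zrs urs]; rewrite big_cons.
pose q := \prod_(y <- rs) ('X - y%:P) ^+ m; rewrite -/q => upq.
have /Bezout_eq1_coprimepP[[a b] /= ab1] := coprimep_XsubC_prod m zrs.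
have -> : u = u *m horner_mx D (a * ('X - z%:P) ^+ m) + u *m horner_mx D (b * q).
  by rewrite -mulmxDr -rmorphD /= ab1 rmorph1 mulmx1.
apply: QD.
  apply: IHrs => // [y w yrs|]; first by apply: Qz; rewrite inE yrs orbT.
  rewrite -mulmxA mulmxE -rmorphM /= -/q -mulrA mulrC rmorphM -mulmxE mulmxA /=.
  by rewrite upq mul0mx.
apply: (Qz z); rewrite ?mem_head // -horner_mx_XsubC_exp.
rewrite -mulmxA mulmxE -rmorphM /= -mulrA mulrC [q * _]mulrC rmorphM -mulmxE.
by rewrite mulmxA /= upq mul0mx.
Qed.

Variable A : {linear 'rV[C]_n.+1 -> 'M[C]_n.+1}.
Hypothesis AD : forall u, A u *m D = A (u *m D) + D *m A u.

(** Read [w *m A u] as the bracket of [u] and [w]; then [AD] says that [D] is a derivation. By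
    Leibniz, [D - (z + y)] sends [[u, w]] to [[(D - z) u, w] + [u, (D - y) w]], which lowers one of
    the exponents in each term. *)
Lemma geigen_bracket z y i j u w :
  u *m (D - z%:M) ^+ i = 0 -> w *m (D - y%:M) ^+ j = 0 ->
  (w *m A u) *m (D - (z + y)%:M) ^+ (i + j) = 0.
Proof.
elim: {i j}(i + j)%N {-2}i {-2}j (leqnn (i + j)) u w => [|k IHk] i j.
  rewrite leqn0 addn_eq0 => /andP[/eqP-> /eqP->] u w.
  by rewrite !expr0 !mulmx1 => -> _; rewrite linear0 mulmx0.
case: i => [|i] ijk u w.
  by rewrite expr0 mulmx1 => -> _; rewrite linear0 mulmx0 mul0mx.
case: j ijk => [|j] ijk.
  by rewrite expr0 mulmx1 => _ ->; rewrite !mul0mx.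
move=> uz wy.
have -> : (i.+1 + j.+1 = (i + j).+2)%N by rewrite addSn addnS.
rewrite exprS -mulmxE mulmxA.
have -> : w *m A u *m (D - (z + y)%:M)
    = w *m A (u *m (D - z%:M)) + (w *m (D - y%:M)) *m A u.
  rewrite [LHS]mulmxBr -(mulmxA w (A u)) AD mul_mx_scalar mulmxDr mulmxA. 
  rewrite (mulmxBr u) mul_mx_scalar.
  have -> : A (u *m D - z *: u) = A (u *m D) - z *: A u by rewrite linearB linearZ.
  rewrite (mulmxBr w (A _)).
  rewrite -scalemxAr (mulmxBr w D) mul_mx_scalar mulmxBl -scalemxAl.
  by rewrite scalerDl opprD addrACA.
rewrite mulmxDl.
have -> : (i + j).+1 = (i + j.+1)%N by rewrite addnS.
rewrite IHk ?add0r; first last.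
- exact: wy.
- by rewrite -mulmxA mulmxE -exprS.
- by move: ijk; rewrite addSn.
rewrite addnS -addSn IHk //; first by move: ijk; rewrite addnS.
by rewrite -mulmxA mulmxE -exprS.
Qed.

(** [S] is a polynomial in [D] acting as the conjugate of [z] on the generalized eigenspace of [z].
    It is a derivation because eigenvalues add under the bracket and conjugation is additive. The
    eigenvalues of [D *m S] are squared moduli, so a zero trace makes them all vanish. *)
Lemma conj_derivation : exists S : 'M[C]_n.+1,
  (forall u, A u *m S = A (u *m S) + S *m A u) /\
  (\tr (D *m S) = 0 -> forall z, eigenvalue D z -> z = 0).
Proof.
have [rs Drs srs] := char_poly_split D.
have Prs : \prod_(z <- rs) ('X - z%:P) %| \prod_(z <- undup rs) ('X - z%:P) ^+ n.+1.
  rewrite -big_undup_iterop_count.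
  apply: (big_ind2 (fun p q => p %| q)) => [|p p' q q'|z _].
  - exact: dvd1p.
  - exact: dvdp_mul.
  by apply: (dvdp_exp2l ('X - z%:P)); rewrite -srs count_size.
have split0 u : u *m horner_mx D (\prod_(z <- undup rs) ('X - z%:P) ^+ n.+1) = 0.
  have /dvdpP[q ->] := Prs; rewrite mulrC rmorphM /= -Drs Cayley_Hamilton.
  by rewrite mul0r mulmx0.
(* The exponent is doubled because the bracket of two vectors killed with exponent [n.+1] is only
   known to be killed with exponent [n.+1 + n.+1]. *)
have [p pE] := conj_interpolation (n.+1 + n.+1) (undup_uniq rs).
have pS z m u : z \in rs -> (m <= n.+1 + n.+1)%N ->
    u *m (D - z%:M) ^+ m = 0 -> u *m horner_mx D p = z^* *: u.
  rewrite -mem_undup => zrs lem uz; have /dvdpP[q /eqP] := pE z zrs.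
  rewrite subr_eq => /eqP->; rewrite rmorphD /= horner_mx_C mulmxDr mul_mx_scalar.
  rewrite mulrC rmorphM /= horner_mx_XsubC_exp -mulmxE mulmxA -(subnKC lem).
  by rewrite exprD -mulmxE mulmxA uz !mul0mx add0r.
exists (horner_mx D p); split.
  suff H u w : w *m (A u *m horner_mx D p) =
      w *m (A (u *m horner_mx D p) + horner_mx D p *m A u).
    by move=> u; apply/row_matrixP => i; rewrite !rowE H.
  pose Q u := forall w, w *m (A u *m horner_mx D p) =
      w *m (A (u *m horner_mx D p) + horner_mx D p *m A u).
  apply: (row_ind_geigen (Q := Q) (undup_uniq rs) _ _ _ (split0 u)) w; rewrite /Q.
  - by move=> {}w; rewrite !(mul0mx, linear0 A, mulmx0, add0r).  
  - move=> u1 u2 H1 H2 w; rewrite mulmxDl !linearD /= mulmxDl !mulmxDr H1 H2.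
    by rewrite !mulmxDr addrACA.
  move=> z {}u; rewrite mem_undup => zrs uz w.
  pose Q' w := w *m (A u *m horner_mx D p) =
      w *m (A (u *m horner_mx D p) + horner_mx D p *m A u).
  apply: (row_ind_geigen (Q := Q') (undup_uniq rs) _ _ _ (split0 w)); rewrite /Q'.
  - by rewrite !mul0mx.
  - by move=> u1 u2 H1 H2; rewrite !(mulmxDl u1) H1 H2.
  move=> y {}w; rewrite mem_undup => yrs wy.
  have lenn : (n.+1 <= n.+1 + n.+1)%N by rewrite leq_addr.
  rewrite mulmxDr (pS z n.+1 u) // mulmxA (mulmxA w) (pS y n.+1 w) //.
  rewrite linearZ /= -scalemxAr -scalemxAl -scalerDl -rmorphD /=.
  have zy := geigen_bracket uz wy.
  have [zyrs|zyrs] := boolP (z + y \in rs); first exact: pS zy.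
  (* If [z + y] is not an eigenvalue, the bracket is killed by two coprime polynomials in [D]. *)
  suff -> : w *m A u = 0 by rewrite mul0mx scaler0.
  rewrite -mem_undup in zyrs.
  apply: (coprimep_row0 (coprimep_XsubC_prod (n.+1 + n.+1) zyrs)).
    by rewrite horner_mx_XsubC_exp.
  have -> : \prod_(z <- undup rs) ('X - z%:P) ^+ (n.+1 + n.+1) =
      \prod_(z <- undup rs) ('X - z%:P) ^+ n.+1 * \prod_(z <- undup rs) ('X - z%:P) ^+ n.+1.
    by rewrite -big_split /=; apply: eq_bigr => x _; rewrite exprD.
  by rewrite rmorphM /= -mulmxE mulmxA split0.
have DSE : D *m horner_mx D p = horner_mx D ('X * p).
  by rewrite rmorphM /= horner_mx_X.
move=> tr0 z zD.
have evp y : y \in rs -> p.[y] = y^*.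
  move=> yrs; have /dvdpP[q /eqP] := pE y (etrans (mem_undup _ _) yrs).
  rewrite subr_eq => /eqP->; rewrite hornerD hornerM horner_exp hornerXsubC.
  by rewrite subrr addnS expr0n mulr0 add0r hornerC.
(* Spectral mapping: [a] is the value of ['X * p] at some root of the characteristic polynomial of
   [D]. *)
have eigDS a : eigenvalue (D *m horner_mx D p) a -> exists2 y, y \in rs & a = y * y^*.
  move=> /eigenvalueP[v]; rewrite DSE => vp v0.
  have [cop|] := boolP (coprimep ('X * p - a%:P) (char_poly D)).
    case/eqP: v0; apply: (coprimep_row0 cop).
      by rewrite rmorphB /= horner_mx_C mulmxBr vp mul_mx_scalar subrr.
    by rewrite Cayley_Hamilton mulmx0.
  move=> /closed_rootP[y]; rewrite root_gcd => /andP[yp yD].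
  have yrs : y \in rs by rewrite -root_prod_XsubC -Drs.
  exists y => //; move: yp; rewrite rootE hornerD hornerN hornerC hornerM hornerX.
  by rewrite evp // subr_eq0 => /eqP.
have DS0 : forall a, eigenvalue (D *m horner_mx D p) a -> a = 0.
  apply: mxtrace_ge0_eigen0 tr0 => a /eigDS[y _ ->]; exact: mul_conjC_ge0.
have : eigenvalue (D *m horner_mx D p) (z * z^*).
  have zrs : z \in rs by rewrite -root_prod_XsubC -Drs -eigenvalue_root_char.
  have /eigenvalueP[v vz v0] := zD; apply/eigenvalueP; exists v => //.
  rewrite mulmxA vz -scalemxAl (pS z 1%N) ?scalerA ?addSn //.
  by rewrite expr1 mulmxBr vz mul_mx_scalar subrr.
by move=> /DS0/eqP; rewrite mul_conjC_eq0 => /eqP.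
Qed.

End ConjugateDerivation.

(** * The Killing form and the criterion of Cartan *)

Lemma nilpotent_eigen0 (C : numClosedFieldType) n (D : 'M[C]_n) :
  (forall a, eigenvalue D a -> a = 0) -> D ^+ n = 0.
Proof.
case: n D => [|n] D ev0; first by apply/matrixP => -[].
have [r Dr sr] := char_poly_split D.
have r0 : {in r, forall z, z = 0}.
  move=> z zr; apply: ev0.
  by rewrite eigenvalue_root_char Dr root_prod_XsubC.
have := Cayley_Hamilton D; rewrite Dr big_seq.
rewrite (eq_bigr (fun=> 'X)) => [|z /r0->]; last by rewrite subr0.
rewrite -big_seq big_const_seq count_predT sr iter_mulr_1 rmorphXn /=.
by rewrite horner_mx_X.
Qed.

Lemma conj_derivation_gen (C : numClosedFieldType) n (D : 'M[C]_n)
    (A : {linear 'rV[C]_n -> 'M[C]_n}) :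
  (forall u, A u *m D = A (u *m D) + D *m A u) ->
  exists S : 'M[C]_n, (forall u, A u *m S = A (u *m S) + S *m A u) /\
    (\tr (D *m S) = 0 -> D ^+ n = 0).
Proof.
case: n D A => [|n] D A AD.
  by exists 0; split=> [u|_]; apply/matrixP => -[].
have [S [SD S0]] := conj_derivation AD.
by exists S; split=> // trDS; apply: nilpotent_eigen0; exact: S0.
Qed.

Section ModuleMore.
Variables (R : realType) (s : lieAlgebra R) (l : lieModule s).
Implicit Types (x : s) (y : l).

Lemma mod_actNr x y : mod_act x (- y) = - mod_act x y.
Proof. by rewrite -scaleN1r mod_actZr scaleN1r. Qed.

Lemma mod_actNl x y : mod_act (- x) y = - mod_act x y.
Proof. by rewrite -scaleN1r mod_actZl scaleN1r. Qed.

Definition rho x : 'End(l) := linfun (mklin (mod_act_linearr x)).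

Lemma rhoE x y : rho x y = mod_act x y.
Proof. exact: (lfunE (mklin (mod_act_linearr x))). Qed.

Lemma rhoD x x' : rho (x + x') = rho x + rho x'.
Proof. by apply/lfunP => y; rewrite add_lfunE !rhoE mod_actDl. Qed.

Lemma rhoZ a x : rho (a *: x) = a *: rho x.
Proof. by apply/lfunP => y; rewrite scale_lfunE !rhoE mod_actZl. Qed.

Lemma rho_br x x' : rho (lie_br x x') = (rho x \o rho x')%VF - (rho x' \o rho x)%VF.
Proof.
apply/lfunP => y; rewrite add_lfunE opp_lfunE !comp_lfunE !rhoE.
exact: mod_actbr.
Qed.

End ModuleMore.

Arguments rho {R s l} x.

Section LieMore.
Variables (R : realType) (s : lieAlgebra R).
Implicit Types x y z : s.

Definition lie_br0r x : lie_br x 0 = 0 := @mod_act0r R s (adjoint s) x.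
Definition lie_br0l x : lie_br 0 x = 0 := @mod_act0l R s (adjoint s) x.
Definition lie_brZr x a y : lie_br x (a *: y) = a *: lie_br x y :=
  @mod_actZr R s (adjoint s) a x y.
Definition lie_brZl a x y : lie_br (a *: x) y = a *: lie_br x y :=
  @mod_actZl R s (adjoint s) a x y.
Definition lie_brNl x y : lie_br (- x) y = - lie_br x y :=
  @mod_actNl R s (adjoint s) x y.
Definition lie_brBr x y y' : lie_br x (y - y') = lie_br x y - lie_br x y' :=
  @mod_actBr R s (adjoint s) x y y'.
Definition lie_br_br x x' y :
  lie_br (lie_br x x') y = lie_br x (lie_br x' y) - lie_br x' (lie_br x y) :=
  @mod_actbr R s (adjoint s) x x' y.

Definition ad x : 'End(s) := @rho R s (adjoint s) x.

Lemma adE x y : ad x y = lie_br x y. Proof. exact: (@rhoE R s (adjoint s)). Qed.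

Definition adD x y : ad (x + y) = ad x + ad y := @rhoD R s (adjoint s) x y.
Definition adZ a x : ad (a *: x) = a *: ad x := @rhoZ R s (adjoint s) a x.
Lemma ad0 : ad (0 : s) = 0.
Proof. by rewrite -(scale0r 0) adZ scale0r. Qed.
Definition ad_br x y : ad (lie_br x y) = (ad x \o ad y)%VF - (ad y \o ad x)%VF :=
  @rho_br R s (adjoint s) x y.

Definition killing x y : R := lftr (ad x \o ad y)%VF.

Lemma killingC x y : killing x y = killing y x.
Proof. exact: lftr_comp. Qed.

Lemma killingDl x x' y : killing (x + x') y = killing x y + killing x' y.
Proof. by rewrite /killing adD comp_lfunDl lftrD. Qed.

Lemma killingZl a x y : killing (a *: x) y = a * killing x y.
Proof. by rewrite /killing adZ -comp_lfunZl lftrZ. Qed.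

Lemma killingDr x x' y : killing y (x + x') = killing y x + killing y x'.
Proof. by rewrite !(killingC y) killingDl. Qed.

Lemma killingZr a x y : killing y (a *: x) = a * killing y x.
Proof. by rewrite !(killingC y) killingZl. Qed.

Lemma killing0l y : killing 0 y = 0.
Proof. by rewrite -(scale0r 0) killingZl mul0r. Qed.

Lemma killing0r y : killing y 0 = 0.
Proof. by rewrite killingC killing0l. Qed.

Lemma killingNl x y : killing (- x) y = - killing x y.
Proof. by rewrite -scaleN1r killingZl mulN1r. Qed.

Lemma killingNr x y : killing y (- x) = - killing y x.
Proof. by rewrite killingC killingNl killingC. Qed.

Lemma killing_br x y z : killing (lie_br x y) z = killing x (lie_br y z).
Proof.
rewrite /killing !ad_br comp_lfunDl comp_lfunDr comp_lfunNl comp_lfunNr !lftrB.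
by rewrite -!comp_lfunA; congr (_ - _); rewrite lftr_comp -comp_lfunA.
Qed.

End LieMore.

Section Cartan.
Variables (R : realType) (s : lieAlgebra R).
Local Notation C := R[i].
Local Notation n := (\dim {:s}).
Local Notation rc := (real_complex R).

Definition crow (v : s) : 'rV[C]_n := map_mx rc (rVof (bas s) v).

Lemma cmx_linear (V : vectType R) a (f g : 'End(V)) :
  cmx (a *: f + g) = rc a *: cmx f + cmx g.
Proof.
rewrite /cmx /endmx linearP /=; apply/matrixP => i j.
by rewrite !mxE rmorphD rmorphM.
Qed.

Lemma cmx0 (V : vectType R) : cmx (0 : 'End(V)) = 0.
Proof. by rewrite /cmx /endmx linear0 map_mx0. Qed.

Lemma cmxD (V : vectType R) (f g : 'End(V)) : cmx (f + g) = cmx f + cmx g.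
Proof. by have := cmx_linear 1 f g; rewrite rmorph1 !scale1r. Qed.

Lemma cmxZ (V : vectType R) a (f : 'End(V)) : cmx (a *: f) = rc a *: cmx f.
Proof. by have := cmx_linear a f 0; rewrite cmx0 !addr0. Qed.

Lemma cmxB (V : vectType R) (f g : 'End(V)) : cmx (f - g) = cmx f - cmx g.
Proof. by rewrite cmxD -scaleN1r cmxZ rmorphN1 scaleN1r. Qed.

Lemma cmx_comp (V : vectType R) (f g : 'End(V)) :
  cmx (f \o g)%VF = cmx g *m cmx f.
Proof.
by rewrite /cmx /endmx (@mxof_comp _ _ _ _ (bas V) (bas V)) ?basP // map_mxM.
Qed.

Lemma crow_mul v (g : 'End(s)) : crow v *m cmx g = crow (g v).
Proof.
by rewrite /crow /cmx -map_mxM; congr map_mx; rewrite mul_mxof rVofK ?basP.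
Qed.

Lemma crow_sum (u : 'rV[C]_n) : u = \sum_i u 0 i *: crow (bas s)`_i.
Proof.
rewrite [LHS]row_sum_delta; apply: eq_bigr => i _; congr (_ *: _).
by rewrite /crow rVofE ?basP // map_delta_mx.
Qed.

(** The complex-linear extension of [ad] to the complexification, in coordinates. *)
Definition cad (u : 'rV[C]_n) : 'M[C]_n := \sum_i u 0 i *: cmx (ad (bas s)`_i).

Lemma cad_is_linear : linear cad.
Proof.
move=> a u v; rewrite /cad scaler_sumr -big_split; apply: eq_bigr => i _ /=.
by rewrite !mxE scalerDl scalerA.
Qed.

HB.instance Definition _ := GRing.isLinear.Build C _ _ _ cad cad_is_linear.

Lemma cad_crow v : cad (crow v) = cmx (ad v).
Proof.
rewrite [in RHS](coord_basis (basP s) (memvf v)).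
have adS : ad (\sum_i coord (bas s) i v *: (bas s)`_i)
    = \sum_i coord (bas s) i v *: ad (bas s)`_i.
  rewrite (big_morph _ (@adD R s) (@ad0 R s)).
  by apply: eq_bigr => i _; rewrite adZ.
rewrite adS /cad (big_morph _ (@cmxD s) (@cmx0 s)).
by apply: eq_bigr => i _; rewrite cmxZ !mxE.
Qed.

Lemma cad_derivation x (u : 'rV[C]_n) :
  cad u *m cmx (ad x) = cad (u *m cmx (ad x)) + cmx (ad x) *m cad u.
Proof.
rewrite [u]crow_sum; apply: (big_ind (fun u => cad u *m cmx (ad x)
    = cad (u *m cmx (ad x)) + cmx (ad x) *m cad u)).
- by rewrite mul0mx !linear0 mul0mx addr0.
- move=> v w vx wx; rewrite mulmxDl !(linearD cad) mulmxDl mulmxDr vx wx.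
  by rewrite addrACA.
move=> i _; rewrite -scalemxAl !(linearZ_LR cad) /= -scalemxAl -scalemxAr.
rewrite -scalerDr crow_mul !cad_crow adE ad_br -!cmx_comp; congr (_ *: _).
by rewrite cmxB subrK.
Qed.

(* The conjugate [S] of the semisimple part of [ad x] is a derivation of the
   complexification, so that [tr (ad x S)], the sum of the squared moduli of the
   eigenvalues of [ad x], is a sum of values of the Killing form on [r]. *)
Lemma killing_orthogonal_nilpotent (r : {vspace s}) x :
  (forall a b, b \in r -> killing a b = 0) ->
  x \in mod_brv (l := adjoint s) fullv r ->
  exists N, forall v, iter N (lie_br x) v = 0.
Proof.
move=> r0 xr.
have [S [SD S0]] := conj_derivation_gen (cad_derivation x).
exists n.
suff Dn : cmx (ad x) ^+ n = 0.
  have crowI k v : crow (iter k (lie_br x) v) = crow v *m cmx (ad x) ^+ k.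
    elim: k v => [|k IHk] v; first by rewrite mulmx1.
    by rewrite iterSr IHk exprS -mulmxE mulmxA crow_mul adE.
  move=> v; apply/eqP; rewrite -(rVof_eq0 (basP s)).
  rewrite -(map_mx_eq0 rc) -/(crow _) crowI Dn mulmx0 //.
apply: S0.
(* The vanishing of [tr (ad y S)] is linear in [y], so it is enough to check it on brackets [[a, b]]
   with [b] in [r]. *)
have [W WP] : exists W : {vspace s}, forall y, y \in W <-> \tr (cmx (ad y) *m S) = 0.
  apply: vspace_of_pred.
    by rewrite ad0 cmx0 mul0mx mxtrace0.
  move=> a u v u0 v0; rewrite adD adZ cmx_linear mulmxDl -scalemxAl.
  by rewrite mxtraceD mxtraceZ u0 v0 mulr0 addr0.
have sub : (mod_brv (l := adjoint s) fullv r <= W)%VS; last first.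
  by apply/WP; exact: (subvP sub).
apply/mod_brv_subP => a b _ br; apply/WP.
rewrite /= ad_br.
(* By cyclicity the trace is that of [ad b] times the commutator of [ad a] with [S]. As [S] is a
   derivation, this commutator is a value of [cad], hence a complex combination of maps [ad], and
   values of the Killing form at [b] appear. *)
rewrite cmxB !cmx_comp mulmxBl linearB /= -!mulmxA [X in _ - X]mxtrace_mulC.
rewrite -mulmxA -linearB -mulmxBr -(cad_crow a) SD addrK.
rewrite /cad mulmx_sumr linear_sum big1 // => i _.
rewrite -scalemxAr /= mxtraceZ -cmx_comp cmx_trace.
by have := r0 (bas s)`_i b br; rewrite /killing => ->; rewrite mulr0.
Qed.

End Cartan.

(** * The theorem of Engel for a subalgebra of ad-nilpotent elements *)

Section Engel.
Variables (R : realType) (s : lieAlgebra R).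
Implicit Types (k h U : {vspace s}) (x u : s).

Definition nilpotent_map (V : vectType R) (f : V -> V) : Prop :=
  exists N, forall v, iter N f v = 0.

Lemma memv_br_mod (l : lieModule s) (U : {vspace s}) (V : {vspace l}) x y :
  x \in U -> y \in V -> mod_act x y \in mod_brv U V.
Proof. by move=> xU yV; have /mod_brv_subP := subvv (mod_brv U V); exact. Qed.

(** The conclusion of the theorem of Engel for [k] acting on the quotient of [U + U'] by [U'],
    phrased without quotients. All pairs are allowed because the induction in [engel] uses the pair
    formed by [k] and [h]. *)
Definition engel_flag k : Prop := forall U' U,
  (forall x u, x \in k -> u \in U' -> lie_br x u \in U') ->
  (forall x u, x \in k -> u \in U -> lie_br x u \in U) -> ~~ (U <= U')%VS ->
  exists u, [/\ u \in U, u \notin U' & forall x, x \in k -> lie_br x u \in U'].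

(** Starting from a vector killed by [k] modulo [U'], iterate [ad x]. The iterates stay killed by
    [k] because [x] normalizes [k], and the last one outside [U'] is also killed by [x]. *)
Lemma engel_flag_extend k x : engel_flag k ->
  (forall a, a \in k -> lie_br a x \in k) -> nilpotent_map (lie_br x) ->
  engel_flag (k + <[x]>)%VS.
Proof.
move=> kF kx [N xN] U' U sU' sU UU'.
have kkx a : a \in k -> a \in (k + <[x]>)%VS by apply/subvP/addvSl.
have xkx : x \in (k + <[x]>)%VS by rewrite (subvP (addvSr _ _)) ?memv_line.
have [||//|u [uU uU' ku]] := kF U' U.
- by move=> a u /kkx; exact: sU'.
- by move=> a u /kkx; exact: sU.
pose v j := iter j (lie_br x) u.
have vU j : v j \in U by elim: j => //= j IHj; exact: sU.
have kv j a : a \in k -> lie_br a (v j) \in U'.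
  elim: j a => [|j IHj] a ak /=; first exact: ku.
  have /eqP := lie_br_br a x (v j); rewrite eq_sym subr_eq => /eqP->.
  by rewrite memvD ?IHj ?kx // sU' // IHj.
have exj : exists j, v j \in U' by exists N; rewrite /v xN mem0v.
have [[|j] vj minj] := ex_minnP exj; first by rewrite -[u]/(v 0%N) vj in uU'.
exists (v j); split; [exact: vU | by apply/negP => /minj; rewrite ltnn |].
move=> _ /memv_addP[a ak [_ /vlineP[c ->] ->]].
by rewrite lie_brDl lie_brZl; apply: memvD; [exact: kv | apply: memvZ; exact: vj].
Qed.

(** A subalgebra [k] with the flag property is enlarged until it is [h]: the property, applied to
    [k] inside [h], yields an element of [h] outside [k] that normalizes [k]. *)
Lemma engel h :
  (forall x y, x \in h -> y \in h -> lie_br x y \in h) ->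
  (forall x, x \in h -> nilpotent_map (lie_br x)) -> engel_flag h.
Proof.
move=> hh hnil.
suff ext n k : (k <= h)%VS -> (\dim h - \dim k <= n)%N ->
    (forall x y, x \in k -> y \in k -> lie_br x y \in k) -> engel_flag k ->
    engel_flag h.
  apply: (ext (\dim h) 0%VS); rewrite ?sub0v ?leq_subr //.
    by move=> x y; rewrite !memv0 => /eqP-> _; rewrite lie_br0l.
  move=> U' U _ _ /subvPn[u uU uU']; exists u; split=> // x.
  by rewrite memv0 => /eqP->; rewrite lie_br0l mem0v.
elim: n k => [|n IHn] k skh dimk kk kF.
  suff <- : k = h by [].
  by apply/eqP; rewrite eqEdim skh -subn_eq0 -leqn0.
have [/eqP <- //|nhk] := boolP (k == h).
have hk : ~~ (h <= k)%VS by apply: contra nhk => hk; rewrite eqEsubv skh.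
have sk a : a \in k -> a \in h by apply/subvP.
have [||//|x [xh xk kx]] := kF k h.
- exact: kk.
- by move=> a u /sk; exact: hh.
apply: (IHn (k + <[x]>)%VS).
- by rewrite subv_add skh -memvE.
- have lt_dim : (\dim k < \dim (k + <[x]>))%N.
    rewrite ltn_neqAle dimvS ?addvSl // andbT; apply: contra xk => /eqP eq_dim.
    have /eqP-> : k == (k + <[x]>)%VS by rewrite eqEdim addvSl -eq_dim leqnn.
    by rewrite (subvP (addvSr _ _)) // memv_line.
  have : (\dim (k + <[x]>) <= \dim h)%N by rewrite dimvS // subv_add skh -memvE.
  by lia.
- move=> y z /memv_addP[a ak [_ /vlineP[c ->] ->]].
  move=> /memv_addP[b bk [_ /vlineP[d ->] ->]].
  apply: (subvP (addvSl _ _)).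
  rewrite !lie_brDl !lie_brDr !lie_brZl !lie_brZr lie_brxx !scaler0 addr0.
  apply: memvD; last by apply: memvZ; rewrite lie_brC memvN kx.
  by apply: memvD; [exact: kk | apply: memvZ; exact: kx].
- exact: engel_flag_extend kF kx (hnil x xh).
Qed.

End Engel.

Section SemisimpleKilling.
Variables (R : realType) (s : lieAlgebra R).
Hypothesis s_ss : semisimple s.

Lemma abelian_ideal0 (I : {vspace s}) : lie_ideal I ->
  (forall x y, x \in I -> y \in I -> lie_br x y = 0) -> I = 0%VS.
Proof.
move=> idI abI; apply: s_ss => //; exists 1%N.
apply/eqP; rewrite -subv0 ; apply/(@mod_brv_subP _ _ (adjoint s)) => x y xI yI.
by rewrite memv0 /= abI.
Qed.

(** The center [Z] of [I] is an abelian ideal, hence zero, whereas the theorem of Engel produces a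
    nonzero element of it. *)
Lemma nil_ideal0 (I : {vspace s}) : lie_ideal I ->
  (forall x, x \in I -> nilpotent_map (lie_br x)) -> I = 0%VS.
Proof.
move=> idI nilI; apply/eqP; apply: contraT => I0.
have [Z ZP] : exists Z : {vspace s}, forall z, z \in Z <->
    z \in I /\ forall a, a \in I -> lie_br a z = 0.
  apply: vspace_of_pred; first by split; [exact: mem0v | move=> a _; exact: lie_br0r].
  move=> c u v [uI u0] [vI v0]; split; first by rewrite memvD ?memvZ.
  by move=> a aI; rewrite lie_brDr lie_brZr u0 // v0 // scaler0 addr0.
have Z0 : Z = 0%VS.
  apply: abelian_ideal0 => [x y /ZP[yI y0]|x y /ZP[xI _] /ZP[_]]; last exact.
  apply/ZP; split=> [|a aI]; first exact: idI.
  have /eqP := lie_br_br a x y; rewrite eq_sym subr_eq => /eqP->.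
  by rewrite (y0 a) // lie_br0r addr0 y0 // lie_brC memvN idI.
have [||||u [uI u0 uZ]] := engel (h := I) _ nilI (U' := 0%VS) (U := I).
- by move=> x y _; exact: idI.
- by move=> x u _; rewrite !memv0 => /eqP->; rewrite lie_br0r.
- by move=> x u _; exact: idI.
- by rewrite subv0.
suff : u \in Z by rewrite Z0 (negPf u0).
by apply/ZP; split=> // a /uZ; rewrite memv0 => /eqP.
Qed.

(** For the radical [r] of the form, the ideal [[s, r]] consists of ad-nilpotent elements, hence is
    zero; then [r] is central, thus an abelian ideal. *)
Lemma killing_nondegenerate (x : s) : (forall y, killing x y = 0) -> x = 0.
Proof.
have [r rP] : exists r : {vspace s},
    forall x : s, x \in r <-> forall y, killing x y = 0.
  apply: vspace_of_pred; first by move=> y; exact: killing0l.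
  by move=> c u v u0 v0 y; rewrite killingDl killingZl u0 v0 mulr0 addr0.
have idr : lie_ideal r.
  move=> a b /rP br; apply/rP => y.
  by rewrite lie_brC killingNl killing_br br oppr0.
pose r1 := mod_brv (l := adjoint s) fullv r.
have sr1 : (r1 <= r)%VS by apply/(@mod_brv_subP _ _ (adjoint s)) => a b _; exact: idr.
have r10 : r1 = 0%VS.
  apply: nil_ideal0 => [a b /(subvP sr1) br|a ar1].
    exact: (@memv_br_mod _ _ (adjoint s)) (memvf _) br.
  apply: killing_orthogonal_nilpotent ar1 => c b /rP bc.
  by rewrite killingC.
have r0 : r = 0%VS.
  apply: abelian_ideal0 idr _ => a b _ br.
  have : lie_br a b \in r1 by exact: (@memv_br_mod _ _ (adjoint s)) (memvf _) br.
  by rewrite r10 memv0 => /eqP.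
by move=> /rP; rewrite r0 memv0 => /eqP.
Qed.

End SemisimpleKilling.

(** * Gradations and sl2-triples *)

Lemma iter_linear (K : fieldType) (V : vectType K) (f : {linear V -> V}) n a u v :
  iter n f (a *: u + v) = a *: iter n f u + iter n f v.
Proof. by elim: n => //= n ->; rewrite linearP. Qed.

Lemma iter_lin0 (K : fieldType) (V : vectType K) (f : {linear V -> V}) n :
  iter n f 0 = 0.
Proof. by elim: n => //= n ->; rewrite linear0. Qed.

Section Gradation.
Variables (R : realType) (V : vectType R) (g : int -> {vspace V}).

(** Support and projections are bundled in one witness so that a single choice extracts both. *)
Lemma decomposition_projections : direct_decomposition g ->
  exists Ppi : seq int * (int -> 'End(V)), let P := Ppi.1 in let pi := Ppi.2 in
  [/\ forall p v, pi p v \in g p, forall p v, v \in g p -> pi p v = v,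
      forall p q v, v \in g p -> p != q -> pi q v = 0,
      forall v, v = \sum_(p <- P) pi p v & forall p, p \notin P -> g p = 0%VS].
Proof.
move=> [P [uP gP sumP indP]].
pose pi0 := sumv_pi_for (esym sumP).
have pi0_mem p v : pi0 p v \in g p by exact: memv_sum_pi.
have pi0_sum v : v = \sum_(p <- P) pi0 p v.
  by rewrite sumv_pi_uniq_sum ?filter_predT ?memvf.
exists (P, fun p => if p \in P then pi0 p else 0) => /=.
have mem p v : (if p \in P then pi0 p else 0) v \in g p.
  by case: ifP; rewrite ?zero_lfunE ?mem0v.
have uniq_dec v w : (forall p, w p \in g p) -> v = \sum_(p <- P) w p ->
    forall p, p \in P -> pi0 p v = w p.
  move=> wg vw p _; apply/eqP; rewrite -subr_eq0; apply/eqP.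
  apply: (indP (fun p => pi0 p v - w p)) => [q|]; first exact: memvB.
  by rewrite sumrB -pi0_sum -vw subrr.
have single p v q : v \in g p -> q \in P -> pi0 q v = if q == p then v else 0.
  move=> vp qP; apply: (uniq_dec v (fun q => if q == p then v else 0)) => //.
    by move=> r; case: eqP => [->|_]; rewrite ?mem0v.
  have [pP|pP] := boolP (p \in P).
    rewrite (bigD1_seq p) //= eqxx big1 ?addr0 // => r /negPf -> //.
  move: vp; rewrite gP // memv0 => /eqP->.
  by rewrite big1 // => r _; case: ifP.
split=> //.
- move=> p v vp; case: ifP => [pP|/negbT/gP gp0].
    by rewrite (single p) // eqxx.
  by move: vp; rewrite gp0 memv0 zero_lfunE => /eqP.
- move=> p q v vp pq; case: ifP => [qP|_]; last by rewrite zero_lfunE.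
  by rewrite (single p) // eq_sym (negPf pq).
- move=> v; rewrite {1}[v]pi0_sum; apply: eq_big_seq => p ->; exact: erefl.
Qed.

Variable dg : direct_decomposition g.

Definition gdata := projT1 (cid (decomposition_projections dg)).
Definition gsupp : seq int := gdata.1.
Definition gcomp (p : int) : 'End(V) := gdata.2 p.

Let gdataP := projT2 (cid (decomposition_projections dg)).

Lemma gcomp_mem p v : gcomp p v \in g p.
Proof. by have [mem _ _ _ _] := gdataP; exact: mem. Qed.

Lemma gcomp_id p v : v \in g p -> gcomp p v = v.
Proof. by have [_ id _ _ _] := gdataP; exact: id. Qed.

Lemma gcomp_other p q v : v \in g p -> p != q -> gcomp q v = 0.
Proof. by have [_ _ other _ _] := gdataP; exact: other. Qed.

Lemma gcomp_sum v : v = \sum_(p <- gsupp) gcomp p v.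
Proof. by have [_ _ _ sum _] := gdataP; exact: sum. Qed.

Lemma gsupp0 p : p \notin gsupp -> g p = 0%VS.
Proof. by have [_ _ _ _ zero] := gdataP; exact: zero. Qed.

Lemma gcomp_eq v w : (forall p, gcomp p v = gcomp p w) -> v = w.
Proof. by move=> vw; rewrite [v]gcomp_sum [w]gcomp_sum; apply: eq_bigr => p _. Qed.

Lemma grade_ind (P : V -> Prop) : P 0 -> (forall u v, P u -> P v -> P (u + v)) ->
  (forall p v, v \in g p -> P v) -> forall v, P v.
Proof.
move=> P0 PD Pg v; rewrite [v]gcomp_sum; apply: (big_ind P) => // p _.
exact: Pg (gcomp_mem p v).
Qed.

Lemma grade_bounded : exists N : nat, forall p : int, (N < `|p|)%N -> g p = 0%VS.
Proof.
exists (\max_(p <- gsupp) `|p|%N) => p Np; apply: gsupp0; apply: contraL Np.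
move=> pP; rewrite -leqNgt (big_rem p pP) /=; exact: leq_maxl.
Qed.

(** The Euler operator; it does the work of a grading element without one being sought in the
    algebra. *)
Definition degree : 'End(V) := \sum_(p <- gsupp) p%:~R *: gcomp p.

Lemma degreeE p v : v \in g p -> degree v = p%:~R *: v.
Proof.
move=> vp; rewrite sum_lfunE [X in _ = _ *: X]gcomp_sum scaler_sumr.
apply: eq_bigr => q _; rewrite scale_lfunE.
by have [<- //|pq] := eqVneq p q; rewrite (gcomp_other vp pq) !scaler0.
Qed.

Lemma shift_nilpotent (f : 'End(V)) (k : int) : k != 0 ->
  (forall p v, v \in g p -> f v \in g (p + k)) -> nilpotent_map f.
Proof.
(* Nonzero degrees of [V] lie between [-N] and [N], so [(N + N).+1] shifts by a nonzero integer
   leave this range. *)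
move=> k0 fg; have [N gN] := grade_bounded; exists (N + N).+1 => v.
elim/grade_ind: v => [|u v u0 v0|p v vp].
- exact: iter_lin0.
- by rewrite -[u]scale1r iter_linear u0 v0 scaler0 addr0.
have iterg n : iter n f v \in g (p + k *+ n).
  elim: n => [|n IHn]; first by rewrite mulr0n addr0.
  by rewrite iterS mulrS (addrC k) addrA; exact: fg.
have [Np|pN] := ltnP N `|p|.
  move: vp; rewrite gN // memv0 => /eqP->.
  exact: iter_lin0.
have := iterg (N + N).+1; rewrite gN ?memv0 => [/eqP //|].
have : (`|k *+ (N + N).+1| >= (N + N).+1)%N.
  by rewrite -mulr_natr abszM natz leq_pmull // absz_gt0.
move: (k *+ _) => m; lia.
Qed.

End Gradation.

Section GradedModule.
Variables (R : realType) (s : lieAlgebra R) (l : lieModule s).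
Variables (gs : int -> {vspace s}) (gl : int -> {vspace l}).
Hypothesis glr : graded_module gs gl.
Local Notation dgl := (glr.1 : direct_decomposition gl).

Lemma grade_act p q x y : x \in gs p -> y \in gl q -> mod_act x y \in gl (p + q).
Proof. exact: glr.2. Qed.

Lemma gcomp_act p q x y : x \in gs p ->
  gcomp dgl (p + q) (mod_act x y) = mod_act x (gcomp dgl q y).
Proof.
move=> xp; elim/(grade_ind dgl): y => [|u v Hu Hv|r v vr].
- by rewrite !(mod_act0r, linear0).
- by rewrite mod_actDr !linearD /= mod_actDr Hu Hv.
have [<-|rq] := eqVneq r q.
  by rewrite (gcomp_id dgl vr) gcomp_id // grade_act.
rewrite (gcomp_other dgl vr rq) mod_act0r (gcomp_other dgl (grade_act xp vr)) //.
by apply: contra rq => /eqP/addrI->.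
Qed.

End GradedModule.

Section ShiftProduct.
Variables (R : realType) (V W : lmodType R).

(** The product of the operators [T - c j] for [j < n]; it replaces a decomposition into weight
    spaces when [T] is not known to be diagonalizable. *)
Fixpoint shift_prod (T : V -> V) (c : nat -> R) n z :=
  if n is n'.+1 then T (shift_prod T c n' z) - c n' *: shift_prod T c n' z else z.

Lemma shift_prod_stable (P : V -> Prop) T c n z :
  (forall j y, P y -> P (T y - c j *: y)) -> P z -> P (shift_prod T c n z).
Proof. by move=> PT Pz; elim: n => //= n; exact: PT. Qed.

Lemma shift_prod_inj (P : V -> Prop) T c n z :
  (forall j y, P y -> P (T y - c j *: y)) ->
  (forall j y, P y -> T y - c j *: y = 0 -> y = 0) ->
  P z -> shift_prod T c n z = 0 -> z = 0.
Proof.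
move=> PT Tinj Pz; elim: n => //= n IHn Tn; apply: IHn; apply: Tinj Tn.
exact: shift_prod_stable.
Qed.

End ShiftProduct.

Lemma shift_prod_intertwine (R : realType) (V W : lmodType R) (F : V -> W)
    (P : V -> Prop) T T' (c c' : nat -> R) n z :
  (forall j y, P y -> P (T y - c j *: y)) ->
  (forall j y, P y -> T' (F y) - c' j *: F y = F (T y - c j *: y)) -> P z ->
  shift_prod T' c' n (F z) = F (shift_prod T c n z).
Proof.
by move=> PT TF Pz; elim: n => //= n ->; rewrite TF //; exact: shift_prod_stable.
Qed.

(** * The kernel of the raising operator in a module, modulo a stable subspace *)

Section Sl2.
Variables (R : realType) (s : lieAlgebra R) (l : lieModule s) (e f h : s).
Variable N : {vspace l}.
Hypothesis ef : lie_br e f = h.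
Hypothesis he : lie_br h e = 2%:R *: e.
Hypothesis eN : forall y, y \in N -> mod_act e y \in N.
Hypothesis fN : forall y, y \in N -> mod_act f y \in N.
Hypothesis e_nil : exists k, forall y, iter k (mod_act e) y \in N.
Implicit Types y z u : l.

Lemma sl2_hN y : y \in N -> mod_act h y \in N.
Proof. by move=> yN; rewrite -ef mod_actbr; apply: memvB; [exact/eN/fN | exact/fN/eN]. Qed.

Lemma sl2_ef y : mod_act e (mod_act f y) = mod_act f (mod_act e y) + mod_act h y.
Proof. by rewrite -ef mod_actbr addrC subrK. Qed.

Lemma sl2_eh y : mod_act e (mod_act h y) = mod_act h (mod_act e y) - 2%:R *: mod_act e y.
Proof. by rewrite -mod_actZl -he mod_actbr subKr. Qed.

(** Only [ef] and [he] enter, so that the identity can also serve to complete a pair [e], [f] to a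
    triple. *)
Lemma sl2_iter n u : iter n.+1 (mod_act e) (mod_act f u)
  = mod_act f (iter n.+1 (mod_act e) u)
    + n.+1%:R *: (mod_act h (iter n (mod_act e) u) - n%:R *: iter n (mod_act e) u).
Proof.
elim: n => [|n IHn]; first by rewrite /= sl2_ef scale1r scale0r subr0.
rewrite iterS IHn mod_actDr sl2_ef -iterS mod_actZr mod_actBr mod_actZr sl2_eh -!iterS.
set v := iter n.+1 _ u; rewrite -addrA; congr (_ + _).
rewrite -{1}[mod_act h v]scale1r -addrA -opprD -scalerDl !scalerBr !scalerA.
by rewrite addrA -scalerDl; congr (_ *: _ - _ *: _); rewrite -?natrD -?natrM ?natrX;
  congr _%:R; lia.
Qed.

Definition e_image n z := exists u, z - iter n (mod_act e) u \in N.

Lemma iter_act_linear n a u v : iter n (mod_act e) (a *: u + v)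
  = a *: iter n (mod_act e) u + iter n (mod_act e) v.
Proof. exact: (iter_linear (mklin (mod_act_linearr e))). Qed.

Lemma e_image_linear n a y z : e_image n y -> e_image n z -> e_image n (a *: y + z).
Proof.
move=> [u yu] [v zv]; exists (a *: u + v).
by rewrite iter_act_linear opprD addrACA -scalerBr memvD ?memvZ.
Qed.

Lemma e_imageN n z : z \in N -> e_image n z.
Proof.
by exists 0; rewrite (iter_lin0 (mklin (mod_act_linearr e))) subr0.
Qed.

Lemma e_image0 z : e_image 0 z.
Proof. by exists z; rewrite subrr mem0v. Qed.

(** If [z] is [e^n u] modulo [N], then [e^(n+1) u] lies in [N], and [sl2_iter] exhibits [(h - n) z]
    as [e^(n+1)] of [f u / (n + 1)]. *)
Lemma e_image_next n z : mod_act e z \in N -> e_image n z ->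
  e_image n.+1 (mod_act h z - n%:R *: z).
Proof.
move=> ez [u zu]; exists (n.+1%:R^-1 *: mod_act f u).
set w := iter n (mod_act e) u in zu *.
have ew : iter n.+1 (mod_act e) u \in N.
  rewrite iterS -/w -(subKr z w) mod_actBr.
  by apply: memvB; [exact: ez | exact: eN].
have -> : iter n.+1 (mod_act e) (n.+1%:R^-1 *: mod_act f u)
    = n.+1%:R^-1 *: mod_act f (iter n.+1 (mod_act e) u)
      + (mod_act h w - n%:R *: w).
  rewrite -[_ *: mod_act f u]addr0 iter_act_linear.
  rewrite (iter_lin0 (mklin (mod_act_linearr e))) addr0 sl2_iter scalerDr.
  by rewrite scalerA mulVf ?scale1r // pnatr_eq0.
set r := _ - w in zu.
have -> : mod_act h z - n%:R *: z = (mod_act h r - n%:R *: r) + (mod_act h w - n%:R *: w).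
  by rewrite addrACA -opprD -mod_actDr -scalerDr subrK.
rewrite opprD addrACA subrr addr0; apply: memvB; last exact/memvZ/fN.
by apply: memvB; [exact: sl2_hN | exact: memvZ].
Qed.

(** On [z], modulo [N], the operator [h - n] is the nonzero scalar [c - n] for each [n >= m]. By
    [e_image_next], [z] then lies in the images of all powers of [e], and [e] is nilpotent modulo
    [N]. *)
Lemma sl2_ker_weight m (c : R) z : (forall j, (m <= j)%N -> c != j%:R) ->
  mod_act e z \in N -> e_image m z -> mod_act h z - c *: z \in N -> z \in N.
Proof.
move=> cj ez mz hz.
have im k : e_image (m + k) z.
  elim: k => [|k IHk]; first by rewrite addn0.
  have := e_image_next ez IHk; rewrite -addnS => zk.
  have cmk : c - (m + k)%:R != 0 by rewrite subr_eq0 cj ?leq_addr.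
  have -> : z = (c - (m + k)%:R)^-1 *: (mod_act h z - (m + k)%:R *: z)
      + - (c - (m + k)%:R)^-1 *: (mod_act h z - c *: z).
    rewrite scaleNr -scalerBr opprB [X in _ *: X]addrC addrA subrK -scalerBl.
    by rewrite scalerA mulVf ?scale1r.
  by apply: e_image_linear; rewrite // -[_ *: _]addr0; apply: e_imageN;
    rewrite addr0 memvZ.
have [k ek] := e_nil; have [u] := im k.
rewrite addnC iterD => zu.
by rewrite -[z](subrK (iter k (mod_act e) (iter m (mod_act e) u))) memvD.
Qed.

(** Each factor [h - j] raises the power of [e] whose image contains the vector, until that power is
    zero modulo [N]. *)
Lemma sl2_ker_annihilated : exists n, forall z,
  mod_act e z \in N -> shift_prod (mod_act h) (fun j => j%:R) n z \in N.
Proof.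
have [k ek] := e_nil; exists k => z ez.
pose w n := shift_prod (mod_act h) (fun j => j%:R) n z.
have wp n : mod_act e (w n) \in N /\ e_image n (w n).
  elim: n => [|n [IHe IHn]]; first by split => //; exact: e_image0.
  split; last exact: e_image_next.
  by rewrite /= mod_actBr mod_actZr sl2_eh !memvB ?memvZ ?sl2_hN.
have [_ [u]] := wp k.
by move=> zu; rewrite -/(w k) -[w k](subrK (iter k (mod_act e) u)) memvD.
Qed.

End Sl2.

Section NilpotentTrace.
Variables (R : realType) (V : vectType R).
Implicit Types f g : 'End(V).

Lemma endmx_comp f g : endmx (f \o g)%VF = endmx g *m endmx f.
Proof. by rewrite /endmx (@mxof_comp _ _ _ _ (bas V) (bas V)) ?basP. Qed.

Lemma rVof_iter f n v :
  rVof (bas V) (iter n f v) = rVof (bas V) v *m endmx f ^+ n.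
Proof.
elim: n v => [|n IHn] v; first by rewrite mulmx1.
rewrite iterSr IHn exprS -mulmxE mulmxA; congr (_ *m _).
by rewrite mul_mxof rVofK ?basP.
Qed.

Lemma endmx_nilpotent f : nilpotent_map f <-> exists n, endmx f ^+ n = 0.
Proof.
split=> [] [n fn]; exists n; last first.
  by move=> v; apply/eqP; rewrite -(rVof_eq0 (basP V)) rVof_iter fn mulmx0.
apply/row_matrixP => i; rewrite rowE row0 -[delta_mx _ _](vecofK (basP V)).
by rewrite -rVof_iter fn linear0.
Qed.

Lemma lftr_nilpotent f : nilpotent_map f -> lftr f = 0.
Proof.
move=> /endmx_nilpotent[n fn]; apply: complexI; rewrite -cmx_trace.
have [r -> memr] := mxtrace_eigen (cmx f).
rewrite big_seq big1 // => z; rewrite memr => /eigenvalueP[v vz v0].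
have vk k : v *m cmx f ^+ k = z ^+ k *: v.
  elim: k => [|k IHk]; first by rewrite mulmx1 scale1r.
  by rewrite exprSr -mulmxE mulmxA IHk -scalemxAl vz scalerA -exprSr.
have : cmx f ^+ n = 0.
  rewrite /cmx; have map_exp k : (map_mx (real_complex R) (endmx f)) ^+ k
      = map_mx (real_complex R) (endmx f ^+ k).
    elim: k => [|k IHk]; first by rewrite !expr0 map_mx1.
    by rewrite !exprS IHk -!mulmxE map_mxM.
  by rewrite map_exp fn map_mx0.
move=> f0; have /esym/eqP := vk n; rewrite f0 mulmx0 scaler_eq0 (negPf v0) orbF.
by rewrite expf_eq0 => /andP[_ /eqP].
Qed.

End NilpotentTrace.

(* A nilpotent [a] commuting with [[a, b]] forces [[a, b]] to be nilpotent:
   [c ^+ m * a ^+ j = 0] implies [c ^+ (2 * m + 1) * a ^+ j.-1 = 0]. *)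
Lemma commutator_nilpotent (R : numFieldType) d (a b : 'M[R]_d) n :
  a * (a * b - b * a) = (a * b - b * a) * a -> a ^+ n = 0 ->
  exists m, (a * b - b * a) ^+ m = 0.
Proof.
set c := a * b - b * a => ac an0.
have acm m : GRing.comm (a ^+ m) c by apply/commr_sym/commrX.
have ajb j : a ^+ j.+1 * b = b * a ^+ j.+1 + (c * a ^+ j) *+ j.+1.
  elim: j => [|j IHj]; first by rewrite !expr1 mulr1 /c addrC subrK.
  rewrite exprS -mulrA IHj mulrDr mulrA.
  have -> : a * b = b * a + c by rewrite /c addrC subrK.
  rewrite mulrDl -mulrA -exprS -addrA; congr (_ + _).
  rewrite mulrnAr mulrA ac -mulrA -exprS [in RHS]mulrS.
  by [].
suff desc m : c ^+ m * a ^+ n = 0 -> exists k, c ^+ k = 0.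
  by apply: (desc 0%N); rewrite an0 mulr0.
elim: n m {an0} => [|n IHn] m cam; first by exists m; rewrite mulr1 in cam.
apply: (IHn (m + m).+1).
have := congr1 (fun x => x * b * c ^+ m) cam; rewrite !mul0r -(mulrA (c ^+ m)) ajb.
have E1 : c ^+ m * (b * a ^+ n.+1) * c ^+ m = 0.
  by rewrite -!mulrA (commrX m (acm n.+1)) cam !mulr0.
rewrite mulrDr mulrDl E1 add0r.
rewrite mulrnAr mulrnAl -!mulrA (commrX m (acm n)) !mulrA -exprSr -exprD.
rewrite addSn => /eqP; rewrite -scaler_nat scaler_eq0 pnatr_eq0 /= => /eqP.
by [].
Qed.

(** * Duality for a nondegenerate Killing form *)

Section KillingRepresentation.
Variables (R : realType) (s : lieAlgebra R).
Hypothesis nd : forall x : s, (forall y, killing x y = 0) -> x = 0.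

Lemma killing_suml I (r : seq I) (P : pred I) (F : I -> s) y :
  killing (\sum_(i <- r | P i) F i) y = \sum_(i <- r | P i) killing (F i) y.
Proof.
by apply: (big_morph (fun x => killing x y)) => [u v|]; rewrite ?killingDl ?killing0l.
Qed.

Lemma killing_sumr I (r : seq I) (P : pred I) (F : I -> s) y :
  killing y (\sum_(i <- r | P i) F i) = \sum_(i <- r | P i) killing y (F i).
Proof. by rewrite killingC killing_suml; apply: eq_bigr => i _; rewrite killingC. Qed.

Lemma killing_represents (g : 'Hom(s, R^o)) : exists z, forall x, g x = killing z x.
Proof.
pose e := bas s.
pose G : 'M[R]_(\dim {:s}) := \matrix_(i, j) killing e`_i e`_j.
pose c : 'rV[R]_(\dim {:s}) := \row_j g e`_j.
have mulG (v : 'rV_(\dim {:s})) j : (v *m G) 0 j = killing (vecof e v) e`_j.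
  by rewrite mxE killing_suml; apply: eq_bigr => i _; rewrite killingZl mxE.
have Gunit : G \in unitmx.
  rewrite -row_free_unit; apply: inj_row_free => v vG.
  apply/eqP; rewrite -(vecof_eq0 (basP s)); apply/eqP/nd => y.
  rewrite (coord_basis (basP s) (memvf y)) killing_sumr big1 // => j _.
  by rewrite killingZr -mulG vG mxE mulr0.
exists (vecof e (c *m invmx G)) => x.
rewrite (coord_basis (basP s) (memvf x)) linear_sum killing_sumr.
by apply: eq_bigr => j _; rewrite linearZ killingZr -mulG mulmxKV // mxE.
Qed.

(** A functional vanishing on the image of [Q] is represented by an element of its kernel. *)
Lemma self_adjoint_image (Q : 'End(s)) x :
  (forall y z, killing (Q y) z = killing y (Q z)) ->
  (forall z, Q z = 0 -> killing z x = 0) -> exists y, Q y = x.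
Proof.
move=> Qadj Qx; have [/memv_imgP[y _ ->]|xQ] := boolP (x \in limg Q); first by exists y.
have [g [gQ]] := separating_functional xQ.
have [z gz] := killing_represents g; rewrite gz Qx ?eqxx //.
by apply: nd => y; rewrite Qadj -gz gQ // memv_img ?memvf.
Qed.

End KillingRepresentation.

Section GradedKilling.
Variables (R : realType) (s : lieAlgebra R) (gs : int -> {vspace s}).
Hypothesis gr : graded_lie gs.
Local Notation dg := (gr.1 : direct_decomposition gs).

Lemma grade_br p q x y : x \in gs p -> y \in gs q -> lie_br x y \in gs (p + q).
Proof. exact: gr.2. Qed.

(** The composite of the two adjoint maps shifts degrees by [p + q], so it is nilpotent. *)
Lemma killing_grade p q x y : x \in gs p -> y \in gs q -> p + q != 0 ->
  killing x y = 0.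
Proof.
move=> xp yq pq; apply: lftr_nilpotent; apply: (shift_nilpotent dg pq) => r v vr.
by rewrite comp_lfunE !adE [p + q]addrC addrA addrC grade_br // addrC grade_br.
Qed.

Lemma gcomp_br p q x y : x \in gs p -> gcomp dg (p + q) (lie_br x y) =
  lie_br x (gcomp dg q y).
Proof.
by move=> xp; exact: (gcomp_act gr).
Qed.

Lemma killing_gcomp p x y : y \in gs p -> killing x y = killing (gcomp dg (- p) x) y.
Proof.
move=> yp; elim/(grade_ind dg): x => [|u v Hu Hv|r v vr].
- by rewrite linear0.
- by rewrite linearD !killingDl Hu Hv.
have [rp|rp] := eqVneq r (- p); first by rewrite gcomp_id -?rp.
rewrite (gcomp_other dg vr rp) killing0l; apply: (killing_grade vr yp).
by rewrite addr_eq0.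
Qed.

Lemma ad_grade_nilpotent p x : p != 0 -> x \in gs p -> nilpotent_map (lie_br x).
Proof.
move=> p0 xp; have [n xn] : nilpotent_map (ad x).
  by apply: (shift_nilpotent dg p0) => q v vq; rewrite adE addrC grade_br.
by exists n => v; rewrite -(xn v); apply: eq_iter => u; rewrite adE.
Qed.

(** The commutator [c] of [a] and [b] commutes with [a], so it is nilpotent. It also commutes with
    the degree operator [d], whence [tr (c d) = 0]. As the commutator of [b] with [d] is [- p b],
    this trace is [- p tr (a b)]. *)
Lemma killing_ker_ad2 p e z : p != 0 -> e \in gs p -> z \in gs (- p) ->
  lie_br e (lie_br e z) = 0 -> killing e z = 0.
Proof.
move=> p0 ep zp eez.
pose a := endmx (ad e); pose b := endmx (ad z); pose d := endmx (degree dg).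
pose c := a * b - b * a.
have cE : c = - endmx (ad (lie_br e z)).
  by rewrite ad_br /endmx linearB /= -!/(endmx _) !endmx_comp opprB.
have dE (k : int) x : x \in gs k -> endmx (ad x) * d - d * endmx (ad x)
    = k%:~R *: endmx (ad x).
  move=> xk; rewrite -!mulmxE -!endmx_comp /endmx -linearB -linearZ; congr mxof.
  apply/lfunP => v; elim/(grade_ind dg): v => [|u v Hu Hv|r v vr].
  - by rewrite !linear0.
  - by rewrite !linearD /= Hu Hv.
  rewrite add_lfunE opp_lfunE scale_lfunE !comp_lfunE !adE (degreeE dg vr).
  by rewrite (degreeE dg (grade_br xk vr)) lie_brZr -scalerBl rmorphD /= addrK.
have ac : a * c = c * a.
  rewrite cE mulrN mulNr; congr (- _); rewrite -!mulmxE -!endmx_comp.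
  congr endmx; apply/eqP; rewrite -subr_eq0 -ad_br; apply/eqP.
  by rewrite lie_brC eez oppr0 ad0.
have [n an] : exists n, a ^+ n = 0.
  have [n en] := ad_grade_nilpotent p0 ep.
  apply/endmx_nilpotent; exists n => v; rewrite -(en v); apply: eq_iter => u.
  by rewrite adE.
have [m cm] := commutator_nilpotent ac an.
have cd : GRing.comm c d.
  have ez0 : lie_br e z \in gs 0 by rewrite -(subrr p) grade_br.
  rewrite /GRing.comm cE mulrN mulNr; congr (- _); apply/eqP; rewrite -subr_eq0.
  by rewrite (dE 0) // scale0r.
have tr_cd : \tr (c * d) = 0.
  pose F := hommx (bas s) (bas s) (c * d).
  have FE : endmx F = c * d by exact: (hommxK (basP s) (basP s)).
  have /lftr_nilpotent : nilpotent_map F.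
    by apply/endmx_nilpotent; exists m; rewrite FE exprMn_comm // cm mul0r.
  by rewrite /lftr FE.
have : \tr (c * d) = - (p%:~R * \tr (a * b)).
  rewrite /c mulrBl -[a * b * d]mulrA linearB /= -[b * a * d]mulrA.
  rewrite [\tr (b * _)]mxtrace_mulC !mulmxE -[a * d * b]mulrA.
  rewrite -linearB -mulrBr /= (dE (- p)) // -mulmxE -scalemxAr mxtraceZ mulmxE.
  by rewrite rmorphN mulNr.
rewrite tr_cd => /eqP; rewrite eq_sym oppr_eq0 mulf_eq0 intr_eq0 (negPf p0) /=.
by move=> /eqP ab; rewrite /killing /lftr endmx_comp mxtrace_mulC.
Qed.

Hypothesis nd : forall x : s, (forall y, killing x y = 0) -> x = 0.

(** The square of [ad e] is self-adjoint and [e] is orthogonal to its kernel by [killing_ker_ad2].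
    Hence [e = [e, [e, x]]] for some [x], and [f] is the component of [-2 x] in degree [- p]. *)
Lemma jacobson_morozov_weak p e : p != 0 -> e \in gs p ->
  exists2 f, f \in gs (- p) & lie_br (lie_br e f) e = 2%:R *: e.
Proof.
move=> p0 ep; pose Q : 'End(s) := (ad e \o ad e)%VF.
have QE x : Q x = lie_br e (lie_br e x) by rewrite comp_lfunE !adE.
have [||x xe] := self_adjoint_image nd (Q := Q) (x := e).
- move=> y z; rewrite !QE lie_brC killingNl killing_br [lie_br e y]lie_brC.
  by rewrite killingNl killing_br opprK.
- move=> z; rewrite QE => ez.
  have Qz : lie_br e (lie_br e (gcomp dg (- p) z)) = 0.
    by rewrite -!(gcomp_br _ _ ep) ez linear0.
  by rewrite (killing_gcomp _ ep) killingC (killing_ker_ad2 p0 ep) // gcomp_mem.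
exists (gcomp dg (- p) (- 2%:R *: x)); first exact: gcomp_mem.
rewrite lie_brC -!(gcomp_br _ _ ep) subrr addr0 !lie_brZr -QE xe.
by rewrite gcomp_id ?memvZ // scaleNr opprK.
Qed.

End GradedKilling.

(* Morozov: the defect [h, f] + 2 f lies in the centralizer of [e], where
   [ad h + 2] is invertible because [ad h] has eigenvalues in the natural numbers. *)
Lemma jacobson_morozov_complete (R : realType) (s : lieAlgebra R) (e f h : s)
    (B : {vspace s}) :
  lie_br e f = h -> lie_br h e = 2%:R *: e -> nilpotent_map (lie_br e) ->
  f \in B -> (forall x, x \in B -> lie_br h x \in B) ->
  exists f', [/\ f' \in B, lie_br e f' = h & lie_br h f' = - 2%:R *: f'].
Proof.
move=> ef he [n en] fB hB.
pose K := (B :&: lker (ad e))%VS.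
have KP x : (x \in K) = (x \in B) && (lie_br e x == 0).
  by rewrite memv_cap memv_ker adE.
pose T : 'End(s) := ad h + 2%:R *: \1%VF.
have TE x : T x = lie_br h x + 2%:R *: x.
  by rewrite add_lfunE scale_lfunE id_lfunE adE.
have TK x : x \in K -> T x \in K.
  rewrite !KP TE => /andP[xB /eqP ex]; rewrite memvD ?memvZ ?hB //=.
  have := sl2_eh (l := adjoint s) he x => /= ehx.
  by rewrite lie_brDr lie_brZr ehx ex lie_br0r !scaler0 subr0 addr0.
have TK0 x : x \in K -> T x = 0 -> x = 0.
  rewrite KP TE => /andP[xB /eqP ex] Tx; apply/eqP; rewrite -memv0.
  apply: (sl2_ker_weight (l := adjoint s) ef he _ _ _ (m := 0%N) (c := - 2%:R)).
  - by move=> y; rewrite !memv0 => /eqP-> /=; rewrite lie_br0r.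
  - by move=> y; rewrite !memv0 => /eqP-> /=; rewrite lie_br0r.
  - by exists n => y; rewrite memv0 /= en.
  - move=> j _; apply/eqP => /eqP; rewrite eq_sym -addr_eq0 -natrD pnatr_eq0.
    by rewrite addn_eq0 andbF.
  - by rewrite memv0 /= ex.
  - exact: e_image0.
  - by rewrite memv0 /= scaleNr opprK Tx.
have TKK : (T @: K)%VS = K.
  apply/eqP; rewrite eqEdim; apply/andP; split.
    by apply/subvP => _ /memv_imgP[x xK ->]; exact: TK.
  rewrite limg_dim_eq //; apply/eqP; rewrite -subv0; apply/subvP => x.
  by rewrite memv_cap memv_ker memv0 => /andP[xK /eqP /(TK0 _ xK)->].
have : lie_br h f + 2%:R *: f \in K.
  rewrite KP memvD ?memvZ ?hB //=.
  have := sl2_eh (l := adjoint s) he f => /= ehf.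
  by rewrite lie_brDr lie_brZr ehf ef lie_brxx sub0r addNr.
rewrite -TKK => /memv_imgP[g gK]; rewrite TE => hfg.
move: gK; rewrite KP => /andP[gB /eqP eg].
exists (f - g); split; first exact: memvB.
  by rewrite lie_brBr ef eg subr0.
rewrite lie_brBr scaleNr scalerBr opprB; apply/eqP.
by rewrite subr_eq addrAC [_ + lie_br h g]addrC -hfg addrK.
Qed.

(** * Generation of the positive part by degree 1 *)

Section Generation.
Variables (R : realType) (s : lieAlgebra R) (gs : int -> {vspace s}).
Hypothesis gr : graded_lie gs.
Hypothesis nd : forall x : s, (forall y, killing x y = 0) -> x = 0.
Hypothesis tr : transitive_lie gs.
Local Notation dg := (gr.1 : direct_decomposition gs).

Lemma jacobson_morozov p e : p != 0 -> e \in gs p ->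
  exists f h, [/\ f \in gs (- p), h \in gs 0, lie_br e f = h,
    lie_br h e = 2%:R *: e & lie_br h f = - 2%:R *: f].
Proof.
move=> p0 ep; have [f0 f0p he] := jacobson_morozov_weak gr nd p0 ep.
have h0 : lie_br e f0 \in gs 0 by rewrite -(subrr p) (grade_br gr).
have [|f [fp ef hf]] := jacobson_morozov_complete (erefl _) he
    (ad_grade_nilpotent gr p0 ep) f0p.
  by move=> x xp; rewrite -[- p]add0r (grade_br gr).
by exists f, (lie_br e f0).
Qed.

Lemma killing_grade_nondegenerate p x : x \in gs p ->
  (forall y, y \in gs (- p) -> killing x y = 0) -> x = 0.
Proof.
move=> xp x0; apply: nd => y.
by rewrite killingC (killing_gcomp gr _ xp) killingC x0 // gcomp_mem.
Qed.

(** [ad h] is skew for the Killing form. *)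
Lemma killing_shift (h x a : s) n :
  killing (shift_prod (lie_br h) (fun j => - j%:R) n x) a
  = (-1) ^+ n * killing x (shift_prod (lie_br h) (fun j => j%:R) n a).
Proof.
elim: n a => [|n IHn] a /=; first by rewrite mul1r.
set b := shift_prod _ _ n a; rewrite scaleNr opprK killingDl killingZl.
rewrite [lie_br h _]lie_brC killingNl killing_br IHn IHn.
have -> : shift_prod (lie_br h) (fun j => j%:R) n (lie_br h a) = lie_br h b.
  apply: (@shift_prod_intertwine _ _ _ (lie_br h) xpredT) => // j y _.
  by rewrite lie_brBr lie_brZr.
by rewrite killingDr killingNr killingZr exprS; ring.
Qed.

(** In a triple [y], [f], [h], the space [gs 1] lies in the kernel of [ad y], where a product of
    operators [h - j] vanishes; by duality a product of operators [h + j] vanishes on [gs (-1)].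
    Moved past [f], which has weight -2, it becomes a product of operators [h + j + 2]. These are
    injective on the kernel of [ad y], which contains [[f, gs (-1)]]. So [f] kills [gs (-1)], and
    transitivity gives [f = 0], then [y = 0]. *)
Lemma centralizer_grade1 q y : (2 <= q)%N -> y \in gs (- q%:Z) ->
  (forall a, a \in gs 1 -> lie_br y a = 0) -> y = 0.
Proof.
move=> q2 yq ya.
have q0 : - q%:Z != 0 by lia.
have [f [h [fq h0 yf hy hf]]] := jacobson_morozov q0 yq; rewrite opprK in fq.
have N0 (x : s) : (forall z, z \in (0%VS : {vspace s}) -> lie_br x z \in (0%VS : {vspace s})).
  by move=> z; rewrite !memv0 => /eqP->; rewrite lie_br0r.
have ynil : exists k, forall z, iter k (lie_br y) z \in (0%VS : {vspace s}).
  by have [k yk] := ad_grade_nilpotent gr q0 yq; exists k => z; rewrite memv0 yk.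
have [n annih] := sl2_ker_annihilated (l := adjoint s) yf hy (N0 y) (N0 f) ynil.
have {}annih a : a \in gs 1 -> shift_prod (lie_br h) (fun j => j%:R) n a = 0.
  by move=> ag; apply/eqP; have := annih a; rewrite !memv0 /= ya // => ->.
have hg (p : int) z : z \in gs p -> lie_br h z \in gs p.
  by move=> zp; rewrite -[p]add0r (grade_br gr).
have annihN x : x \in gs (-1) -> shift_prod (lie_br h) (fun j => - j%:R) n x = 0.
  move=> xg; apply: (killing_grade_nondegenerate (p := -1)).
    apply: (shift_prod_stable (P := fun x => x \in gs (-1))) xg => j z zg.
    by rewrite memvB ?memvZ ?hg.
  move=> a; rewrite opprK => ag; rewrite killing_shift annih // killing0r.
  by rewrite mulr0.
have fx x : x \in gs (-1) -> lie_br f x = 0.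
  move=> xg.
  have yfx z : z \in gs (-1) -> lie_br y (lie_br f z) = 0.
    move=> zg; apply: (killing_grade_nondegenerate (p := -1)) => [|a].
      have -> : -1 = - q%:Z + (q%:Z + -1) by rewrite addKr.
      by rewrite !(grade_br gr).
    rewrite opprK => ag; rewrite lie_brC killingNl killing_br ya // killing0r.
    by rewrite oppr0.
  have yh z : lie_br y z = 0 -> lie_br y (lie_br h z) = 0.
    move=> yz; have := sl2_eh (l := adjoint s) hy z => /= ->.
    by rewrite yz lie_br0r scaler0 subr0.
  apply: (@shift_prod_inj _ _ (fun z => lie_br y z = 0) (lie_br h) (fun j => - (j + 2)%:R) n).
  - by move=> j z yz; rewrite lie_brBr lie_brZr yz yh // scaler0 subr0.
  - move=> j z yz hz; apply/eqP; rewrite -memv0.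
    apply: (sl2_ker_weight (l := adjoint s) yf hy (N0 y) (N0 f) ynil (m := 0%N)
      (c := - (j + 2)%:R)); rewrite ?memv0 /= ?yz ?hz ?eqxx //.
      by move=> k _; rewrite eq_sym -addr_eq0 -natrD pnatr_eq0; lia.
    exact: e_image0.
  - exact: yfx.
  rewrite (shift_prod_intertwine (P := fun z => z \in gs (-1)) (T := lie_br h) (c := fun j => - j%:R)) //.
  - by rewrite annihN ?lie_br0r.
  - by move=> j z zg; rewrite memvB ?memvZ ?hg.
  - move=> j z _; have := lie_br_br h f z; rewrite hf => /eqP.
    rewrite lie_brZl eq_sym subr_eq => /eqP->.
    rewrite lie_brBr lie_brZr [_ + lie_br f _]addrC -addrA -!scaleNr -scalerDl.
    by congr (_ + _ *: _); rewrite natrD; ring.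
have f0 : f = 0.
  apply: contrapT => f0; have [//|x xg] := tr (p := q%:Z) _ fq f0.
  by apply; rewrite /= lie_brC fx // oppr0.
apply/eqP; move: hy; rewrite -yf f0 lie_br0r lie_br0l => /esym/eqP.
by rewrite scaler_eq0 pnatr_eq0.
Qed.


(** A functional separating an element of [gs (1 + p)] from [[gs 1, gs p]] is represented in degree
    [-(1 + p)] by [z']. The brackets of [z'] with [gs 1] are orthogonal to [gs p], hence zero, and
    [centralizer_grade1] applies. *)
Lemma grade_succ (p : nat) : (0 < p)%N ->
  gs (1 + p%:Z) = mod_brv (l := adjoint s) (gs 1) (gs p%:Z).
Proof.
move=> p0; apply/eqP; rewrite eqEsubv; apply/andP; split; last first.
  by apply/(@mod_brv_subP _ _ (adjoint s)) => x y x1 yp; exact: (grade_br gr).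
apply/subvPn => -[x xp xW].
have [g [gW gx]] := separating_functional xW.
have [z gz] := killing_represents nd g.
pose z' := gcomp dg (- (1 + p%:Z)) z.
have z'E w : w \in gs (1 + p%:Z) -> killing z' w = g w.
  by move=> wp; rewrite gz -(killing_gcomp gr z wp).
case/eqP: gx; rewrite -z'E // (_ : z' = 0) ?killing0l //.
apply: (@centralizer_grade1 p.+1) => [//||a a1].
  have -> : - p.+1%:Z = - (1 + p%:Z) by lia.
  exact: gcomp_mem.
apply: (killing_grade_nondegenerate (p := - p%:Z)) => [|b].
  have -> : - p%:Z = - (1 + p%:Z) + 1 by lia.
  by rewrite (grade_br gr) // gcomp_mem.
rewrite opprK => bp; rewrite killing_br z'E ?(grade_br gr) //.
by rewrite gW // (@memv_br_mod _ _ (adjoint s)).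
Qed.

End Generation.

(** * Complexification *)

Section PairGrade.
Variables (R : realType) (V W : vectType R).
Variables (g : int -> {vspace V}) (g' : int -> {vspace W}).
Local Notation VW := (V * W : vectType R)%type.

(** Serves both complexifications, with [g' = g], and [s (+) l], where it unfolds to the same space
    as [ext_grade]. *)
Definition pair_grade (p : int) : {vspace VW} :=
  (linfun (fst : (V * W)%type -> V) @^-1: g p
   :&: linfun (snd : (V * W)%type -> W) @^-1: g' p)%VS.

Lemma mem_pair_grade p (u : VW) : (u \in pair_grade p) = (u.1 \in g p) && (u.2 \in g' p).
Proof. by rewrite memv_cap -!memv_preim !lfunE. Qed.

Lemma fst_sum I (r : seq I) (P : pred I) (F : I -> VW) :
  (\sum_(i <- r | P i) F i).1 = \sum_(i <- r | P i) (F i).1.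
Proof. exact: (big_morph (fst : VW -> V)). Qed.

Lemma snd_sum I (r : seq I) (P : pred I) (F : I -> VW) :
  (\sum_(i <- r | P i) F i).2 = \sum_(i <- r | P i) (F i).2.
Proof. exact: (big_morph (snd : VW -> W)). Qed.

Lemma gcomp_sum_grade (U : vectType R) (h : int -> {vspace U})
    (dh : direct_decomposition h) (P : seq int) (w : int -> U) :
  uniq P -> (forall p, w p \in h p) -> forall q, q \in P ->
  gcomp dh q (\sum_(p <- P) w p) = w q.
Proof.
move=> uP wh q qP; rewrite linear_sum (bigD1_seq q) //= gcomp_id // big1 ?addr0 //.
by move=> r rq; rewrite (gcomp_other dh (wh r) rq).
Qed.

Lemma gcomp_sum_subset (U : vectType R) (h : int -> {vspace U})
    (dh : direct_decomposition h) (P : seq int) u :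
  uniq P -> (forall p, p \notin P -> h p = 0%VS) -> u = \sum_(p <- P) gcomp dh p u.
Proof.
move=> uP h0; apply: (gcomp_eq (dg := dh)) => q.
have [qP|qP] := boolP (q \in P).
  by rewrite (gcomp_sum_grade dh uP (fun p => gcomp_mem dh p u) qP).
have z v : gcomp dh q v = 0.
  by have := gcomp_mem dh q v; rewrite h0 // memv0 => /eqP.
by rewrite !z.
Qed.

Lemma pair_decomposition : direct_decomposition g -> direct_decomposition g' ->
  direct_decomposition pair_grade.
Proof.
move=> dg dg'; pose P := undup (gsupp dg ++ gsupp dg').
have uP : uniq P by exact: undup_uniq.
have g0 p : p \notin P -> g p = 0%VS.
  by rewrite mem_undup mem_cat negb_or => /andP[/gsupp0].
have g'0 p : p \notin P -> g' p = 0%VS.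
  by rewrite mem_undup mem_cat negb_or => /andP[_ /gsupp0].
exists P; split=> // [p pP||w wg sum0 p].
- apply/eqP; rewrite -subv0; apply/subvP => u; rewrite mem_pair_grade g0 // g'0 //.
  by rewrite !memv0 => /andP[/eqP u1 /eqP u2]; rewrite [u]surjective_pairing u1 u2.
- apply/eqP; rewrite eqEsubv subvf; apply/subvP => u _.
  have -> : u = \sum_(p <- P) (gcomp dg p u.1, gcomp dg' p u.2).
    rewrite [LHS]surjective_pairing [RHS]surjective_pairing fst_sum snd_sum /=.
    by congr pair; exact: gcomp_sum_subset.
  rewrite big_seq; apply: memv_suml => p pP.
  rewrite (big_rem _ pP) /=; apply: (subvP (addvSl _ _)).
  by rewrite mem_pair_grade /= !gcomp_mem.
have [pP|pP] := boolP (p \in P); last first.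
  have := wg p; rewrite mem_pair_grade g0 // g'0 // !memv0 => /andP[/eqP u1 /eqP u2].
  by rewrite [w p]surjective_pairing u1 u2.
have w1 q : (w q).1 \in g q by have := wg q; rewrite mem_pair_grade => /andP[].
have w2 q : (w q).2 \in g' q by have := wg q; rewrite mem_pair_grade => /andP[].
have s1 := gcomp_sum_grade dg uP w1 pP; have s2 := gcomp_sum_grade dg' uP w2 pP.
rewrite [w p]surjective_pairing -s1 -s2 -fst_sum -snd_sum sum0 !linear0; exact: erefl.
Qed.

End PairGrade.

Section PairTrace.
Variables (R : realType) (V W : vectType R).
Local Notation VW := (V * W : vectType R)%type.

Definition inl_lfun : 'Hom(V, VW) := linfun (fun v => (v, 0) : VW).
Definition inr_lfun : 'Hom(W, VW) := linfun (fun w => (0, w) : VW).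
Definition fst_lfun : 'Hom(VW, V) := linfun (fst : (V * W)%type -> V).
Definition snd_lfun : 'Hom(VW, W) := linfun (snd : (V * W)%type -> W).

Lemma inl_linear : linear (fun v => (v, 0) : VW).
Proof. by move=> a u v; congr pair => /=; rewrite ?scaler0 ?addr0. Qed.

Lemma inr_linear : linear (fun w => (0, w) : VW).
Proof. by move=> a u v; congr pair => /=; rewrite ?scaler0 ?addr0. Qed.

Lemma inl_lfunE v : inl_lfun v = (v, 0). Proof. exact: (lfunE (mklin inl_linear)). Qed.
Lemma inr_lfunE v : inr_lfun v = (0, v). Proof. exact: (lfunE (mklin inr_linear)). Qed.
Lemma fst_lfunE u : fst_lfun u = u.1. Proof. by rewrite lfunE. Qed.
Lemma snd_lfunE u : snd_lfun u = u.2. Proof. by rewrite lfunE. Qed.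

(** Cyclicity turns both diagonal blocks into traces on the whole space, of [f] composed with
    complementary projectors. *)
Lemma lftr_pair (f : 'End(VW)) : lftr f =
  lftr (fst_lfun \o (f \o inl_lfun))%VF + lftr (snd_lfun \o (f \o inr_lfun))%VF.
Proof.
rewrite !(lftr_comp _ (_ \o _)%VF) -lftrD; congr lftr; apply/lfunP => u.
rewrite add_lfunE !comp_lfunE fst_lfunE snd_lfunE inl_lfunE inr_lfunE -linearD.
by rewrite [u in LHS]surjective_pairing; congr (f (_, _)); rewrite ?addr0 ?add0r.
Qed.

End PairTrace.

Section Complexification.
Variables (R : realType) (s : lieAlgebra R).
Local Notation ss := (s * s : vectType R)%type.
Implicit Types u v w : ss.

Definition cbr u v : ss :=
  (lie_br u.1 v.1 - lie_br u.2 v.2, lie_br u.1 v.2 + lie_br u.2 v.1).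

Lemma cbr_linearr u : linear (cbr u).
Proof.
move=> a v v'; congr pair => /=; rewrite !lie_brDr !lie_brZr.
  by rewrite scalerBr opprD addrACA.
by rewrite scalerDr addrACA.
Qed.

Lemma cbrC u v : cbr u v = - cbr v u.
Proof.
congr pair => /=; rewrite (lie_brC v.1) (lie_brC v.2) ?(lie_brC v.1) ?(lie_brC v.2).
  by rewrite opprB opprK addrC.
by rewrite opprD !opprK addrC.
Qed.

Lemma cbr_linearl v : linear (cbr^~ v).
Proof. by move=> a u u'; rewrite cbrC cbr_linearr opprD -scalerN -!cbrC. Qed.

Lemma cbrxx u : cbr u u = 0.
Proof. by congr pair => /=; rewrite ?lie_brxx ?subrr // (lie_brC u.2) subrr. Qed.

Section ComplexModule.
Variable l : lieModule s.
Local Notation ll := (l * l : vectType R)%type.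

Definition cmact u (y : ll) : ll :=
  (mod_act u.1 y.1 - mod_act u.2 y.2, mod_act u.1 y.2 + mod_act u.2 y.1).

Lemma cmact_linearr u : linear (cmact u).
Proof.
move=> a v v'; congr pair => /=; rewrite !mod_actDr !mod_actZr.
  by rewrite scalerBr opprD addrACA.
by rewrite scalerDr addrACA.
Qed.

Lemma cmact_linearl y : linear (cmact^~ y).
Proof.
move=> a v v'; congr pair => /=; rewrite !mod_actDl !mod_actZl.
  by rewrite scalerBr opprD addrACA.
by rewrite scalerDr addrACA.
Qed.

Lemma cmact_br u v y : cmact (cbr u v) y = cmact u (cmact v y) - cmact v (cmact u y).
Proof.
congr pair => /=; rewrite !(mod_actDl, mod_actDr, mod_actNl, mod_actNr, mod_actbr);
  rewrite !opprD !opprK !addrA.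
  by rewrite [LHS](ACl (1*5*7*3*2*8*6*4)).
by rewrite [LHS](ACl (1*5*7*3*2*8*6*4)).
Qed.

End ComplexModule.

Lemma cjacobi u v w : cbr u (cbr v w) + cbr v (cbr w u) + cbr w (cbr u v) = 0.
Proof.
have cbrN x y : cbr x (- y) = - cbr x y.
  have cbr0 : cbr x 0 = 0 by congr pair => /=; rewrite !lie_br0r ?subrr ?addr0.
  by have := cbr_linearr x (-1) y 0; rewrite cbr0 !addr0 !scaleN1r.
have E : cbr (cbr u v) w = cbr u (cbr v w) - cbr v (cbr u w).
  exact: (@cmact_br (adjoint s)).
by rewrite (cbrC w (cbr u v)) E (cbrC w u) cbrN opprB addrC addrA subrK subrr.
Qed.

(** The complexification as a real Lie algebra, [(u, v)] standing for [u + iv]. *)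
Definition clie : lieAlgebra R := LieAlgebra cbr_linearl cbr_linearr cbrxx cjacobi.

Definition cmod (l : lieModule s) : lieModule clie :=
  @LieModule R clie _ _ (@cmact_linearl l) (@cmact_linearr l) (@cmact_br l).

Lemma clie_brE (u v : clie) : lie_br u v =
  (lie_br u.1 v.1 - lie_br u.2 v.2, lie_br u.1 v.2 + lie_br u.2 v.1) :> ss.
Proof. by []. Qed.

Lemma cmod_actE (l : lieModule s) (u : clie) (y : cmod l) : mod_act u y =
  (mod_act u.1 y.1 - mod_act u.2 y.2, mod_act u.1 y.2 + mod_act u.2 y.1)
    :> (l * l)%type.
Proof. by []. Qed.

(** The real trace of a complex-linear map is twice the real part of its complex trace. *)
Lemma killing_clie (u v : clie) :
  killing u v = 2%:R * (killing u.1 v.1 - killing u.2 v.2).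
Proof.
rewrite {1}/killing lftr_pair mulr_natl mulr2n.
have E1 : (@fst_lfun R s s \o ((ad u \o ad v) \o @inl_lfun R s s))%VF
    = (ad u.1 \o ad v.1)%VF - (ad u.2 \o ad v.2)%VF.
  apply/lfunP => x; rewrite add_lfunE opp_lfunE !comp_lfunE inl_lfunE !adE.
  by rewrite fst_lfunE !clie_brE /= !lie_br0r subr0 add0r.
have E2 : (@snd_lfun R s s \o ((ad u \o ad v) \o @inr_lfun R s s))%VF
    = (ad u.1 \o ad v.1)%VF - (ad u.2 \o ad v.2)%VF.
  apply/lfunP => x; rewrite add_lfunE opp_lfunE !comp_lfunE inr_lfunE !adE.
  by rewrite snd_lfunE !clie_brE /= !lie_br0r addr0 sub0r lie_brNr.
by rewrite E1 E2 !lftrB.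
Qed.

Lemma clie_killing_nondegenerate :
  (forall x : s, (forall y, killing x y = 0) -> x = 0) ->
  forall u : clie, (forall v, killing u v = 0) -> u = 0.
Proof.
move=> nd u u0; rewrite [u]surjective_pairing.
have two0 : 2%:R != 0 :> R by rewrite pnatr_eq0.
congr pair; apply: nd => y; apply: (mulfI two0); rewrite mulr0.
  by rewrite -(u0 (y, 0)) killing_clie /= killing0r subr0.
apply: oppr_inj; rewrite oppr0 -(u0 (0, y)) killing_clie /= killing0r sub0r.
by rewrite mulrN.
Qed.

Lemma clie_graded (gs : int -> {vspace s}) : graded_lie gs ->
  graded_lie (s := clie) (pair_grade gs gs).
Proof.
move=> gr; split; first exact: pair_decomposition gr.1 gr.1.
move=> p q u v; rewrite !mem_pair_grade => /andP[u1 u2] /andP[v1 v2].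
by rewrite memvB ?memvD ?(grade_br gr).
Qed.

End Complexification.

Lemma lt_N1_int (p : int) : p < -1 ->
  [/\ p - 1 < -1, 0 != p & p != -1 - 1 -> p + 1 < -1].
Proof. by move=> p1; split; lia. Qed.

(** * Compatibility of degree 1 with the complex structure on [gl (-1)] *)

Section DegreeOne.
Variables (R : realType) (s : lieAlgebra R) (gs : int -> {vspace s}) (j : s).
Hypothesis gr : graded_lie gs.
Hypothesis nd : forall x : s, (forall y, killing x y = 0) -> x = 0.
Hypothesis j_deg0 : j \in gs 0.
Hypothesis j_grade0 : forall a, a \in gs 0 -> lie_br j a = 0.
Hypothesis j_gradeN1 : forall x, x \in gs (-1) -> lie_br j (lie_br j x) = - x.

Lemma j_grade p x : x \in gs p -> lie_br j x \in gs p.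
Proof. by move=> xp; rewrite -[p]add0r (grade_br gr). Qed.

(** [ad j] is skew for the Killing form, which pairs degrees 1 and -1 perfectly. *)
Lemma j_grade1 a : a \in gs 1 -> lie_br j (lie_br j a) = - a.
Proof.
move=> a1; apply/eqP; rewrite -addr_eq0; apply/eqP.
apply: (killing_grade_nondegenerate gr nd (p := 1)) => [|x xg].
  by rewrite memvD ?j_grade.
rewrite killingDl lie_brC killingNl killing_br lie_brC killingNl opprK.
by rewrite killing_br j_gradeN1 // killingNr addNr.
Qed.

(** [[a, x]] has degree 0 and therefore commutes with [j]. *)
Lemma j_swap a x : a \in gs 1 -> x \in gs (-1) ->
  lie_br a (lie_br j x) = - lie_br (lie_br j a) x.
Proof.
move=> a1 xg; have := lie_br_br j a x.
rewrite (j_grade0 (grade_br gr a1 xg)) sub0r => ->; rewrite opprK.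
exact: erefl.
Qed.

Lemma j_swap2 a x : a \in gs 1 -> x \in gs (-1) ->
  lie_br (lie_br j a) (lie_br j x) = lie_br a x.
Proof. by move=> a1 xg; rewrite j_swap ?j_grade // j_grade1 // lie_brNl opprK. Qed.

Local Notation sC := (clie s).
Local Notation gsC := (pair_grade gs gs).

(* [e = a + i [j, a]] satisfies [[j, e] = - i e], and [f] can be chosen with
   [[j, f] = i f]. *)
Lemma complex_triple a : a \in gs 1 ->
  exists f h : sC, [/\ f.1 \in gs (-1), f.2 = - lie_br j f.1, h \in gsC 0,
    lie_br ((a, lie_br j a) : sC) f = h &
    lie_br h ((a, lie_br j a) : sC) = 2%:R *: ((a, lie_br j a) : sC)
    /\ lie_br h f = - 2%:R *: f].
Proof.
move=> a1; set e : sC := (a, lie_br j a).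
have grC := clie_graded gr; have ndC := clie_killing_nondegenerate nd.
have e1 : e \in gsC 1 by rewrite mem_pair_grade /= a1 j_grade.
have [//|f0] := jacobson_morozov_weak grC ndC _ e1.
rewrite mem_pair_grade => /andP[x1 y1] he.
set x := f0.1 in x1; set y := f0.2 in y1.
(* [u - i [j, u]] is the projection of [f0 = x + i y] to the eigenspace of [j] for [i]. The
   discarded component has zero bracket with [e]: the bracket would have eigenvalue [-2 i], while
   [j] acts by 0 in degree 0. *)
pose u := 2%:R^-1 *: (x + lie_br j y).
have u1 : u \in gs (-1) by rewrite memvZ // memvD // j_grade.
have juE : - lie_br j u = 2%:R^-1 *: (y - lie_br j x).
  by rewrite /u lie_brZr lie_brDr j_gradeN1 // -scalerN opprD opprK addrC.
pose f1 : sC := (u, - lie_br j u).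
have half v : 2%:R^-1 *: (v + v) = v :> s.
  by rewrite -mulr2n -scaler_nat scalerA mulVf ?scale1r // pnatr_eq0.
have ef1 : lie_br e f1 = lie_br e f0.
  rewrite !clie_brE /= juE /u !lie_brZr -!scalerBr -!scalerDr !lie_brDr.
  rewrite !lie_brNr !j_swap2 // !(j_swap a1) //; congr pair.
  - rewrite -[RHS]half; congr (_ *: _); by rewrite opprB.
  - rewrite -[RHS]half; congr (_ *: _).
    by rewrite opprK [lie_br (lie_br j a) x + _]addrC.
(* [B] is this eigenspace in degree -1. Elements of degree 0 preserve it, so the completed [f]
   remains in it. *)
have [B BP] : exists B : {vspace sC}, forall v,
    v \in B <-> v.1 \in gs (-1) /\ v.2 = - lie_br j v.1.
  apply: vspace_of_pred; first by rewrite mem0v lie_br0r oppr0.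
  move=> c v w [v1 v2] [w1 w2]; split; first by rewrite memvD ?memvZ.
  by rewrite /= v2 w2 lie_brDr lie_brZr opprD scalerN.
have hB (h : sC) : h \in gsC 0 -> forall v, v \in B -> lie_br h v \in B.
  rewrite mem_pair_grade => /andP[h1 h2] v /BP[v1 v2]; apply/BP.
  have g0 w z : w \in gs 0 -> z \in gs (-1) -> lie_br w z \in gs (-1).
    by move=> w0 z1; rewrite -[-1]add0r (grade_br gr).
  have jw w z : w \in gs 0 -> lie_br j (lie_br w z) = lie_br w (lie_br j z).
    move=> w0; apply/eqP; rewrite -subr_eq0 -lie_br_br j_grade0 //.
    by rewrite lie_br0l.
  rewrite !clie_brE /= v2 lie_brNr opprK lie_brNr; split.
    by rewrite memvD ?g0 // j_grade.
  rewrite lie_brDr !jw // j_gradeN1 // lie_brNr opprD opprK.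
  exact: erefl.
have h0 : lie_br e f0 \in gsC 0.
  rewrite -(subrr 1) (grade_br grC) // mem_pair_grade; apply/andP; split; [exact: x1|exact: y1].
have [||f [/BP[f1E f2E] ef hf]] := jacobson_morozov_complete ef1 he
    (ad_grade_nilpotent grC (isT : 1 != 0 :> int) e1) (f := f1) (B := B).
- by apply/BP.
- exact: hB.
by exists f, (lie_br e f0).
Qed.

Variables (l : lieModule s) (gl : int -> {vspace l}) (jl : l -> l).
Hypothesis glr : graded_module gs gl.
Hypothesis jl_mem : forall y, y \in gl (-1) -> jl y \in gl (-1).
Hypothesis jl_linear : forall a y y', y \in gl (-1) -> y' \in gl (-1) ->
  jl (a *: y + y') = a *: jl y + jl y'.
Hypothesis jlK : forall y, y \in gl (-1) -> jl (jl y) = - y.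
Hypothesis jl_act0 : forall a y, a \in gs 0 -> y \in gl (-1) ->
  mod_act a (jl y) = jl (mod_act a y).
Hypothesis jl_grade0 : forall x y, x \in gs (-1) -> y \in gl 0 ->
  jl (mod_act x y) = mod_act (lie_br j x) y.
Hypothesis jl_gradeN1 : forall x y, x \in gs (-1) -> y \in gl (-1) ->
  mod_act (lie_br j x) (jl y) = mod_act x y.
Local Notation dgl := (glr.1 : direct_decomposition gl).

Lemma jl0 : jl 0 = 0.
Proof.
have := @jl_linear 1 0 0 (mem0v _) (mem0v _).
by rewrite !scale1r addr0 => /esym/eqP; rewrite -subr_eq0 addrK => /eqP.
Qed.

Lemma jlD y y' : y \in gl (-1) -> y' \in gl (-1) -> jl (y + y') = jl y + jl y'.
Proof. by move=> yg y'g; have := jl_linear 1 yg y'g; rewrite !scale1r. Qed.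

Lemma jlN y : y \in gl (-1) -> jl (- y) = - jl y.
Proof.
by move=> yg; have := jl_linear (-1) yg (mem0v _); rewrite jl0 !addr0 !scaleN1r.
Qed.

Local Notation lC := (cmod l).
Local Notation glC := (pair_grade gl gl).

(* The elements of degree at least -1 whose component of degree -1 is in the
   eigenspace of [jl] to which the action of [f] on degree 0 leads. *)
Definition lower_pred (v : lC) : Prop :=
  (forall p, p < -1 -> gcomp dgl p v.1 = 0 /\ gcomp dgl p v.2 = 0) /\
  gcomp dgl (-1) v.2 = - jl (gcomp dgl (-1) v.1).

Lemma lower_space : exists N : {vspace lC}, forall v, v \in N <-> lower_pred v.
Proof.
apply: vspace_of_pred.
  by split=> [p _|]; rewrite !linear0 ?jl0 ?oppr0.
move=> c u v [u1 u2] [v1 v2]; split=> [p p1|].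
  have [u10 u20] := u1 p p1; have [v10 v20] := v1 p p1.
  by split; rewrite linearP /= ?u10 ?u20 ?v10 ?v20 scaler0 addr0.
rewrite !linearP /= u2 v2 jl_linear ?gcomp_mem //.
by rewrite opprD scalerN.
Qed.

Lemma cmod_shift_nilpotent p (u : clie s) : p != 0 -> u \in pair_grade gs gs p ->
  nilpotent_map (mod_act u : lC -> lC).
Proof.
rewrite mem_pair_grade => p0 /andP[u1 u2].
have dgC := pair_decomposition dgl dgl.
have [n un] : nilpotent_map (rho u : 'End(lC)).
  apply: (shift_nilpotent dgC p0) => q v; rewrite (@rhoE _ _ lC u v) !mem_pair_grade.
  by move=> /andP[v1 v2]; rewrite /= [q + p]addrC memvB ?memvD ?(grade_act glr).
by exists n => v; rewrite -(un v); apply: eq_iter => w; exact: esym (rhoE _ _).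
Qed.

(** The claim is that the first component of [w = e Y] vanishes, where [e = a + i [j, a]] and
    [Y = y + i jl y] both have eigenvalue [-i]. Modulo the space [N] of [lower_space], [e] kills
    [Y], so a product of operators [h - m] with [m >= 0] sends [Y] into [N], hence to 0 because the
    two eigenspaces of [jl] are independent. On the kernel of [f], however, the weights of [h] are
    at most 0; this forces [f w = 0], then [w = 0]. *)
Lemma degree_one_act a y : a \in gs 1 -> y \in gl (-1) ->
  mod_act a y = mod_act (lie_br j a) (jl y).
Proof.
move=> a1 y1; have [f [h [fg fE h0 ef [he hf]]]] := complex_triple a1.
set e : sC := (a, lie_br j a) in ef he.
have ja1 := j_grade a1; have jf1 := j_grade fg.
move: h0; rewrite mem_pair_grade => /andP[h10 h20].
have h_act x v : x \in gs 0 -> v \in gl (-1) -> mod_act x v \in gl (-1).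
  by move=> x0 v1; rewrite -[-1]add0r (grade_act glr).
have [N NP] := lower_space.
have eN v : v \in N -> mod_act e v \in N.
  move=> /NP[vlow v1]; apply/NP.
  have shift p : gcomp dgl p (mod_act e v).1 = mod_act a (gcomp dgl (p - 1) v.1)
        - mod_act (lie_br j a) (gcomp dgl (p - 1) v.2) /\
      gcomp dgl p (mod_act e v).2 = mod_act a (gcomp dgl (p - 1) v.2)
        + mod_act (lie_br j a) (gcomp dgl (p - 1) v.1).
    have pE : p = 1 + (p - 1) by rewrite addrC subrK.
    by rewrite /= {1 4}pE linearB linearD /= !(gcomp_act glr).
  split=> [p p1|].
    have [-> ->] := shift p; have [|-> ->] := vlow (p - 1); first by have [] := lt_N1_int p1.
    by rewrite !mod_act0r subr0 addr0.
  have [-> ->] := shift (-1); have [|-> ->] := vlow (-1 - 1); first by [].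
  by rewrite !mod_act0r subr0 addr0 jl0 oppr0.
(* Here [f] and the vector both have eigenvalue [i], so [jl_gradeN1] makes their product equal to
   its opposite. *)
have f_lower v w : v \in gl (-1) -> w = - jl v ->
    mod_act f ((v, w) : lC) = 0.
  move=> v1 ->; rewrite cmod_actE /= fE !mod_actNl !mod_actNr opprK jl_gradeN1 //.
  rewrite subrr; congr pair; rewrite -jl_gradeN1 ?jl_mem // jlK // mod_actNr.
  by rewrite opprK subrr.
have fN v : v \in N -> mod_act f v \in N.
  move=> /NP[vlow v1]; apply/NP.
  have shift p : gcomp dgl p (mod_act f v).1 = (mod_act f ((gcomp dgl (p + 1) v.1,
        gcomp dgl (p + 1) v.2) : lC)).1 /\
      gcomp dgl p (mod_act f v).2 = (mod_act f ((gcomp dgl (p + 1) v.1,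
        gcomp dgl (p + 1) v.2) : lC)).2.
    have pE : p = -1 + (p + 1) by rewrite addrC addrK.
    have f2 : f.2 \in gs (-1) by rewrite fE memvN.
    by rewrite /= {1 4}pE linearB linearD /= !(gcomp_act glr).
  split=> [p p1|].
    have [-> ->] := shift p; have [p2|p2] := eqVneq p (-1 - 1).
      by rewrite p2 subrK f_lower ?gcomp_mem.
    have [|-> ->] := vlow (p + 1); first by have [_ _ ->] := lt_N1_int p1.
    by rewrite mod_act0r.
  have [-> ->] := shift (-1); rewrite addNr.
  set z1 := gcomp _ 0 v.1; set z2 := gcomp _ 0 v.2.
  have z10 : z1 \in gl 0 by exact: gcomp_mem.
  have z20 : z2 \in gl 0 by exact: gcomp_mem.
  have fm x z : x \in gs (-1) -> z \in gl 0 -> mod_act x z \in gl (-1).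
    by move=> xg zg; rewrite -[-1]addr0 (grade_act glr).
  rewrite /= fE !mod_actNl opprK jlD ?fm // !jl_grade0 // j_gradeN1 //.
  by rewrite mod_actNl opprD opprK addrC.
have eNil : exists k, forall v : lC, iter k (mod_act e) v \in N.
  have [|k ek] := @cmod_shift_nilpotent 1 e isT; first by rewrite mem_pair_grade a1.
  by exists k => v; rewrite ek mem0v.
have [n annih] := sl2_ker_annihilated ef he eN fN eNil.
pose Y : lC := (y, jl y).
(* The eigenspace of [jl] containing [Y], preserved by [h], which has degree 0. *)
pose U (v : lC) := v.1 \in gl (-1) /\ v.2 = jl v.1.
have hU v : U v -> U (mod_act h v).
  move=> [v1 v2]; rewrite /U cmod_actE /= v2; split.
    by rewrite memvB ?h_act ?jl_mem.
  rewrite jlD ?memvN ?h_act ?jl_mem // jlN ?h_act ?jl_mem // -!jl_act0 ?jl_mem //.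
  by rewrite jlK // mod_actNr opprK.
have UZ c v : U v -> U (mod_act h v - c *: v).
  move=> Uv; have [v1 v2] := Uv; have [w1 w2] := hU v Uv.
  split; first by rewrite memvB ?memvZ.
  change ((mod_act h v).2 - c *: v.2 = jl ((mod_act h v).1 - c *: v.1)).
  have -> : (mod_act h v).1 - c *: v.1 = - c *: v.1 + (mod_act h v).1.
    by rewrite scaleNr addrC.
  rewrite w2 v2 jl_linear //.
  by rewrite [RHS]addrC scaleNr.
have hY : shift_prod (mod_act h) (fun i => i%:R) n Y = 0.
  have [v1 v2] : U (shift_prod (mod_act h) (fun i => i%:R) n Y).
    by apply: shift_prod_stable => // i v; exact: UZ.
  have /annih/NP[_] : mod_act e Y \in N.
    apply/NP; have e0 : mod_act e Y \in glC 0.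
      rewrite mem_pair_grade cmod_actE /= -(subrr 1).
      by rewrite memvB ?memvD ?(grade_act glr) ?jl_mem.
    move: e0; rewrite mem_pair_grade => /andP[e1 e2]; split=> [p p1|].
      have [_ p0 _] := lt_N1_int p1.
      by rewrite (gcomp_other dgl e1 p0) (gcomp_other dgl e2 p0).
    by rewrite (gcomp_other dgl e1) // (gcomp_other dgl e2) // jl0 oppr0.
  set w := shift_prod _ _ _ _ in v1 v2 *.
  rewrite v2 !gcomp_id ?jl_mem // => /eqP; rewrite -addr_eq0 -mulr2n -scaler_nat.
  rewrite scaler_eq0 pnatr_eq0 /= => /eqP jw0.
  have w0 : w.1 = 0 by apply: oppr_inj; rewrite -jlK // jw0 jl0 oppr0.
  by rewrite [w]surjective_pairing v2 jw0 w0.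
have hfv (v : lC) : mod_act h (mod_act f v) = mod_act f (mod_act h v) - 2%:R *: mod_act f v.
  have := mod_actbr h f v; rewrite hf mod_actZl scaleNr => /esym/eqP.
  by rewrite subr_eq addrC => /eqP.
have hev (v : lC) : mod_act h (mod_act e v) = mod_act e (mod_act h v) + 2%:R *: mod_act e v.
  have := mod_actbr h e v; rewrite he mod_actZl => /esym/eqP.
  by rewrite subr_eq addrC => /eqP.
have fe : lie_br f e = - h by rewrite lie_brC ef.
have hNf : lie_br (- h) f = 2%:R *: f by rewrite lie_brNl hf scaleNr opprK.
have N0 (x : sC) (v : lC) : v \in (0%VS : {vspace lC}) -> mod_act x v \in (0%VS : {vspace lC}).
  by rewrite !memv0 => /eqP->; rewrite mod_act0r.
have fNil : exists k, forall v : lC, iter k (mod_act f) v \in (0%VS : {vspace lC}).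
  have [|k fk] := @cmod_shift_nilpotent (-1) f isT.
    by rewrite mem_pair_grade fE memvN fg.
  by exists k => v; rewrite fk mem0v.
have ker_f m (c : R) (v : lC) : (forall i, (m <= i)%N -> c != - i%:R) ->
    mod_act f v = 0 -> e_image f 0%VS m v -> mod_act h v - c *: v = 0 -> v = 0.
  move=> ci fv vm hv; apply/eqP; rewrite -memv0.
  apply: (sl2_ker_weight fe hNf (N0 f) (N0 e) fNil (c := - c) _ _ vm).
  - by move=> i mi; rewrite eqr_oppLR ci.
  - by rewrite fv mem0v.
  - by rewrite mod_actNl scaleNr -opprD hv oppr0 mem0v.
have fhv (v : lC) : mod_act f v = 0 -> mod_act f (mod_act h v) = 0.
  by move=> fv; have := hfv v; rewrite fv mod_act0r scaler0 subr0.
pose w := mod_act e Y.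
have fw : mod_act f w = 0.
  (* Where the kernel of [f] meets its image the weights of [h] are at most -1, so even the factor
     [h - 0] is injective. *)
  pose P (v : lC) := mod_act f v = 0 /\ exists u : lC, v = mod_act f u.
  apply: (@shift_prod_inj _ _ P (mod_act h) (fun i => i%:R) n).
  - move=> i v [fv [u vu]]; split.
      by rewrite mod_actBr mod_actZr fhv // fv scaler0 subr0.
    exists (mod_act h u - 2%:R *: u - i%:R *: u).
    by rewrite vu hfv !mod_actBr !mod_actZr.
  - move=> i v [fv [u vu]] hv; apply: (@ker_f 1 i%:R) => //.
      by case=> // k _; rewrite -addr_eq0 -natrD pnatr_eq0 addnS.
    by exists u; rewrite vu /= subrr mem0v.
  - split; last by exists w.
    have eY0 : w \in glC 0.
      rewrite /w mem_pair_grade cmod_actE /= -(subrr 1).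
      by rewrite memvB ?memvD ?(grade_act glr) ?jl_mem.
    rewrite -/w; move: eY0; rewrite mem_pair_grade => /andP[w1 w2].
    have fm x z : x \in gs (-1) -> z \in gl 0 -> mod_act x z \in gl (-1).
      by move=> xg zg; rewrite -[-1]addr0 (grade_act glr).
    rewrite [mod_act f w]surjective_pairing; apply: f_lower; rewrite /= fE !mod_actNl ?opprK.
      by rewrite memvD ?fm.
    rewrite jlD ?fm // !jl_grade0 // j_gradeN1 // mod_actNl.
    by rewrite opprD opprK addrC.
  rewrite (@shift_prod_intertwine _ _ _ (fun v : lC => mod_act f (mod_act e v)) xpredT
    (mod_act h) _ (fun i => i%:R)) //.
    by rewrite hY !mod_act0r.
  move=> i v _; rewrite hfv hev !mod_actDr !mod_actZr addrK.
  by rewrite mod_actNr mod_actZr mod_actNr mod_actZr.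
(* Moving the product past [e], which has weight 2, turns [h - i] into [h - (i + 2)], injective on
   the whole kernel of [f]. *)
have w0 : w = 0.
  apply: (@shift_prod_inj _ _ (fun v : lC => mod_act f v = 0) (mod_act h) (fun i => (i + 2)%:R) n).
  - by move=> i v fv; rewrite mod_actBr mod_actZr fhv // fv scaler0 subr0.
  - move=> i v fv hv; apply: (@ker_f 0 (i + 2)%:R) => //; last exact: e_image0.
    by move=> k _; rewrite -addr_eq0 -natrD pnatr_eq0 addnAC addnS.
  - exact: fw.
  rewrite (@shift_prod_intertwine _ _ _ (mod_act e) xpredT
    (mod_act h) _ (fun i => i%:R)) //.
    by rewrite hY mod_act0r.
  move=> i v _; rewrite hev mod_actBr mod_actZr -addrA -scalerBl -scaleNr.
  by congr (_ + _ *: _); rewrite natrD; ring.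
have /eqP : w.1 = 0 by rewrite w0.
by rewrite /= subr_eq0 => /eqP.
Qed.

End DegreeOne.

(** * Irreducible graded modules *)

(** The smallest subspace containing [G] and stable under the operators of [O], with its induction
    principle. Taking only part of the algebra for [O] gives one-sided generation, and an empty [O]
    gives the linear span. *)
Lemma module_closure (R : realType) (s : lieAlgebra R) (l : lieModule s)
    (G : l -> Prop) (O : s -> Prop) :
  exists W : {vspace l}, [/\ forall y, G y -> y \in W,
    forall x y, O x -> y \in W -> mod_act x y \in W
  & forall P : l -> Prop, P 0 -> (forall a u v, P u -> P v -> P (a *: u + v)) ->
      (forall y, G y -> P y) ->
      (forall x y, O x -> y \in W -> P y -> P (mod_act x y)) ->
      forall y, y \in W -> P y].
Proof.
pose closed (W : {vspace l}) := (forall y, G y -> y \in W) /\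
  (forall x y, O x -> y \in W -> mod_act x y \in W).
have [W WP] : exists W : {vspace l}, forall y, y \in W <->
    forall W', closed W' -> y \in W'.
  apply: vspace_of_pred => [W' _|a u v uW vW W' cW]; first exact: mem0v.
  by rewrite memvD ?memvZ ?uW ?vW.
have cW : closed W.
  split=> [y Gy|x y Ox /WP yW]; apply/WP => W' cW'; have [GW' OW'] := cW'.
    exact: GW'.
  by apply: OW' => //; exact: yW.
have [GW OW] := cW; exists W; split=> // P P0 PD PG PO y yW.
have [W' W'P] : exists W' : {vspace l}, forall y, y \in W' <-> y \in W /\ P y.
  apply: vspace_of_pred; first by split; [exact: mem0v | exact: P0].
  by move=> a u v [uW Pu] [vW Pv]; split; [rewrite memvD ?memvZ | exact: PD].
have cW' : closed W'.
  split=> [z Gz|x z Ox /W'P[zW Pz]]; apply/W'P; split; by [exact: GW | exact: PG | exact: OW | exact: PO].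
by have /WP/(_ _ cW')/W'P[] := yW.
Qed.

Section Generation.
Variables (R : realType) (s : lieAlgebra R) (gs : int -> {vspace s}).
Hypothesis gr : graded_lie gs.
Hypothesis fund : fundamental_lie gs.
Variable P : int -> s -> Prop.
Hypothesis P0 : forall p, P p 0.
Hypothesis PD : forall p a x y, P p x -> P p y -> P p (a *: x + y).
Hypothesis Pbr : forall p q x y, x \in gs p -> y \in gs q ->
  P p x -> P q y -> P (p + q) (lie_br x y).
Hypothesis PN1 : forall x, x \in gs (-1) -> P (-1) x.

Lemma negative_generation (n : nat) x : x \in gs (- n.+1%:Z) -> P (- n.+1%:Z) x.
Proof.
elim: n x => [|n IHn] x; first exact: PN1.
have -> : - n.+2%:Z = - n.+1%:Z - 1 by lia.
rewrite fund; last by rewrite oppr_lt0.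
have [W WP] := vspace_of_pred (@P0 (- n.+1%:Z - 1)) (@PD (- n.+1%:Z - 1)).
move=> xb; apply/WP; move: x xb; apply/subvP.
apply/(@mod_brv_subP _ _ (adjoint s)) => x y xg yg; apply/WP.
by rewrite addrC; apply: Pbr => //; [exact: PN1 | exact: IHn].
Qed.

Hypothesis nd : forall x : s, (forall y, killing x y = 0) -> x = 0.
Hypothesis tr : transitive_lie gs.
Hypothesis P00 : forall x, x \in gs 0 -> P 0 x.
Hypothesis P1 : forall x, x \in gs 1 -> P 1 x.

(** The predicate depends on the degree for the sake of [family_act], where an element of degree [q]
    shifts a family by [q]. *)
Lemma graded_generation p x : x \in gs p -> P p x.
Proof.
case: p => [n|n]; last by rewrite NegzE; exact: negative_generation.
elim: n x => [|n IHn] x; first exact: P00.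
case: n IHn => [|n] IHn; first exact: P1.
have -> : Posz n.+2 = 1 + n.+1%:Z by lia.
rewrite (grade_succ gr nd tr) //.
have [W WP] := vspace_of_pred (@P0 (1 + n.+1%:Z)) (@PD (1 + n.+1%:Z)).
move=> xb; apply/WP; move: x xb; apply/subvP.
apply/(@mod_brv_subP _ _ (adjoint s)) => x y xg yg; apply/WP.
by apply: Pbr => //; [exact: P1 | exact: IHn].
Qed.

End Generation.

Lemma stable_generation (R : realType) (s : lieAlgebra R) (gs : int -> {vspace s})
    (l : lieModule s) (W : {vspace l}) :
  graded_lie gs -> fundamental_lie gs ->
  (forall x : s, (forall y, killing x y = 0) -> x = 0) -> transitive_lie gs ->
  (forall p x y, p \in [:: -1; 0; 1] -> x \in gs p -> y \in W -> mod_act x y \in W) ->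
  forall x y, y \in W -> mod_act x y \in W.
Proof.
move=> gr fund nd tr st x y yW; move: x y yW.
have all p x : x \in gs p -> forall y, y \in W -> mod_act x y \in W.
  apply: (graded_generation (P := fun _ x => forall y, y \in W -> mod_act x y \in W)
    gr fund _ _ _ _ nd tr) => //.
  - by move=> _ y yW; rewrite mod_act0l mem0v.
  - by move=> _ a u v Hu Hv y yW; rewrite mod_actDl mod_actZl memvD ?memvZ ?Hu ?Hv.
  - by move=> _ _ u v _ _ Hu Hv y yW; rewrite mod_actbr memvB ?Hu ?Hv // ?Hv ?Hu.
  - by move=> u ug y yW; apply: st ug yW; rewrite !inE.
  - by move=> u ug y yW; apply: st ug yW; rewrite !inE.
  - by move=> u ug y yW; apply: st ug yW; rewrite !inE.
move=> x; elim/(grade_ind gr.1): x => [|u v Hu Hv|p v /all //] y yW.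
- by rewrite mod_act0l mem0v.
- by rewrite mod_actDl memvD ?Hu ?Hv.
Qed.

Section Irreducible.
Variables (R : realType) (s : lieAlgebra R) (l : lieModule s).
Hypothesis irr : irreducible l.

Lemma irreducible_full (W : {vspace l}) y :
  (forall x z, z \in W -> mod_act x z \in W) -> y \in W -> y <> 0 -> W = fullv.
Proof.
move=> /irr.2[-> |//] /=; rewrite memv0 => /eqP y0; by case.
Qed.

Lemma irreducible_nonzero : exists y : l, y <> 0.
Proof.
have [F0 _] := irr; exists (vpick (fullv : {vspace l})) => /eqP.
by rewrite vpick0 => /eqP.
Qed.

Lemma schur (phi : 'End(l)) : commutes_with_action phi -> phi <> 0 ->
  forall y, phi y = 0 -> y = 0.
Proof.
move=> cphi phi0 y phiy; apply: contrapT => y0; apply: phi0.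
have ker_full : lker phi = fullv.
  apply: (irreducible_full (y := y)) => //; last by rewrite memv_ker phiy.
  by move=> x z; rewrite !memv_ker cphi => /eqP->; rewrite mod_act0r.
by apply/lfunP => z; rewrite zero_lfunE; apply/eqP; rewrite -memv_ker ker_full memvf.
Qed.

Variables (gs : int -> {vspace s}) (gl : int -> {vspace l}).
Hypothesis gr : graded_lie gs.
Hypothesis glr : graded_module gs gl.
Local Notation dg := (gr.1 : direct_decomposition gs).
Local Notation dgl := (glr.1 : direct_decomposition gl).

(** The part [psi k] of [phi] of degree [k] commutes with the action; for [k != 0] it is nilpotent,
    so it vanishes by Schur. *)
Lemma commutes_grade (phi : 'End(l)) : commutes_with_action phi ->
  forall p y, y \in gl p -> phi y \in gl p.
Proof.
move=> cphi.
pose psi k : 'End(l) := \sum_(p <- gsupp dgl) (gcomp dgl (p + k) \o (phi \o gcomp dgl p))%VF.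
have psiE k p y : y \in gl p -> psi k y = gcomp dgl (p + k) (phi y).
  move=> yp; rewrite [X in _ = _ (phi X)](gcomp_sum dgl) !linear_sum sum_lfunE.
  apply: eq_bigr => q _; rewrite !comp_lfunE.
  by have [-> //|pq] := eqVneq q p; rewrite (gcomp_other dgl yp) 1?eq_sym // !linear0.
have psi_comm k : commutes_with_action (psi k).
  move=> x y; elim/(grade_ind dg): x => [|u v Hu Hv|r x xr].
  - by rewrite !mod_act0l linear0.
  - by rewrite !mod_actDl linearD /= Hu Hv.
  elim/(grade_ind dgl): y => [|u v Hu Hv|p y yp].
  - by rewrite linear0 mod_act0r linear0.
  - by rewrite linearD !mod_actDr linearD /= Hu Hv.
  rewrite (psiE k _ _ (grade_act glr xr yp)) (psiE k p) // cphi -addrA.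
  exact: gcomp_act.
have psi_nil k : k != 0 -> psi k = 0.
  move=> k0; apply: contrapT => psi0; have inj := schur (psi_comm k) psi0.
  have [n psin] : nilpotent_map (psi k).
    apply: (shift_nilpotent dgl k0) => p y yp.
    by rewrite (psiE k p) // gcomp_mem.
  have [y []] := irreducible_nonzero.
  elim: n {psin} y (psin y) => //= n IHn y /inj; exact: IHn.
move=> p y yp.
suff -> : phi y = gcomp dgl p (phi y) by exact: gcomp_mem.
apply: (gcomp_eq (dg := dgl)) => q.
have [<-|pq] := eqVneq p q; first by rewrite (gcomp_id dgl (gcomp_mem dgl p _)).
rewrite (gcomp_other dgl (gcomp_mem dgl p _) pq).
have := psiE (q - p) p y yp; rewrite psi_nil ?subr_eq0 1?eq_sym // zero_lfunE.
by rewrite addrC subrK.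
Qed.

Hypothesis fund : fundamental_lie gs.

Lemma negative_kill (y : l) : (forall x, x \in gs (-1) -> mod_act x y = 0) ->
  forall p x, p < 0 -> x \in gs p -> mod_act x y = 0.
Proof.
move=> y0 [n|n] x //; rewrite NegzE => _.
apply: (negative_generation (P := fun _ x => mod_act x y = 0) fund) => //.
- by move=> _; rewrite mod_act0l.
- by move=> _ a u v u0 v0; rewrite mod_actDl mod_actZl u0 v0 scaler0 addr0.
- by move=> _ _ u v _ _ u0 v0; rewrite mod_actbr u0 v0 !mod_act0r subrr.
Qed.

(** Since negative degrees kill [y], acting on it by nonnegative degrees already produces a
    submodule. It has no component below degree [p], so it cannot contain [gl q]. *)
Lemma lowest_vector q p y : q < p -> gl q <> 0%VS -> y \in gl p ->
  (forall x, x \in gs (-1) -> mod_act x y = 0) -> y = 0.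
Proof.
move=> qp glq yp yN1; apply: contrapT => y0; apply: glq.
have [W [yW OW Wind]] := module_closure (eq y)
  (fun x => exists2 r, 0 <= r & x \in gs r).
have Wneg w : w \in W -> forall r x, r < 0 -> x \in gs r -> mod_act x w \in W.
  apply: (Wind (fun w => forall r x, r < 0 -> x \in gs r -> mod_act x w \in W)).
  - by move=> r x _ _; rewrite mod_act0r mem0v.
  - by move=> a u v Hu Hv r x r0 xr; rewrite mod_actDr mod_actZr memvD ?memvZ ?(Hu r) ?(Hv r).
  - by move=> _ <- r x r0 xr; rewrite (negative_kill yN1 r0 xr) mem0v.
  move=> x {}w [k k0 xk] wW Hw r z r0 zr.
  have -> : mod_act z (mod_act x w) = mod_act (lie_br z x) w + mod_act x (mod_act z w).
    by rewrite mod_actbr subrK.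
  apply: memvD; last by apply: OW; [exists k | exact: Hw r0 zr].
  have zx := grade_br gr zr xk; have [rk|rk] := ltP (r + k) 0; first exact: Hw rk zx.
  by apply: OW => //; exists (r + k).
have Wfull : W = fullv.
  apply: (irreducible_full (y := y)) => //; last exact: yW.
  move=> x w wW; elim/(grade_ind dg): x => [|u v Hu Hv|r x xr].
  - by rewrite mod_act0l mem0v.
  - by rewrite mod_actDl memvD.
  have [r0|r0] := ltP r 0; first exact: Wneg r0 xr.
  by apply: OW => //; exists r.
have Wlow w : w \in W -> forall r, r < p -> gcomp dgl r w = 0.
  apply: (Wind (fun w => forall r, r < p -> gcomp dgl r w = 0)).
  - by move=> r _; rewrite linear0.
  - by move=> a u v Hu Hv r rp; rewrite linearP /= Hu // Hv // scaler0 addr0.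
  - by move=> _ <- r rp; rewrite (gcomp_other dgl yp) // gt_eqF.
  move=> x {}w [k k0 xk] wW Hw r rp.
  have -> : r = k + (r - k) by rewrite addrC subrK.
  by rewrite (gcomp_act glr _ _ xk) Hw ?mod_act0r //; lia.
apply/eqP; rewrite -subv0; apply/subvP => v vq; rewrite memv0.
by rewrite -(gcomp_id dgl vq) Wlow // Wfull memvf.
Qed.

(** Acting by [gs (-1)] on the degrees at least -1 produces a submodule, nonzero because of [gl q],
    hence all of [l]. A component of degree below -1 can only come from a last action of
    [gs (-1)]. *)
Lemma generated_below q p : -1 <= q -> gl q <> 0%VS -> p < 0 ->
  (gl (p - 1) <= mod_brv (gs (-1)) (gl p))%VS.
Proof.
move=> q1 glq p0.
have [W [GW OW Wind]] := module_closure
  (fun y : l => exists2 r, -1 <= r & y \in gl r) (fun x => x \in gs (-1)).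
have Wneg w : w \in W -> forall r x, r < 0 -> x \in gs r -> mod_act x w \in W.
  move=> wW [n|n] x //; rewrite NegzE => _ xr; move: w wW.
  move: x xr; apply: (negative_generation
    (P := fun _ x => forall w, w \in W -> mod_act x w \in W) fund) => //.
  - by move=> _ w wW; rewrite mod_act0l mem0v.
  - by move=> _ a u v Hu Hv w wW; rewrite mod_actDl mod_actZl memvD ?memvZ ?Hu ?Hv.
  - by move=> _ _ u v _ _ Hu Hv w wW; rewrite mod_actbr memvB ?Hu ?Hv // ?Hv ?Hu.
  - by move=> x xg w wW; exact: OW.
have Wpos w : w \in W -> forall r x, 0 <= r -> x \in gs r -> mod_act x w \in W.
  apply: (Wind (fun w => forall r x, 0 <= r -> x \in gs r -> mod_act x w \in W)).
  - by move=> r x _ _; rewrite mod_act0r mem0v.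
  - by move=> a u v Hu Hv r x r0 xr; rewrite mod_actDr mod_actZr memvD ?memvZ ?(Hu r) ?(Hv r).
  - move=> y [k k1 yk] r x r0 xr; apply: GW; exists (r + k); first by lia.
    exact: grade_act xr yk.
  move=> x {}w xg wW Hw r z r0 zr.
  have -> : mod_act z (mod_act x w) = mod_act (lie_br z x) w + mod_act x (mod_act z w).
    by rewrite mod_actbr subrK.
  apply: memvD; last by apply: OW => //; exact: Hw r0 zr.
  have zx := grade_br gr zr xg; have [rk|rk] := ltP (r - 1) 0; first exact: Wneg rk zx.
  exact: Hw rk zx.
have Wfull : W = fullv.
  have q0 : vpick (gl q) <> 0 by move=> /eqP; rewrite vpick0 => /eqP.
  apply: (irreducible_full (y := vpick (gl q))) => //; last first.
    by apply: GW; exists q => //; exact: memv_pick.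
  move=> x w wW; elim/(grade_ind dg): x => [|u v Hu Hv|r x xr].
  - by rewrite mod_act0l mem0v.
  - by rewrite mod_actDl memvD.
  by have [r0|r0] := ltP r 0; [exact: Wneg r0 xr | exact: Wpos r0 xr].
have Wlow w : w \in W -> gcomp dgl (p - 1) w \in mod_brv (gs (-1)) (gl p).
  apply: (Wind (fun w => gcomp dgl (p - 1) w \in mod_brv (gs (-1)) (gl p))).
  - by rewrite linear0 mem0v.
  - by move=> a u v Hu Hv; rewrite linearP /= memvD ?memvZ.
  - move=> y [r r1 yr]; rewrite (gcomp_other dgl yr) ?mem0v //; lia.
  move=> x {}w xg _ _; rewrite addrC (gcomp_act glr _ _ xg).
  by apply: memv_br_mod => //; exact: gcomp_mem.
by apply/subvP => v vp; rewrite -(gcomp_id dgl vp) Wlow // Wfull memvf.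
Qed.

End Irreducible.

Section DoubleModule.
Variables (R : realType) (s : lieAlgebra R) (l : lieModule s).

Lemma cact_linearl (w : (l * l)%type) : linear ((@cact R s l)^~ w).
Proof. by move=> a x x'; congr pair => /=; rewrite mod_actDl mod_actZl. Qed.

Lemma cact_linearr x : linear (@cact R s l x).
Proof. by move=> a w w'; congr pair => /=; rewrite mod_actDr mod_actZr. Qed.

Lemma cact_br x x' (w : (l * l)%type) :
  cact (lie_br x x') w = cact x (cact x' w) - cact x' (cact x w).
Proof. by congr pair => /=; rewrite mod_actbr. Qed.

(** It contains the graphs of operators on [l]; a graph is a submodule exactly when the operator
    commutes with the action. It also serves as the complexification of [l] under the real algebra
    [s]. *)
Definition double_module : lieModule s :=
  LieModule cact_linearl cact_linearr cact_br.

Lemma double_actE x (w : double_module) :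
  mod_act x w = (mod_act x w.1, mod_act x w.2) :> (l * l)%type.
Proof. by []. Qed.

End DoubleModule.

(** * Extension of an operator from degrees 0, -1, -2 to the whole module *)

Section Extension.
Variables (R : realType) (s : lieAlgebra R) (gs : int -> {vspace s}) (j : s).
Variables (l : lieModule s) (gl : int -> {vspace l}) (t : l -> l).
Hypothesis gr : graded_lie gs.
Hypothesis nd : forall x : s, (forall y, killing x y = 0) -> x = 0.
Hypothesis fund : fundamental_lie gs.
Hypothesis tr : transitive_lie gs.
Hypothesis glr : graded_module gs gl.
Hypothesis irr : irreducible l.
Hypothesis gl2 : gl (-2) <> 0%VS.
Local Notation dg := (gr.1 : direct_decomposition gs).
Local Notation dgl := (glr.1 : direct_decomposition gl).

Hypothesis j_comm : forall a (y : l), a \in gs 0 -> mod_act j (mod_act a y) = mod_act a (mod_act j y).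
Hypothesis t_mem : forall y, y \in gl (-1) -> t y \in gl (-1).
Hypothesis j_deg0 : j \in gs 0.
Hypothesis t_linear : forall a y y', y \in gl (-1) -> y' \in gl (-1) ->
  t (a *: y + y') = a *: t y + t y'.
Hypothesis t_comm : forall a y, a \in gs 0 -> y \in gl (-1) ->
  t (mod_act a y) = mod_act a (t y).
Hypothesis t_down0 : forall x y, x \in gs (-1) -> y \in gl 0 ->
  t (mod_act x y) = mod_act x (mod_act j y).
Hypothesis t_downN1 : forall x y, x \in gs (-1) -> y \in gl (-1) ->
  mod_act j (mod_act x y) = mod_act x (t y).
Hypothesis t_upN1 : forall a y, a \in gs 1 -> y \in gl (-1) ->
  mod_act j (mod_act a y) = mod_act a (t y).
Hypothesis t_upN2 : forall a y, a \in gs 1 -> y \in gl (-2) ->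
  t (mod_act a y) = mod_act a (mod_act j y).

Local Notation ll := (double_module l).

Lemma graph_space (U : {vspace l}) (f : l -> l) :
  (forall a y y', y \in U -> y' \in U -> f (a *: y + y') = a *: f y + f y') ->
  exists W : {vspace ll}, forall w, w \in W <-> w.1 \in U /\ w.2 = f w.1.
Proof.
move=> fl.
have f0 : f 0 = 0.
  have := @fl 1 0 0 (mem0v _) (mem0v _).
  by rewrite !scale1r addr0 => /esym/eqP; rewrite -subr_eq0 addrK => /eqP.
apply: vspace_of_pred; first by split; [exact: mem0v | rewrite f0].
move=> a u v [u1 u2] [v1 v2]; split; first by rewrite memvD ?memvZ.
by rewrite /= fl // u2 v2.
Qed.

Section Family.
Variables G0 G1 G2 : {vspace ll}.
Hypothesis G0P : forall w, w \in G0 <-> w.1 \in gl 0 /\ w.2 = mod_act j w.1.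
Hypothesis G1P : forall w, w \in G1 <-> w.1 \in gl (-1) /\ w.2 = t w.1.
Hypothesis G2P : forall w, w \in G2 <-> w.1 \in gl (-2) /\ w.2 = mod_act j w.1.

Fixpoint up n : {vspace ll} := if n is n'.+1 then mod_brv (gs 1) (up n') else G0.
Fixpoint down n : {vspace ll} := if n is n'.+1 then mod_brv (gs (-1)) (down n') else G2.

(* Below degree -2 and above degree 0 the graph is propagated by the action of
   [gs (-1)] and [gs 1]. *)
Definition family (p : int) : {vspace ll} :=
  match p with Posz n => up n | Negz 0 => G1 | Negz n.+1 => down n end.

Lemma mod_brv_stable (U : {vspace s}) (V W : {vspace ll}) a :
  (forall x v, x \in U -> v \in V -> mod_act a (mod_act x v) \in W) ->
  forall v, v \in mod_brv U V -> mod_act a v \in W.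
Proof.
move=> st.
have [W' WP] : exists W' : {vspace ll}, forall v, v \in W' <-> mod_act a v \in W.
  apply: vspace_of_pred; first by rewrite mod_act0r mem0v.
  by move=> c u v uW vW; rewrite mod_actDr mod_actZr memvD ?memvZ.
move=> v vb; apply/WP; move: v vb; apply/subvP/mod_brv_subP => x v xU vV.
by apply/WP; exact: st.
Qed.

Lemma act_swap a x (v : ll) :
  mod_act a (mod_act x v) = mod_act (lie_br a x) v + mod_act x (mod_act a v).
Proof. by rewrite mod_actbr subrK. Qed.

Lemma up_act0 n a v : a \in gs 0 -> v \in up n -> mod_act a v \in up n.
Proof.
elim: n a v => [|n IHn] a v a0 /=.
  move=> /G0P[v1 v2]; apply/G0P; split; first by rewrite -[0]add0r (grade_act glr).
  by rewrite /= v2 j_comm.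
move: v; apply: mod_brv_stable => x v x1 vn; rewrite act_swap.
have ax : lie_br a x \in gs 1 by rewrite -[1]add0r (grade_br gr).
by apply: memvD; apply: memv_br_mod => //; exact: IHn.
Qed.

Lemma down_act0 n a v : a \in gs 0 -> v \in down n -> mod_act a v \in down n.
Proof.
elim: n a v => [|n IHn] a v a0 /=.
  move=> /G2P[v1 v2]; apply/G2P; split; first by rewrite -[-2]add0r (grade_act glr).
  by rewrite /= v2 j_comm.
move: v; apply: mod_brv_stable => x v x1 vn; rewrite act_swap.
have ax : lie_br a x \in gs (-1) by rewrite -[-1]add0r (grade_br gr).
by apply: memvD; apply: memv_br_mod => //; exact: IHn.
Qed.

Lemma G0_down x v : x \in gs (-1) -> v \in G0 -> mod_act x v \in G1.
Proof.
move=> xg /G0P[v1 v2]; apply/G1P; split; first by rewrite -[-1]addr0 (grade_act glr).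
by rewrite /= v2 t_down0.
Qed.

Lemma G1_up a v : a \in gs 1 -> v \in G1 -> mod_act a v \in G0.
Proof.
move=> a1 /G1P[v1 v2]; apply/G0P; split; first by rewrite -(subrr 1) (grade_act glr).
by rewrite /= v2 t_upN1.
Qed.

Lemma G1_down x v : x \in gs (-1) -> v \in G1 -> mod_act x v \in G2.
Proof.
move=> xg /G1P[v1 v2]; apply/G2P; split.
  exact: (grade_act glr xg v1).
by rewrite /= v2 t_downN1.
Qed.

Lemma G2_up a v : a \in gs 1 -> v \in G2 -> mod_act a v \in G1.
Proof.
move=> a1 /G2P[v1 v2]; apply/G1P; split.
  exact: (grade_act glr a1 v1).
by rewrite /= v2 t_upN2.
Qed.

(** Move [x] past the last factor of degree 1: their bracket has degree 0, and the other term is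
    covered by induction. *)
Lemma up_actN1 n x v : x \in gs (-1) -> v \in up n.+1 -> mod_act x v \in up n.
Proof.
elim: n x v => [|n IHn] x v xg /=; move: v; apply: mod_brv_stable => a v a1 vn;
  rewrite act_swap; (have xa : lie_br x a \in gs 0 by rewrite -(addNr 1) (grade_br gr)).
  apply: memvD; first exact: (@up_act0 0).
  by apply: G1_up => //; exact: G0_down.
apply: memvD; first exact: (@up_act0 n.+1).
by apply: memv_br_mod => //; exact: IHn.
Qed.

Lemma down_act1 n a v : a \in gs 1 -> v \in down n.+1 -> mod_act a v \in down n.
Proof.
elim: n a v => [|n IHn] a v a1 /=; move: v; apply: mod_brv_stable => x v xg vn;
  rewrite act_swap; (have xa : lie_br a x \in gs 0 by rewrite -(subrr 1) (grade_br gr)).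
  apply: memvD; first exact: (@down_act0 0).
  by apply: G1_down => //; exact: G2_up.
apply: memvD; first exact: (@down_act0 n.+1).
by apply: memv_br_mod => //; exact: IHn.
Qed.

(** The property passes to brackets, so only elements of degrees -1, 0 and 1 have to be examined. *)
Lemma family_act q x p v : x \in gs q -> v \in family p ->
  mod_act x v \in family (p + q).
Proof.
move=> xq; move: p v.
apply: (graded_generation (P := fun q x => forall p v, v \in family p ->
  mod_act x v \in family (p + q)) gr fund _ _ _ _ nd tr) xq.
- by move=> r p v _; rewrite mod_act0l mem0v.
- by move=> r a u u' Hu Hu' p v vp; rewrite mod_actDl mod_actZl memvD ?memvZ ?Hu ?Hu'.
- move=> r r' u u' _ _ Hu Hu' p v vp; rewrite mod_actbr memvB //.
    by rewrite [r + r']addrC addrA; apply/Hu/Hu'.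
  by rewrite addrA; apply/Hu'/Hu.
- move=> u ug [[|n]|[|n]] v vp.
  + exact: G0_down.
  + have -> : Posz n.+1 + -1 = n by lia.
    exact: up_actN1.
  + exact: G1_down.
  + have -> : Negz n.+1 + -1 = Negz n.+2 by lia.
    exact: memv_br_mod.
- move=> u ug [n|[|n]] v vp; rewrite addr0.
  + exact: up_act0.
  + move: vp => /G1P[v1 v2]; apply/G1P; split; first by rewrite -[-1]add0r (grade_act glr).
    by rewrite /= v2 t_comm.
  + exact: down_act0.
- move=> u ug [n|[|[|n]]] v vp.
  + have -> : Posz n + 1 = Posz n.+1 by lia.
    exact: memv_br_mod.
  + exact: G1_up.
  + exact: G2_up.
  + have -> : Negz n.+2 + 1 = Negz n.+1 by lia.
    exact: down_act1.
Qed.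

(** [M] is the relation with homogeneous pieces [family p]. The values related to 0 form a submodule
    [N], which is zero because in degree -2, where [gl (-2)] is nonzero, the relation is a graph by
    construction. The domain [Q] is a nonzero submodule, hence everything. *)
Lemma family_extension : exists Phi : 'End(l), [/\ commutes_with_action Phi,
  forall y, y \in gl 0 -> Phi y = mod_act j y,
  forall y, y \in gl (-1) -> Phi y = t y
  & forall y, y \in gl (-2) -> Phi y = mod_act j y].
Proof.
have [M MP] : exists M : {vspace ll}, forall v, v \in M <->
    forall p, ((gcomp dgl p v.1, gcomp dgl p v.2) : ll) \in family p.
  apply: vspace_of_pred => [p|a u v Hu Hv p]; first by rewrite !linear0 mem0v.
  by rewrite !linearP /= (memvD (memvZ a (Hu p)) (Hv p)).
have Mst x v : v \in M -> mod_act x v \in M.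
  move=> vM; elim/(grade_ind dg): x => [|u u' Hu Hu'|q x xq].
  - by rewrite mod_act0l mem0v.
  - by rewrite mod_actDl memvD.
  move/MP: vM => vM; apply/MP => p; have pE : p = q + (p - q) by rewrite addrC subrK.
  rewrite {1 2}pE /= !(gcomp_act glr _ _ xq).
  by have := family_act xq (vM (p - q)); rewrite subrK.
have single p y y' : y \in gl p -> y' \in gl p -> ((y, y') : ll) \in family p ->
    ((y, y') : ll) \in M.
  move=> yp y'p yf; apply/MP => q /=.
  have [<-|pq] := eqVneq p q; first by rewrite !gcomp_id.
  by rewrite (gcomp_other dgl yp pq) (gcomp_other dgl y'p pq) mem0v.
have [N NP] : exists N : {vspace l}, forall y, y \in N <-> ((0, y) : ll) \in M.
  apply: vspace_of_pred => [|a u v Hu Hv]; first exact: mem0v.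
  by have := memvD (memvZ a Hu) Hv; congr (_ \in M); congr pair => /=; rewrite scaler0 addr0.
have [z z2 z0] : exists2 z, z \in gl (-2) & z <> 0.
  exists (vpick (gl (-2))); first exact: memv_pick.
  by move=> /eqP; rewrite vpick0 => /eqP.
have N0 : N = 0%VS.
  have [x y /NP yN||Nfull] := irr.2 N; last 1 first.
  - have /NP/MP/(_ (-2)) /= : z \in N by rewrite Nfull memvf.
    by rewrite linear0 gcomp_id // => /G2P[_ /=]; rewrite mod_act0r.
  - by apply/NP; have := Mst x _ yN; rewrite double_actE /= mod_act0r.
  - by [].
have [Q QP] : exists Q : {vspace l}, forall y, y \in Q <->
    exists y', ((y, y') : ll) \in M.
  apply: vspace_of_pred; first by exists 0; exact: mem0v.
  by move=> a u v [u' Hu] [v' Hv]; exists (a *: u' + v'); exact: (memvD (memvZ a Hu) Hv).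
have Qfull : Q = fullv.
  apply: (irreducible_full irr (y := z)) => // [x y /QP[y' yM]|]; apply/QP.
    by exists (mod_act x y'); exact: (Mst x _ yM).
  exists (mod_act j z); apply: (single (-2)) => //.
    by rewrite -[-2]add0r (grade_act glr).
  by apply/G2P.
have ex y : exists y', ((y, y') : ll) \in M by apply/QP; rewrite Qfull memvf.
pose f y := projT1 (cid (ex y)).
have fM y : ((y, f y) : ll) \in M by exact: projT2 (cid (ex y)).
have uniq y y' : ((y, y') : ll) \in M -> y' = f y.
  move=> yM; apply/eqP; rewrite -subr_eq0 -memv0 -N0; apply/NP.
  by have := memvB yM (fM y); congr (_ \in M); congr pair => /=; rewrite subrr.
have lin_f : linear f.
  by move=> a u v; apply/esym/uniq; exact: (memvD (memvZ a (fM u)) (fM v)).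
exists (linfun (mklin lin_f)).
have FE y : linfun (mklin lin_f) y = f y by exact: (lfunE (mklin lin_f)).
split=> [x y|y y0|y y1|y y2]; rewrite !FE.
- by apply/esym/uniq; exact: (Mst x _ (fM y)).
- apply/esym/uniq/(single 0) => //; first by rewrite -[0]add0r (grade_act glr).
  by apply/G0P.
- by apply/esym/uniq/(single (-1)) => //; [exact: t_mem | apply/G1P].
- apply/esym/uniq/(single (-2)) => //; first by rewrite -[-2]add0r (grade_act glr).
  by apply/G2P.
Qed.

End Family.

Lemma endomorphism_extension : exists Phi : 'End(l), [/\ commutes_with_action Phi,
  forall y, y \in gl 0 -> Phi y = mod_act j y,
  forall y, y \in gl (-1) -> Phi y = t y
  & forall y, y \in gl (-2) -> Phi y = mod_act j y].
Proof.
have [|G0 G0P] := @graph_space (gl 0) (mod_act j).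
  by move=> a y y' _ _; exact: mod_act_linearr.
have [//|G1 G1P] := @graph_space (gl (-1)) t.
have [|G2 G2P] := @graph_space (gl (-2)) (mod_act j).
  by move=> a y y' _ _; exact: mod_act_linearr.
exact: family_extension G0P G1P G2P.
Qed.

End Extension.

(** * The theorem of Frobenius *)

Section Frobenius.
Variables (R : realType) (A : algType R) (D : A -> Prop).
Hypothesis D_one : D 1.
Hypothesis D_lin : forall a x y, D x -> D y -> D (a *: x + y).
Hypothesis D_mul : forall x y, D x -> D y -> D (x * y).
Hypothesis D_domain : forall x y, D x -> D y -> x * y = 0 -> x = 0 \/ y = 0.
Hypothesis D_quadratic : forall x, D x ->
  exists a b : R, (x - a%:A) * (x - a%:A) = - (b ^+ 2)%:A.

(** The subalgebra [D] is kept as a predicate because it will be the centralizer of the action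
    inside [End(l)]. *)
Definition alg_iso (B : lmodType R) (mul : B -> B -> B) (one : B) (f : B -> A) : Prop :=
  [/\ linear f, f one = 1, forall a b, f (mul a b) = f a * f b, injective f
    & forall x, D x <-> exists a, x = f a].

Let D0 : D 0.
Proof. by have := D_lin (-1) D_one D_one; rewrite scaleN1r addNr. Qed.

Let DZ a x : D x -> D (a *: x).
Proof. by move=> Dx; rewrite -[_ *: _]addr0; apply: D_lin => //; exact: D0. Qed.

Let DD x y : D x -> D y -> D (x + y).
Proof. by move=> Dx Dy; rewrite -[x]scale1r; exact: D_lin. Qed.

Let DN x : D x -> D (- x).
Proof. by rewrite -scaleN1r; exact: DZ. Qed.

Let DB x y : D x -> D y -> D (x - y).
Proof. by move=> Dx Dy; apply: DD => //; exact: DN. Qed.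

Let DA (a : R) : D (a%:A : A). Proof. exact: DZ. Qed.

Lemma scalar_mulA (a : R) (x : A) : a%:A * x = a *: x.
Proof. by rewrite -scalerAl mul1r. Qed.

Lemma mul_scalarA (a : R) (x : A) : x * a%:A = a *: x.
Proof. by rewrite -scalerAr mulr1. Qed.

Lemma scalarA_inj : injective (fun a : R => a%:A : A).
Proof.
move=> a b /eqP; rewrite -subr_eq0 -scalerBl scaler_eq0 oner_eq0 orbF subr_eq0.
by move=> /eqP.
Qed.

Section ImaginaryUnit.
Variable I : A.
Hypothesis DI : D I.
Hypothesis II : I * I = - 1.

Definition cplx (z : Rcomplex R) : A := (complex.Re z)%:A + complex.Im z *: I.

Lemma Dcplx z : D (cplx z).
Proof. by apply: DD; exact: DZ. Qed.

Lemma cplx_linear : linear cplx.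
Proof.
move=> a [x y] [x' y']; rewrite /cplx /= !scalerDl scalerDr !scalerA.
by rewrite addrACA.
Qed.

HB.instance Definition _ := GRing.isLinear.Build R (Rcomplex R) A _ cplx cplx_linear.

Lemma cplxD z w : cplx (z + w) = cplx z + cplx w. Proof. exact: linearD. Qed.

Lemma cplxN z : cplx (- z) = - cplx z. Proof. exact: linearN. Qed.

Lemma cplx1 : cplx 1 = 1.
Proof. by rewrite /cplx /= scale1r scale0r addr0. Qed.

Lemma cplxM z w : cplx (z * w) = cplx z * cplx w.
Proof.
case: z w => [a b] [c d]; rewrite /cplx /= mulrDl !mulrDr !scalar_mulA mul_scalarA.
rewrite -!scalerAl -!scalerAr II !scalerA !scalerBl !scalerDl scalerN -!addrA.
by congr (_ + _); rewrite addrC -addrA [c * b]mulrC.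
Qed.

Lemma cplx_comm z : cplx z * I = I * cplx z.
Proof. by rewrite mulrDl mulrDr scalar_mulA mul_scalarA -scalerAl -scalerAr. Qed.

Lemma I_neq_scalar a : I <> a%:A.
Proof.
move=> Ia; have := II; rewrite Ia scalar_mulA scalerA -scaleN1r => /scalarA_inj aa.
by have := sqr_ge0 a; rewrite expr2 aa lerNr oppr0 ler10.
Qed.

Lemma cplx_inj : injective cplx.
Proof.
suff ker z : cplx z = 0 -> z = 0.
  move=> z w zw; apply/eqP; rewrite -subr_eq0; apply/eqP/ker.
  have := cplx_linear (-1) w z; rewrite !scaleN1r zw addNr => <-.
  by rewrite addrC.
case: z => a b; rewrite /cplx /= => ab0.
have b0 : b = 0.
  apply/eqP/negPn/negP => b0; apply: (@I_neq_scalar (- (b^-1 * a))).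
  apply: (scalerI b0); rewrite scalerA mulrN mulrA mulfV // mul1r scaleNr.
  by apply/eqP; rewrite -addr_eq0 addrC ab0.
move: ab0; rewrite b0 scale0r addr0 -(scale0r 1) => /scalarA_inj ->.
by [].
Qed.

(** [x - a] commutes with [b I], so [(x - a - b I)(x - a + b I)] is [(x - a)^2 + b^2 = 0], and one
    factor vanishes. *)
Lemma commutant x : D x -> x * I = I * x -> exists z, x = cplx z.
Proof.
move=> Dx xI; have [a [b ab]] := D_quadratic Dx.
have [|||E|E] := @D_domain (x - a%:A - b *: I) (x - a%:A + b *: I).
- by apply: DB; [apply: DB => //; exact: DA | exact: DZ].
- by apply: DD; [apply: DB => //; exact: DA | exact: DZ].
- set u := x - a%:A in ab *; set v := b *: I.
  have uv : u * v = v * u.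
    rewrite /u /v mulrBl mulrBr mul_scalarA scalar_mulA -scalerAr -scalerAl xI.
    by [].
  rewrite mulrBl (mulrDr u u v) (mulrDr v u v) uv opprD addrA addrK ab /v 
    -scalerAl -scalerAr II.
  by rewrite scalerA -expr2 scalerN opprK addNr.
- exists (Complex a b); apply/eqP; rewrite -subr_eq0 /cplx /= opprD addrA.
  exact/eqP.
- exists (Complex a (- b)); apply/eqP; rewrite -subr_eq0 /cplx /= scaleNr opprD opprK addrA.
  exact/eqP.
Qed.

Section SecondUnit.
Variable J : A.
Hypothesis DJ : D J.
Hypothesis JJ : J * J = - 1.
Hypothesis JI : J * I = - (I * J).

Definition quat (u : (Rcomplex R * Rcomplex R)%type) : A := cplx u.1 + cplx u.2 * J.

Lemma J_cplx z : J * cplx z = cplx (conjc z) * J.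
Proof.
case: z => a b; rewrite /cplx /= mulrDl mulrDr mul_scalarA scalar_mulA.
by rewrite -scalerAr -scalerAl JI scalerN scaleNr.
Qed.

Lemma quatM u v : quat (quat_mul u v) = quat u * quat v.
Proof.
rewrite /quat [(quat_mul u v).1]/= [(quat_mul u v).2]/= !cplxD cplxN !cplxM.
have := J_cplx v.2; have := J_cplx v.1.
move: (cplx u.1) (cplx u.2) (cplx v.1) (cplx v.2) (cplx v.1^*%C) (cplx v.2^*%C).
move=> p q r t r' t' E1 E2; rewrite !mulrDl !mulrDr.
rewrite -[q * J * r]mulrA E1 -[q * J * (t * J)]mulrA [J * (t * J)]mulrA E2.
rewrite -[t' * J * J]mulrA JJ mulrN1 mulrN !mulrA -!addrA; congr (_ + _).
by rewrite addrC -addrA.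
Qed.

Lemma quat_linear : linear quat.
Proof.
move=> a u v; rewrite /quat -[(a *: u + v).1]/(a *: u.1 + v.1).
rewrite -[(a *: u + v).2]/(a *: u.2 + v.2) !cplx_linear.
move: (cplx u.1) (cplx u.2) (cplx v.1) (cplx v.2) => p q r t.
by rewrite mulrDl -scalerAl scalerDr addrACA.
Qed.

Lemma quat_inj : injective quat.
Proof.
suff ker u : quat u = 0 -> u = 0.
  move=> u v uv; apply/eqP; rewrite -subr_eq0; apply/eqP/ker.
  have := quat_linear (-1) v u; rewrite !scaleN1r uv addNr => <-.
  by rewrite addrC.
case: u => z w; rewrite /quat /= => zw.
have w0 : cplx w = 0.
  have := cplx_comm w; have := cplx_comm z; move: (cplx z) (cplx w) zw => p q zw pI qI.
  have : (2%:R : R) *: (I * q * J) = 0.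
    (* The commutator with [I] removes the first term and doubles the second. *)
    have : I * (p + q * J) - (p + q * J) * I = 0.
      by rewrite zw mulr0 mul0r subr0.
    rewrite mulrDr mulrDl pI opprD addrACA subrr add0r -(mulrA q) JI.
    rewrite mulrN opprK (mulrA q) qI !mulrA => <-.
    by rewrite scaler_nat mulr2n.
  move=> /eqP; rewrite scaler_eq0 pnatr_eq0 /= => /eqP IwJ.
  have := congr1 (fun x => I * x * J) IwJ; rewrite mulr0 mul0r => /eqP.
  by rewrite -!mulrA JJ !mulrA II mulN1r mulrN mulr1 opprK => /eqP.
move: zw; rewrite w0 mul0r addr0 => z0.
by congr pair; apply: cplx_inj; rewrite ?z0 ?w0 linear0.
Qed.

Lemma quat_iso : alg_iso (@quat_mul R) (1, 0) quat.
Proof.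
split; [exact: quat_linear | | exact: quatM | exact: quat_inj |].
  by rewrite /quat /= cplx1 linear0 mul0r addr0.
move=> x; split=> [Dx|[u ->]]; last first.
  by apply: DD; [exact: Dcplx | apply: D_mul => //; exact: Dcplx].
have DIxI : D (I * x * I) by do ?apply: D_mul.
(* Conjugation by [I] splits [x] into a part commuting with [I] and a part anticommuting with it;
   the latter times [J] commutes with [I] again. *)
pose xp := 2%:R^-1 *: (x - I * x * I); pose xm := 2%:R^-1 *: (x + I * x * I).
have [|z xpz] := @commutant xp (DZ _ (DB Dx DIxI)).
  rewrite /xp -scalerAl -scalerAr mulrBl mulrBr !mulrA II -!mulrA II mulrN1 mulN1r.
  by rewrite mulrN !opprK addrC.
have xmI : xm * I = - (I * xm).
  rewrite /xm -scalerAl -scalerAr mulrDl mulrDr !mulrA II -!mulrA II mulrN1 mulN1r.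
  by rewrite -scalerN mulrN opprD opprK addrC.
have [||w xmw] := @commutant (xm * J).
- by apply: D_mul => //; exact/DZ/DD.
- by rewrite -mulrA JI mulrN mulrA xmI mulNr opprK mulrA.
exists (z, - w); rewrite /quat [(z, - w).1]/= [(z, - w).2]/= cplxN -xpz -xmw.
rewrite mulNr -mulrA JJ mulrN1 opprK.
rewrite -scalerDr addrACA addNr addr0 -mulr2n -scaler_nat scalerA mulVf ?scale1r //.
by rewrite pnatr_eq0.
Qed.

Lemma quat_central x : D x -> (forall y, D y -> x * y = y * x) -> exists a, x = a%:A.
Proof.
move=> Dx cx; have [[a b] xz] := commutant Dx (cx _ DI).
exists a; rewrite xz /cplx /=.
have := cx J DJ; rewrite xz J_cplx => /eqP; rewrite -subr_eq0 -mulrBl => /eqP xJ.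
have [|/eqP|J0] := D_domain _ DJ xJ; first by apply: DB; exact: Dcplx.
  rewrite subr_eq0 => /eqP /cplx_inj [/eqP]; rewrite -addr_eq0 -mulr2n mulrn_eq0 /=.
  by move=> /eqP->; rewrite scale0r addr0.
by move: JJ; rewrite J0 mul0r => /esym/eqP; rewrite oppr_eq0 oner_eq0.
Qed.

End SecondUnit.
End ImaginaryUnit.

(** Besides the classification, the position of a central element is recorded, since this is what
    turns the endomorphism [Phi] into [ik]. *)
Theorem frobenius x : D x -> (forall y, D y -> x * y = y * x) ->
  (exists2 f : Rcomplex R -> A, alg_iso *%R 1 f & exists z, x = f z) \/
  (((exists f : R^o -> A, alg_iso *%R 1 f) \/
    (exists f, alg_iso (@quat_mul R) (1, 0) f)) /\ exists a, x = a%:A).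
Proof.
move=> Dx cx.
have scalar_case : (forall y, D y -> exists a, y = a%:A) ->
    alg_iso (B := R^o) *%R 1 (fun a => a%:A).
  move=> all_scalar; split.
  - by move=> a b c; rewrite scalerDl scalerA.
  - exact: scale1r.
  - by move=> a b; rewrite scalar_mulA scalerA.
  - exact: scalarA_inj.
  - by move=> y; split=> [/all_scalar//|[a ->]]; exact: DA.
have [all_scalar|/existsNP[y /not_implyP[Dy yR]]] :=
    pselect (forall y, D y -> exists a, y = a%:A).
  right; split; last exact: all_scalar.
  by left; exists (fun a => a%:A); exact: scalar_case.
have [a [b ab]] := D_quadratic Dy.
have Dya : D (y - a%:A) by apply: DB => //; exact: DA.
have b0 : b != 0.
  apply/negP => /eqP b0; case: yR; exists a; apply/eqP; rewrite -subr_eq0; apply/eqP.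
  by have [|//|//] := D_domain Dya Dya; rewrite ab b0 expr0n scale0r oppr0.
pose I := b^-1 *: (y - a%:A).
have DI : D I by exact: DZ.
have II : I * I = - 1.
  rewrite /I -scalerAl -scalerAr ab !scalerN scalerA scalerA.
  by rewrite -invfM -expr2 mulVf ?scale1r // expf_neq0.
have [comm|/existsNP[t /not_implyP[Dt tI]]] := pselect (forall t, D t -> t * I = I * t).
  left; exists (cplx I); last exact: commutant (cx _ DI).
  split; [exact: cplx_linear | exact: cplx1 | exact: cplxM | exact: cplx_inj |].
  move=> u; split=> [Du|[z ->]]; last exact: Dcplx.
  exact: commutant (comm _ Du).
(* A commutator with [I] anticommutes with [I], because the square of [I] is central. *)
have [v [Dv v0 vI]] : exists v, [/\ D v, v != 0 & v * I = - (I * v)].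
  exists (t * I - I * t); split; first by apply: DB; apply: D_mul.
    by rewrite subr_eq0; apply/eqP.
  rewrite mulrBl mulrBr -[t * I * I]mulrA II [I * (I * t)]mulrA II.
  by rewrite mulrN1 mulN1r opprK opprD !mulrA addrC.
have two0 (u : A) : u + u = 0 -> u = 0.
  rewrite -mulr2n -scaler_nat => /eqP; rewrite scaler_eq0 pnatr_eq0 /=.
  by move/eqP.
have Iv0 : I * v <> 0.
  move=> /(congr1 (fun u => I * u)); rewrite mulrA II mulN1r mulr0 => /eqP.
  by rewrite oppr_eq0 (negPf v0).
have [[c d] vv] : exists z, v * v = cplx I z.
  apply: commutant => //; first exact: D_mul.
  by rewrite -mulrA vI mulrN !mulrA vI mulNr opprK.
rewrite /cplx /= in vv.
(* [v] commutes with its own square but anticommutes with [I], which excludes a term in [I]. *)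
have d0 : d = 0.
  have : v * (v * v) = v * v * v by rewrite mulrA.
  rewrite vv mulrDl mulrDr mul_scalarA scalar_mulA -scalerAr -scalerAl vI.
  move=> /addrI/eqP; rewrite scalerN eq_sym -addr_eq0 => /eqP/two0/eqP.
  by rewrite scaler_eq0 => /orP[/eqP//|/eqP].
rewrite d0 scale0r addr0 in vv.
have scalar0 (r : R) : v <> r%:A.
  move=> vr; apply/Iv0/two0; apply/eqP; rewrite addr_eq0 -vI vr.
  by rewrite scalar_mulA mul_scalarA.
(* A square root of a nonnegative scalar is a scalar in a domain, and no scalar anticommutes with
   [I] without being zero. *)
have c0 : c < 0.
  rewrite ltNge; apply/negP => c0; pose r := Num.sqrt c.
  have [|||/eqP|/eqP] := @D_domain (v - r%:A) (v + r%:A).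
  - by apply: DB => //; exact: DA.
  - by apply: DD => //; exact: DA.
  - rewrite mulrBl !mulrDr vv !scalar_mulA !mul_scalarA scalerA -expr2 sqr_sqrtr //.
    by rewrite opprD addrA addrK subrr.
  - by rewrite subr_eq0 => /eqP; exact: scalar0.
  - by rewrite addr_eq0 -scaleNr => /eqP; exact: scalar0.
pose J := (Num.sqrt (- c))^-1 *: v.
have DJ : D J by exact: DZ.
have JJ : J * J = - 1.
  rewrite /J -scalerAl -scalerAr vv !scalerA -invfM -expr2 sqr_sqrtr; last first.
    by rewrite oppr_ge0 ltW.
  by rewrite invrN mulNr mulVf ?lt_eqF // scaleN1r.
have JI : J * I = - (I * J).
  by rewrite /J -scalerAl vI scalerN scalerAr.
right; split; last exact: (quat_central DI II DJ JJ JI).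
by right; exists (quat I J); exact: quat_iso.
Qed.

End Frobenius.

(** * Vanishing of traces *)

Section TraceZero.
Variables (R : realType) (s : lieAlgebra R) (l : lieModule s).
Hypothesis nd : forall x : s, (forall y, killing x y = 0) -> x = 0.

(** Traces vanish on brackets. A functional vanishing on brackets is represented by an element [z]
    orthogonal to them all, hence central, hence zero. *)
Lemma lftr_rho (x : s) : lftr (rho x : 'End(l)) = 0.
Proof.
have [W WP] : exists W : {vspace s}, forall x, x \in W <-> lftr (rho x : 'End(l)) = 0.
  apply: vspace_of_pred => [|a u v u0 v0].
    by rewrite -(scale0r (0 : s)) rhoZ scale0r lftr0.
  by rewrite rhoD rhoZ lftrD lftrZ u0 v0 mulr0 addr0.
apply/WP; apply: contraT => xW; have [g [gW gx]] := separating_functional xW.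
have [z gz] := killing_represents nd g.
have z0 : z = 0.
  suff z_central y : lie_br z y = 0.
    apply: nd => y; rewrite /killing (_ : ad z = 0) ?comp_lfun0l ?lftr0 //.
    by apply/lfunP => u; rewrite adE z_central zero_lfunE.
  apply: nd => u; rewrite killing_br -gz gW //; apply/WP.
  by rewrite rho_br lftrB lftr_comp subrr.
by rewrite gz z0 killing0l eqxx in gx.
Qed.

End TraceZero.

Section ImaginarySpectrum.
Variables (R : realType) (s : lieAlgebra R) (gs : int -> {vspace s}) (j : s).
Variables (l : lieModule s) (gl : int -> {vspace l}) (psi : 'End(l)).
Hypothesis gr : graded_lie gs.
Hypothesis nd : forall x : s, (forall y, killing x y = 0) -> x = 0.
Hypothesis fund : fundamental_lie gs.
Hypothesis tr : transitive_lie gs.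
Hypothesis glr : graded_module gs gl.
Hypothesis irr : irreducible l.
Hypothesis gl2 : gl (-2) <> 0%VS.
Hypothesis j_grade0 : forall a, a \in gs 0 -> lie_br j a = 0.
Hypothesis j_gradeN1 : forall x, x \in gs (-1) -> lie_br j (lie_br j x) = - x.
Hypothesis j_grade1 : forall x, x \in gs 1 -> lie_br j (lie_br j x) = - x.
Hypothesis psi_act : forall x y,
  psi (mod_act x y) = mod_act (lie_br j x) y + mod_act x (psi y).
Hypothesis psi_grade : forall p y, y \in gl p -> psi y \in gl p.
Hypothesis psi2 : forall y, y \in gl (-2) -> psi y = 0.
Local Notation ll := (double_module l).
Local Notation dgl := (glr.1 : direct_decomposition gl).

(* [w.1 + i w.2] is an eigenvector of [psi] for [a + i b] *)
Definition eigen_pair (a b : R) (w : ll) : Prop :=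
  psi w.1 = a *: w.1 - b *: w.2 /\ psi w.2 = b *: w.1 + a *: w.2.

(** The new pair is [x - i e [j, x]] applied to [w.1 + i w.2]; this element is twice the component
    of [x] with eigenvalue [i e] for [ad j]. *)
Lemma eigen_pair_shift a b (e : R) x w :
  e = 1 \/ e = -1 -> lie_br j (lie_br j x) = - x -> eigen_pair a b w ->
  eigen_pair a (b + e) ((mod_act x w.1 + e *: mod_act (lie_br j x) w.2,
                         mod_act x w.2 - e *: mod_act (lie_br j x) w.1) : ll).
Proof.
move=> e1 jjx [w1 w2].
have ee : e * e = 1 by case: e1 => ->; rewrite ?mulr1 ?mulrNN ?mulr1.
set x' := lie_br j x in jjx *.
split=> /=; rewrite linearD ?linearN linearZ /= !psi_act jjx -/x' w1 w2;
  rewrite !(mod_actDr, mod_actNr, mod_actZr, mod_actNl);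
  move: (mod_act x w.1) (mod_act x w.2) (mod_act x' w.1) (mod_act x' w.2) => p q r t;
  rewrite !(scalerDr, scalerDl, scalerN, opprD, opprK, scalerA, mulrDl, mulrDr);
  rewrite -?(mulrC e) ?ee ?scalerDl ?scale1r !addrA.
  by rewrite [LHS](ACl (2*6*3*4*5*1)).
by rewrite [LHS](ACl (2*4*6*1*3*5)).
Qed.

(** Irreducibility concerns [l], not its complexification. Stability of [E] under conjugation and
    under multiplication by [i] brings the submodule [E] down to a submodule [W] of [l]. *)
Lemma imaginary_spectrum a b w : a != 0 -> eigen_pair a b w -> w = 0.
Proof.
move=> a0 wab.
have [E [GE OE Eind]] := @module_closure _ _ ll (fun w => exists b, eigen_pair a b w)
  (fun _ => False).
have Est p x w' : p \in [:: -1; 0; 1] -> x \in gs p -> w' \in E -> mod_act x w' \in E.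
  move=> p1 xp; move: w'; apply: Eind => //.
  - by rewrite mod_act0r mem0v.
  - by move=> c u v uE vE; rewrite mod_actDr mod_actZr memvD ?memvZ.
  move=> {}w {b wab} [b wb].
  have pm : lie_br j (lie_br j x) = - x -> mod_act x w \in E.
    move=> jjx.
    have H1 : ((mod_act x w.1 + 1 *: mod_act (lie_br j x) w.2,
          mod_act x w.2 - 1 *: mod_act (lie_br j x) w.1) : ll) \in E.
      by apply: GE; exists (b + 1); apply: eigen_pair_shift => //; left.
    have H2 : ((mod_act x w.1 + (-1) *: mod_act (lie_br j x) w.2,
          mod_act x w.2 - (-1) *: mod_act (lie_br j x) w.1) : ll) \in E.
      by apply: GE; exists (b + -1); apply: eigen_pair_shift => //; right.
    have := memvZ 2%:R^-1 (memvD H1 H2); congr (_ \in E).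
    have half (v : l) : 2%:R^-1 *: (v + v) = v.
      by rewrite -mulr2n -scaler_nat scalerA mulVf ?scale1r // pnatr_eq0.
    congr pair => /=; rewrite scaleN1r scale1r.
      by rewrite addrACA subrr addr0 half.
    by rewrite opprK addrACA addNr addr0 half.
  move: p1 xp; rewrite !inE => /or3P[] /eqP-> xp.
  - exact/pm/j_gradeN1.
  - apply: GE; exists b; case: wb => w1 w2.
    split=> /=; rewrite psi_act j_grade0 // mod_act0l add0r ?w1 ?w2.
      by rewrite mod_actDr mod_actNr !mod_actZr.
    by rewrite mod_actDr !mod_actZr.
  - exact/pm/j_grade1.
have Eall := stable_generation gr fund nd tr Est.
have Econj w' : w' \in E -> ((w'.1, - w'.2) : ll) \in E.
  move: w'; apply: Eind => //.
  - by rewrite oppr0 mem0v.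
  - move=> c u v uE vE; have := memvD (memvZ c uE) vE.
    by congr (_ \in E); congr pair => /=; rewrite opprD scalerN.
  move=> z [c [w1 w2]]; apply: GE; exists (- c); split=> /=.
    by rewrite w1 scaleNr scalerN opprK.
  by rewrite linearN /= w2 opprD scalerN scaleNr.
have Erot w' : w' \in E -> ((- w'.2, w'.1) : ll) \in E.
  move: w'; apply: Eind => //.
  - by rewrite oppr0 mem0v.
  - move=> c u v uE vE; have := memvD (memvZ c uE) vE.
    by congr (_ \in E); congr pair => /=; rewrite opprD scalerN.
  move=> z [c [w1 w2]]; apply: GE; exists c; split=> /=.
    by rewrite linearN /= w2 opprD scalerN addrC.
  by rewrite w1 scalerN addrC.
have E1 w' : w' \in E -> ((w'.1, 0) : ll) \in E.
  move=> w'E; have := memvZ (2%:R^-1) (memvD w'E (Econj _ w'E)).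
  congr (_ \in E); congr pair => /=; last by rewrite subrr scaler0.
  by rewrite -mulr2n -scaler_nat scalerA mulVf ?scale1r // pnatr_eq0.
have [W WP] : exists W : {vspace l}, forall y, y \in W <-> ((y, 0) : ll) \in E.
  apply: vspace_of_pred => [|c u v Hu Hv]; first exact: mem0v.
  by have := memvD (memvZ c Hu) Hv; congr (_ \in E); congr pair => /=; rewrite scaler0 addr0.
have Wst x y : y \in W -> mod_act x y \in W.
  move=> /WP yE; apply/WP; have := Eall x _ yE.
  by congr (_ \in E); congr pair => /=; rewrite mod_act0r.
have Elow w' : w' \in E -> gcomp dgl (-2) w'.1 = 0 /\ gcomp dgl (-2) w'.2 = 0.
  move: w'; apply: Eind => //.
  - by rewrite !linear0.
  - by move=> c u v [u1 u2] [v1 v2]; rewrite /= !linearP /= u1 u2 v1 v2 scaler0 addr0.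
  move=> z [c [w1 w2]].
  have psi_gcomp y : psi (gcomp dgl (-2) y) = gcomp dgl (-2) (psi y).
    elim/(grade_ind dgl): y => [|u v Hu Hv|p y yp].
    - by rewrite !linear0.
    - by rewrite !linearD /= Hu Hv.
    have [pE|p2] := eqVneq p (-2).
      by rewrite pE in yp; rewrite !gcomp_id ?psi_grade.
    by rewrite (gcomp_other dgl yp p2) (gcomp_other dgl (psi_grade yp) p2) linear0.
  have := psi_gcomp z.1; have := psi_gcomp z.2.
  rewrite (psi2 (gcomp_mem dgl _ z.1)) (psi2 (gcomp_mem dgl _ z.2)) w1 w2.
  rewrite linearB linearD !linearZ /= ?linearN ?scalerN.
  set g1 := gcomp _ _ z.1; set g2 := gcomp _ _ z.2 => Ea Eb.
  have ab0 : a ^+ 2 + c ^+ 2 != 0.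
    by rewrite gt_eqF // ltr_wpDr ?sqr_ge0 // exprn_even_gt0.
  have H1 : (a ^+ 2 + c ^+ 2) *: g1 = a *: (a *: g1 - c *: g2) + c *: (c *: g1 + a *: g2).
    by rewrite scalerBr scalerDr !scalerA addrA addrAC (mulrC c a) subrK -scalerDl.
  have H2 : (a ^+ 2 + c ^+ 2) *: g2 = a *: (c *: g1 + a *: g2) - c *: (a *: g1 - c *: g2).
    rewrite scalerBr scalerDr !scalerA opprB (mulrC c a).
    by rewrite addrA -[_ + _ + (c * c) *: g2]addrA addrAC subrr add0r -scalerDl.
  move: H1 H2; rewrite -Ea -Eb !scaler0 subr0 addr0 => /eqP H1 /eqP H2.
  by move: H1 H2; rewrite !scaler_eq0 (negPf ab0) /= => /eqP-> /eqP->.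
have Wzero y : y \in W -> y = 0.
  move=> yW; apply: contrapT => y0; apply: gl2.
  have Wfull := irreducible_full irr Wst yW y0.
  apply/eqP; rewrite -subv0; apply/subvP => v v2; rewrite memv0.
  have /WP/Elow[/=] : v \in W by rewrite Wfull memvf.
  by rewrite gcomp_id // => -> _.
have wE : w \in E by apply: GE; exists b.
rewrite [w]surjective_pairing; congr pair; apply: Wzero; apply/WP; first exact: E1.
have := E1 _ (Erot _ wE); rewrite -memvN; congr (_ \in E).
by congr pair => /=; rewrite ?opprK ?oppr0.
Qed.

Lemma lftr_imaginary : lftr psi = 0.
Proof.
have := @mxtrace_Re0 R _ (cmx psi); rewrite cmx_trace /=; apply=> c.
move=> /cmx_eigen[u [v [uv0 pu pv]]]; apply: contraTeq uv0 => c0.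
have [-> ->] : ((u, v) : ll) = 0.
  by apply: (imaginary_spectrum (a := complex.Re c) (b := complex.Im c)).
by rewrite eqxx.
Qed.

End ImaginarySpectrum.

(** * The endomorphism algebra of an irreducible module *)

Section EndomorphismAlgebra.
Variables (R : realType) (V : vectType R).
Hypothesis V_proper : (0 < dim V)%N.

Definition end_lalg : lalgType R := HB.pack 'End(V) (lfun_comp_nzRingType V_proper)
  (GRing.Lmodule_isLalgebra.Build R (lfun_comp_nzRingType V_proper)
    (fun k x y => comp_lfunZl k x y)).

Definition end_alg : algType R := HB.pack 'End(V) end_lalg
  (GRing.Lalgebra_isAlgebra.Build R end_lalg (fun k x y => comp_lfunZr k x y)).

End EndomorphismAlgebra.

Section EndomorphismType.
Variables (R : realType) (s : lieAlgebra R) (l : lieModule s).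
Hypothesis irr : irreducible l.

Lemma irreducible_dim : (0 < dim l)%N.
Proof.
rewrite -dimvf lt0n dimv_eq0; apply/eqP; exact: irr.1.
Qed.

Lemma commutes_linear a (phi psi : 'End(l)) : commutes_with_action phi ->
  commutes_with_action psi -> commutes_with_action (a *: phi + psi).
Proof.
move=> cphi cpsi x y; rewrite !add_lfunE !scale_lfunE cphi cpsi.
by rewrite mod_actDr mod_actZr.
Qed.

Lemma commutes_one : commutes_with_action (\1%VF : 'End(l)).
Proof. by move=> x y; rewrite !id_lfunE. Qed.

Lemma commutes_comp (phi psi : 'End(l)) : commutes_with_action phi ->
  commutes_with_action psi -> commutes_with_action (phi \o psi)%VF.
Proof. by move=> cphi cpsi x y; rewrite !comp_lfunE cpsi cphi. Qed.

(** For an eigenvalue [a + i b] of [phi], the real operator [(phi - a)^2 + b^2] kills the real and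
    imaginary parts of an eigenvector, so it is zero by Schur. *)
Lemma commutes_quadratic (phi : 'End(l)) : commutes_with_action phi ->
  exists a b : R, ((phi - a *: \1) \o (phi - a *: \1))%VF = - (b ^+ 2 *: \1%VF).
Proof.
move=> cphi; have [|c /cmx_eigen[u [v [uv0 pu pv]]]] := cmx_eigen_exists _ phi.
  by rewrite dimvf irreducible_dim.
set a := complex.Re c in pu pv; set b := complex.Im c in pu pv.
pose q := phi - a *: \1%VF; exists a, b.
have qE y : q y = phi y - a *: y by rewrite add_lfunE opp_lfunE scale_lfunE id_lfunE.
have cq : commutes_with_action q.
  by move=> x y; rewrite !qE cphi mod_actBr mod_actZr.
have qu : q u = - (b *: v) by rewrite qE pu addrAC subrr add0r.
have qv : q v = b *: u by rewrite qE pv addrK.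
apply/eqP; rewrite -addr_eq0; apply/eqP; apply: contrapT => th0.
have cth : commutes_with_action ((q \o q)%VF + b ^+ 2 *: \1%VF).
  rewrite addrC; apply: commutes_linear; first exact: commutes_one.
  exact: commutes_comp.
have thE y : ((q \o q)%VF + b ^+ 2 *: \1%VF) y = q (q y) + b ^+ 2 *: y.
  by rewrite add_lfunE scale_lfunE id_lfunE comp_lfunE.
have inj := schur irr cth th0.
have u0 : u = 0.
  by apply: inj; rewrite thE qu linearN linearZ /= qv scalerA -expr2 addNr.
have v0 : v = 0.
  by apply: inj; rewrite thE qv linearZ /= qu scalerN scalerA -expr2 addNr.
by rewrite u0 v0 eqxx in uv0.
Qed.

Lemma endomorphism_type (phi : 'End(l)) : commutes_with_action phi ->
  (forall psi, commutes_with_action psi -> (phi \o psi = psi \o phi)%VF) ->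
  (exists2 f, complex_End_iso (l := l) f & exists z, phi = f z) \/
  ((real_type l \/ quaternionic_type l) /\ exists a, phi = a *: \1%VF).
Proof.
move=> cphi central.
have := @frobenius R (end_alg irreducible_dim) (@commutes_with_action R s l)
  commutes_one commutes_linear commutes_comp _ _ phi cphi central.
case.
- move=> x y cx cy xy; have [->|x0] := pselect (x = 0); [by left | right].
  apply/lfunP => u; rewrite zero_lfunE; apply: (schur irr cx x0).
  by rewrite -comp_lfunE (_ : (x \o y)%VF = 0) ?zero_lfunE.
- by move=> x /commutes_quadratic.
- move=> [f [f1 f2 f3 f4 f5] fz]; by left; exists f; [split |].
move=> [[[f [f1 f2 f3 f4 f5]]|[f [f1 f2 f3 f4 f5]]] ex]; right; split=> //.
  by left; exists f; split.
by right; exists f; split.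
Qed.

End EndomorphismType.

(** * Partial Levi-Tanaka extensions *)

(** The complex eigenvalues are square roots of -1, so their real parts vanish. *)
Lemma lftr_complex_structure (R : realType) (V : vectType R) (f : 'End(V)) :
  (f \o f)%VF = - \1%VF -> lftr f = 0.
Proof.
move=> ff; have := @mxtrace_Re0 R _ (cmx f); rewrite cmx_trace /=; apply=> c.
move=> /eigenvalueP[v vc v0].
have cc : c * c = -1.
  have : v *m cmx f *m cmx f = c * c *: v by rewrite vc -scalemxAl vc scalerA.
  rewrite -mulmxA -cmx_comp ff -[- _]add0r cmxB cmx0 sub0r mulmxN.
  rewrite /cmx /endmx mxof1 ?(basis_free (basP V)) // map_mx1 mulmx1 -scaleN1r.
  move=> /eqP; rewrite -subr_eq0 -scalerBl scaler_eq0 (negPf v0) orbF subr_eq0.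
  by move=> /eqP.
case: c cc {vc} => x y /eqP; rewrite eq_complex /= oppr0 => /andP[/eqP xy].
rewrite (mulrC y) -mulr2n mulrn_eq0 /= mulf_eq0 => /orP[] /eqP E //.
by move: xy (sqr_ge0 x); rewrite E mulr0 subr0 expr2 => ->; rewrite oppr_ge0 ler10.
Qed.

Section CRElement.
Variables (R : realType) (s : lieAlgebra R) (gs : int -> {vspace s}).
Variables (J : s -> s) (Js : s).
Hypothesis s_CR : graded_CR gs J.
Hypothesis s_transitive : transitive_lie gs.
Hypothesis Js_def : CR_element gs J Js.

Let gr : graded_lie gs := s_CR.1.

Lemma CR_elementE x : x \in gs (-1) -> J x = lie_br Js x.
Proof. by move=> xg; rewrite Js_def.2. Qed.

Lemma CR_element_mem x : x \in gs (-1) -> J x \in gs (-1).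
Proof. by have [_ [mem _ _ _ _]] := s_CR; exact: mem. Qed.

Lemma CR_element_gradeN1 x : x \in gs (-1) -> lie_br Js (lie_br Js x) = - x.
Proof.
have [_ [_ _ JK _ _]] := s_CR.
by move=> xg; rewrite -!CR_elementE ?CR_element_mem // JK.
Qed.

(** [[J_s, a]] kills [gs (-1)] because [J] commutes there with [ad a]; transitivity in degree 0
    concludes. *)
Lemma CR_element_grade0 a : a \in gs 0 -> lie_br Js a = 0.
Proof.
have [_ [_ _ _ _ JA]] := s_CR; move=> a0; apply: contrapT => ja.
have ja0 : lie_br Js a \in gs 0 by rewrite -[0]add0r (grade_br gr) // Js_def.1.
have [//|x xg] := s_transitive (p := 0) _ ja0 ja; apply.
have ax : lie_br a x \in gs (-1) by rewrite -[-1]add0r (grade_br gr).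
by rewrite /= lie_brC lie_br_br -!CR_elementE // JA // subrr oppr0.
Qed.

End CRElement.

Section Equivalence.
Variables (R : realType) (s : lieAlgebra R) (gs : int -> {vspace s}).
Variables (J : s -> s) (Js : s) (l : lieModule s) (gl : int -> {vspace l}).
Hypothesis s_CR : graded_CR gs J.
Hypothesis s_fundamental : fundamental_lie gs.
Hypothesis s_transitive : transitive_lie gs.
Hypothesis Js_def : CR_element gs J Js.
Hypothesis l_graded : graded_module gs gl.
Hypothesis l_irreducible : irreducible l.

Let gr : graded_lie gs := s_CR.1.
Local Notation j0 := (Js_def.1 : Js \in gs 0).
Local Notation sl := (abelian_extension l).
Local Notation g := (ext_grade gs gl).

Lemma nonzero_pick (V : vectType R) (U : {vspace V}) : U <> 0%VS ->
  exists2 y, y \in U & y <> 0.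
Proof.
move=> U0; exists (vpick U); first exact: memv_pick.
by move=> /eqP; rewrite vpick0 => /eqP.
Qed.

(** * Sufficiency, with [T] in the role of multiplication by [ik] *)

Section Sufficiency.
Hypothesis l_effective : effective_on_degenerate l gs.
Hypothesis gl1 : gl (-1) <> 0%VS.
Hypothesis gl2 : gl (-2) <> 0%VS.
Variable T : 'End(l).
Hypothesis T_comm : commutes_with_action T.
Hypothesis T0 : forall y, y \in gl 0 -> mod_act Js y = T y.
Hypothesis T2 : forall y, y \in gl (-2) -> mod_act Js y = T y.

Lemma transitive_l : transitive_module gs gl.
Proof.
move=> p y p0 yp y0; apply: contrapT => no_x; apply: y0.
apply: (lowest_vector l_irreducible gr l_graded s_fundamental (q := -1) _ gl1 yp).
  by lia.
by move=> x xg; apply: contrapT => xy; apply: no_x; exists x.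
Qed.

Lemma nondegenerate_l y : y \in gl (-1) ->
  (forall x, x \in gs (-1) -> mod_act x y = 0) -> y = 0.
Proof. by move=> y1; apply: (lowest_vector l_irreducible gr l_graded _ (q := -2) (p := -1)). Qed.

Lemma generated_l p : p < 0 -> (gl (p - 1) <= mod_brv (gs (-1)) (gl p))%VS.
Proof. exact: (generated_below l_irreducible gr l_graded _ (q := -1)). Qed.

Let Jl y := mod_act Js y - T y.

Lemma Jl_mem y : y \in gl (-1) -> Jl y \in gl (-1).
Proof.
move=> y1; rewrite memvB ?(commutes_grade l_irreducible gr l_graded) //.
by rewrite -[-1]add0r (grade_act l_graded) ?j0.
Qed.

Lemma Jl_down x y : x \in gs (-1) -> y \in gl 0 -> Jl (mod_act x y) = mod_act (J x) y.
Proof.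
move=> xg y0; rewrite /Jl T_comm -T0 // (CR_elementE Js_def xg).
by rewrite mod_actbr.
Qed.

(** [mod_act x y] lies in [gl (-2)], where [J_s] coincides with [T]. *)
Lemma Jl_downN1 x y : x \in gs (-1) -> y \in gl (-1) ->
  mod_act (J x) y = - mod_act x (Jl y).
Proof.
move=> xg y1; rewrite (CR_elementE Js_def xg) mod_actbr /Jl mod_actBr opprB -T_comm.
by rewrite T2 //; exact: (grade_act l_graded xg y1).
Qed.

(** By nondegeneracy the identity may be tested after acting by [gs (-1)]; there [Jl_downN1], used
    twice, reduces it to the identity for [J]. *)
Lemma Jl_square y : y \in gl (-1) -> Jl (Jl y) = - y.
Proof.
move=> y1; apply/eqP; rewrite -addr_eq0; apply/eqP; apply: nondegenerate_l.
  by rewrite memvD // !Jl_mem.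
move=> x xg; rewrite mod_actDr; apply/eqP; rewrite addr_eq0.
have [_ [Jm _ JK _ _]] := s_CR.
have := Jl_downN1 (Jm _ xg) y1; rewrite JK // mod_actNl => ->.
by rewrite (Jl_downN1 xg (Jl_mem y1)) opprK.
Qed.

Lemma Jl_bracket x y : x \in gs (-1) -> y \in gl (-1) ->
  mod_act (J x) (Jl y) = mod_act x y.
Proof.
by move=> xg y1; rewrite Jl_downN1 ?Jl_mem // Jl_square // mod_actNr opprK.
Qed.

Lemma Jl_linear a y y' : Jl (a *: y + y') = a *: Jl y + Jl y'.
Proof.
by rewrite /Jl linearP /= mod_actDr mod_actZr scalerBr opprD addrACA.
Qed.

Lemma Jl_sub y y' : Jl (y - y') = Jl y - Jl y'.
Proof. by have := Jl_linear (-1) y' y; rewrite !scaleN1r ![- _ + _]addrC. Qed.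

Lemma Jl_act0 a y : a \in gs 0 -> mod_act a (Jl y) = Jl (mod_act a y).
Proof.
move=> a0; rewrite /Jl mod_actBr -T_comm; congr (_ - _).
have := mod_actbr Js a y.
rewrite (CR_element_grade0 s_CR s_transitive Js_def a0) mod_act0l => /esym/eqP.
by rewrite subr_eq0 => /eqP.
Qed.

Lemma ext_graded : graded_lie (s := sl) g.
Proof.
split; first exact: (pair_decomposition gr.1 l_graded.1).
move=> p q u v; rewrite !mem_ext_grade => /andP[u1 u2] /andP[v1 v2].
apply/andP; split; first exact: (grade_br gr).
apply: memvB; first exact: (grade_act l_graded).
by rewrite addrC; exact: (grade_act l_graded).
Qed.

Lemma sufficiency_CR : CR_module gs J gl.
Proof.
have [_ [Jm Jlin JK Jbr JA]] := s_CR.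
exists Jl; split; first exact: ext_graded.
split.
- by move=> u; rewrite !mem_ext_grade => /andP[u1 u2]; rewrite Jm ?Jl_mem.
- move=> a u v; rewrite !mem_ext_grade => /andP[u1 u2] /andP[v1 v2].
  by congr pair; [exact: Jlin | exact: Jl_linear].
- move=> u; rewrite mem_ext_grade => /andP[u1 u2].
  by congr pair => /=; rewrite ?JK ?Jl_square.
- move=> u v; rewrite !mem_ext_grade => /andP[u1 u2] /andP[v1 v2].
  by congr pair => /=; rewrite ?Jbr ?Jl_bracket.
move=> u v; rewrite !mem_ext_grade => /andP[u1 u2] /andP[v1 v2].
congr pair => /=; first exact: JA.
by rewrite Jl_act0 // -Jl_down // Jl_sub.
Qed.

Lemma sufficiency_fundamental : fundamental_lie (s := sl) g.
Proof.
move=> p p0; apply/eqP; rewrite eqEsubv; apply/andP; split; last first.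
  apply/(@mod_brv_subP _ _ (adjoint sl)) => u v ug vg; rewrite addrC.
  exact: (grade_br ext_graded ug vg).
set B := mod_brv _ _.
have memB (u v : sl) : u \in g (-1) -> v \in g p -> ext_br u v \in B.
  exact: (@memv_br_mod _ _ (adjoint sl)).
apply/subvP => u; rewrite mem_ext_grade => /andP[u1 u2].
have [B1 B1P] : exists B1 : {vspace s}, forall x, x \in B1 <-> ((x, 0) : sl) \in B.
  apply: vspace_of_pred => [|c v w Hv Hw]; first exact: mem0v.
  by have := memvD (memvZ c Hv) Hw; congr (_ \in B); congr pair => /=; rewrite scaler0 addr0.
have [B2 B2P] : exists B2 : {vspace l}, forall y, y \in B2 <-> ((0, y) : sl) \in B.
  apply: vspace_of_pred => [|c v w Hv Hw]; first exact: mem0v.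
  by have := memvD (memvZ c Hv) Hw; congr (_ \in B); congr pair => /=; rewrite scaler0 addr0.
have sB1 : (gs (p - 1) <= B1)%VS.
  rewrite s_fundamental //; apply/(@mod_brv_subP _ _ (adjoint s)) => x y xg yg; apply/B1P.
  have := memB ((x, 0) : sl) ((y, 0) : sl); rewrite !mem_ext_grade /= xg yg !mem0v.
  move=> /(_ isT isT); congr (_ \in B); congr pair => /=.
  by rewrite !mod_act0r subrr.
have sB2 : (gl (p - 1) <= B2)%VS.
  apply: subv_trans (generated_l p0) _; apply/mod_brv_subP => x y xg yg; apply/B2P.
  have := memB ((x, 0) : sl) ((0, y) : sl); rewrite !mem_ext_grade /= xg yg !mem0v.
  move=> /(_ isT isT); congr (_ \in B); congr pair => /=; first exact: lie_br0r.
  by rewrite mod_act0l subr0.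
have := memvD ((B1P _).1 (subvP sB1 _ u1)) ((B2P _).1 (subvP sB2 _ u2)).
by rewrite [u in u \in _]surjective_pairing; congr (_ \in B); congr pair => /=;
  rewrite ?addr0 ?add0r.
Qed.

(** [x] commutes with the action of [gs (-1)], so its vanishing on [gl (-1)] spreads downward by
    generation and upward by nondegeneracy and transitivity. This reduces the nondegeneracy of
    [s (+) l] to [l_effective]. *)
Lemma commuting_acts_trivially x : x \in gs (-1) ->
  (forall x', x' \in gs (-1) -> lie_br x' x = 0) ->
  (forall y, y \in gl (-1) -> mod_act x y = 0) -> forall y : l, mod_act x y = 0.
Proof.
move=> xg xc x1.
have swap x' y : x' \in gs (-1) -> mod_act x' (mod_act x y) = mod_act x (mod_act x' y).
  move=> x'g; apply/eqP; rewrite -subr_eq0 -mod_actbr xc // mod_act0l //.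
have below n y : y \in gl (- n.+1%:Z) -> mod_act x y = 0.
  elim: n y => [|n IHn] y; first exact: x1.
  have -> : - n.+2%:Z = - n.+1%:Z - 1 by lia.
  have [W WP] : exists W : {vspace l}, forall y, y \in W <-> mod_act x y = 0.
    apply: vspace_of_pred; first exact: mod_act0r.
    by move=> a u v u0 v0; rewrite mod_actDr mod_actZr u0 v0 scaler0 addr0.
  move=> yp; apply/WP; move: y yp; apply/subvP.
  apply: subv_trans (generated_l _) _; first by rewrite oppr_lt0.
  apply/mod_brv_subP => x' z x'g zg; apply/WP.
  by rewrite -swap // IHn // mod_act0r.
have above n y : y \in gl n%:Z -> mod_act x y = 0.
  elim: n y => [|n IHn] y yn.
    apply: nondegenerate_l => [|x' x'g].
      exact: (grade_act l_graded xg yn).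
    by rewrite swap // x1 //; exact: (grade_act l_graded x'g yn).
  have nE : -1 + n.+1%:Z = n%:Z :> int by rewrite intS addKr.
  apply: contrapT => xy.
  have xyn : mod_act x y \in gl n%:Z.
    by have := grade_act l_graded xg yn; rewrite nE.
  have [x' x'g] := transitive_l (isT : 0 <= n%:Z) xyn xy; apply.
  rewrite swap // IHn //.
  by have := grade_act l_graded x'g yn; rewrite nE.
move=> y; elim/(grade_ind l_graded.1): y => [|u v Hu Hv|[n|n] y yp].
- exact: mod_act0r.
- by rewrite mod_actDr Hu Hv addr0.
- exact: above yp.
- by apply: (below n); rewrite -NegzE.
Qed.

Lemma sufficiency_nondegenerate : nondegenerate_lie (s := sl) g.
Proof.
move=> u; rewrite mem_ext_grade => /andP[u1 u2] u0; apply: contrapT => no_v; apply: u0.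
have no (v : sl) : v \in g (-1) -> ext_br v u = 0.
  by move=> vg; apply: contrapT => vu; apply: no_v; exists v.
have no1 x : x \in gs (-1) -> ext_br (x, 0) u = 0.
  by move=> xg; apply: no; rewrite mem_ext_grade /= xg mem0v.
have no2 y : y \in gl (-1) -> ext_br (0, y) u = 0.
  by move=> yg; apply: no; rewrite mem_ext_grade /= yg mem0v.
have u20 : u.2 = 0.
  apply: nondegenerate_l => // x xg; have [_] := no1 x xg.
  by rewrite mod_act0r subr0.
have x1 y : y \in gl (-1) -> mod_act u.1 y = 0.
  by move=> yg; have [_] := no2 y yg; rewrite mod_act0l sub0r => /eqP; rewrite oppr_eq0 => /eqP.
have xc x' : x' \in gs (-1) -> lie_br x' u.1 = 0 by move=> /no1[].
rewrite [u]surjective_pairing u20 (_ : u.1 = 0) //.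
exact: l_effective u1 xc (commuting_acts_trivially u1 xc x1).
Qed.

Lemma sufficiency : partial_Levi_Tanaka gs J gl.
Proof.
split; [exact: l_graded | exact: transitive_l | exact: sufficiency_CR
  | exact: sufficiency_fundamental | exact: sufficiency_nondegenerate].
Qed.

End Sufficiency.
End Equivalence.

(** * Necessity of the three conditions *)

Section Necessity.
Variables (R : realType) (s : lieAlgebra R) (gs : int -> {vspace s}).
Variables (J : s -> s) (Js : s) (l : lieModule s) (gl : int -> {vspace l}).
Hypothesis s_semisimple : semisimple s.
Hypothesis s_CR : graded_CR gs J.
Hypothesis s_fundamental : fundamental_lie gs.
Hypothesis s_transitive : transitive_lie gs.
Hypothesis Js_def : CR_element gs J Js.
Hypothesis l_graded : graded_module gs gl.
Hypothesis l_irreducible : irreducible l.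

Let gr : graded_lie gs := s_CR.1.
Let nd := killing_nondegenerate s_semisimple.
Local Notation sl := (abelian_extension l).
Local Notation g := (ext_grade gs gl).

(** Degree -1 of [s (+) l] contains [gl (-1)] as well as [gs (-1)], so [gl (p - 1)] has two sources,
    whence two conditions on [W]. *)
Lemma ext_fundamental_sub p : fundamental_lie (s := sl) g -> p < 0 ->
  forall W : {vspace l},
  (forall x y, x \in gs (-1) -> y \in gl p -> mod_act x y \in W) ->
  (forall x y, x \in gs p -> y \in gl (-1) -> mod_act x y \in W) ->
  (gl (p - 1) <= W)%VS.
Proof.
move=> fund p0 W W1 W2; apply/subvP => y yp.
have [W' WP] : exists W' : {vspace sl}, forall u, u \in W' <-> u.2 \in W.
  apply: vspace_of_pred => [|a u v uW vW]; first exact: mem0v.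
  by rewrite memvD ?memvZ.
have : ((0, y) : sl) \in g (p - 1) by rewrite mem_ext_grade /= mem0v.
rewrite fund // => yb; apply/(WP (0, y)); move: yb; apply/subvP.
apply/(@mod_brv_subP _ _ (adjoint sl)) => u v; rewrite !mem_ext_grade.
move=> /andP[u1 u2] /andP[v1 v2]; apply/WP => /=.
by apply: memvB; [exact: W1 | exact: W2].
Qed.

(** If [gl (-1)] were zero, fundamentality would empty all negative degrees; then [gs (-1)] would
    kill the lowest nonzero degree, against transitivity. *)
Lemma necessity_gl1 : transitive_module gs gl -> fundamental_lie (s := sl) g ->
  gl (-1) <> 0%VS.
Proof.
move=> trl fund gl10.
have below n : gl (- n.+1%:Z) = 0%VS.
  elim: n => [//|n IHn]; have -> : - n.+2%:Z = - n.+1%:Z - 1 by lia.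
  apply/eqP; rewrite -subv0; apply: ext_fundamental_sub => //.
  - by rewrite IHn => x y _; rewrite memv0 => /eqP->; rewrite mod_act0r mem0v.
  - by rewrite gl10 => x y _; rewrite memv0 => /eqP->; rewrite mod_act0r mem0v.
have [y y0] := irreducible_nonzero l_irreducible.
have exn : exists n : nat, gl n%:Z != 0%VS.
  apply: contrapT => /forallNP no; apply: y0.
  rewrite [y](gcomp_sum l_graded.1) big1 // => p _.
  have := gcomp_mem l_graded.1 p y; case: p => [n|n].
    by have /negP := no n; rewrite negbK => /eqP->; rewrite memv0 => /eqP.
  by rewrite NegzE below memv0 => /eqP.
have [n /eqP/nonzero_pick[z zn z0] minn] := ex_minnP exn.
have [x xg] := trl n%:Z z isT zn z0; apply.
have := grade_act l_graded xg zn; case: n minn {zn z0 exn} => [|n] minn.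
  by rewrite addr0 gl10 memv0 => /eqP.
have -> : -1 + n.+1%:Z = n%:Z :> int by rewrite intS addKr.
have [gn0|/minn] := eqVneq (gl n%:Z) 0%VS; last by rewrite ltnn.
by rewrite gn0 memv0 => /eqP.
Qed.

Lemma necessity_gl2 : nondegenerate_lie (s := sl) g -> gl (-1) <> 0%VS ->
  gl (-2) <> 0%VS.
Proof.
move=> ndeg /nonzero_pick[y y1 y0] gl20.
have [||u] := ndeg ((0, y) : sl).
- by rewrite mem_ext_grade /= mem0v.
- by case.
rewrite mem_ext_grade => /andP[u1 u2]; apply => /=; congr pair => /=.
  exact: lie_br0r.
have : mod_act u.1 y \in gl (-2) by exact: (grade_act l_graded u1 y1).
by rewrite gl20 memv0 mod_act0l subr0 => /eqP.
Qed.

Section Endomorphism.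
Hypothesis fund : fundamental_lie (s := sl) g.
Hypothesis gl2 : gl (-2) <> 0%VS.
Variable Jl : l -> l.
Hypothesis sl_CR : graded_CR (s := sl) g (fun u => (J u.1, Jl u.2)).

Local Notation j0 := (Js_def.1 : Js \in gs 0).
Let jg0 := CR_element_grade0 s_CR s_transitive Js_def.
Let jgN1 := CR_element_gradeN1 s_CR Js_def.
Let jg1 := j_grade1 gr nd j0 jgN1.

Lemma Jl_grade y : y \in gl (-1) -> Jl y \in gl (-1).
Proof.
have [_ [mem _ _ _ _]] := sl_CR; move=> y1; have := mem ((0, y) : sl).
by rewrite !mem_ext_grade /= mem0v y1 => /(_ isT)/andP[].
Qed.

Lemma Jl_lin a y y' : y \in gl (-1) -> y' \in gl (-1) ->
  Jl (a *: y + y') = a *: Jl y + Jl y'.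
Proof.
have [_ [_ lin _ _ _]] := sl_CR; move=> y1 y'1.
have := lin a ((0, y) : sl) ((0, y') : sl); rewrite !mem_ext_grade /= !mem0v y1 y'1.
by move=> /(_ isT isT)[].
Qed.

Lemma Jl_sq y : y \in gl (-1) -> Jl (Jl y) = - y.
Proof.
have [_ [_ _ sq _ _]] := sl_CR; move=> y1.
have := sq ((0, y) : sl); rewrite !mem_ext_grade /= !mem0v y1.
by move=> /(_ isT)[].
Qed.

Lemma Jl_zero : Jl 0 = 0.
Proof.
have := @Jl_lin 1 0 0 (mem0v _) (mem0v _).
by rewrite !scale1r addr0 => /esym/eqP; rewrite -subr_eq0 addrK => /eqP.
Qed.

Lemma J_zero : J 0 = 0.
Proof. by rewrite (CR_elementE Js_def) ?mem0v // lie_br0r. Qed.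

Lemma Jl_comm0 a y : a \in gs 0 -> y \in gl (-1) -> mod_act a (Jl y) = Jl (mod_act a y).
Proof.
have [_ [_ _ _ _ com]] := sl_CR; move=> a0 y1.
have := com ((a, 0) : sl) ((0, y) : sl); rewrite !mem_ext_grade /= !mem0v a0 y1.
by move=> /(_ isT isT)[_]; rewrite J_zero !mod_act0l !subr0.
Qed.

Lemma Jl_from0 x y : x \in gs (-1) -> y \in gl 0 ->
  Jl (mod_act x y) = mod_act (lie_br Js x) y.
Proof.
have [_ [_ _ _ _ com]] := sl_CR; move=> xg y0.
have := com ((0, y) : sl) ((x, 0) : sl); rewrite !mem_ext_grade /= !mem0v y0 xg.
move=> /(_ isT isT)[_]; rewrite !mod_act0l !sub0r (CR_elementE Js_def) //.
have xy : mod_act x y \in gl (-1) by exact: (grade_act l_graded xg y0).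
have := Jl_lin (-1) xy (mem0v _); rewrite Jl_zero !addr0 !scaleN1r => ->.
by move/oppr_inj.
Qed.

Lemma Jl_fromN1 x y : x \in gs (-1) -> y \in gl (-1) ->
  mod_act (lie_br Js x) (Jl y) = mod_act x y.
Proof.
have [_ [_ _ _ br _]] := sl_CR; move=> xg y1.
have := br ((x, 0) : sl) ((0, y) : sl); rewrite !mem_ext_grade /= !mem0v y1 xg.
move=> /(_ isT isT)[_]; rewrite J_zero !mod_act0l !subr0 (CR_elementE Js_def) //.
Qed.

Lemma Jl_fromN1' x y : x \in gs (-1) -> y \in gl (-1) ->
  mod_act (lie_br Js x) y = - mod_act x (Jl y).
Proof.
move=> xg y1; rewrite -(Jl_fromN1 xg (Jl_grade y1)) Jl_sq // mod_actNr opprK.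
by [].
Qed.

Lemma Jl_from1 a y : a \in gs 1 -> y \in gl (-1) ->
  mod_act (lie_br Js a) y = - mod_act a (Jl y).
Proof.
move=> a1 y1; have := degree_one_act gr nd j0 jg0 jgN1 l_graded Jl_grade Jl_lin
  Jl_sq Jl_comm0 Jl_from0 Jl_fromN1 a1 (Jl_grade y1).
by rewrite Jl_sq // mod_actNr => ->; rewrite opprK.
Qed.

Let t y := mod_act Js y - Jl y.

Lemma Js_swap x (y : l) :
  mod_act Js (mod_act x y) = mod_act (lie_br Js x) y + mod_act x (mod_act Js y).
Proof. by rewrite mod_actbr subrK. Qed.

Lemma t_act0 a y : a \in gs 0 -> y \in gl (-1) -> t (mod_act a y) = mod_act a (t y).
Proof.
by move=> a0 y1; rewrite /t Js_swap jg0 // mod_act0l add0r mod_actBr Jl_comm0.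
Qed.

Lemma t_act x y : x \in gs (-1) \/ x \in gs 1 -> y \in gl (-1) ->
  mod_act Js (mod_act x y) = mod_act x (t y).
Proof.
move=> xg y1; rewrite Js_swap /t mod_actBr addrC; congr (_ + _).
by case: xg => xg; [exact: Jl_fromN1' | exact: Jl_from1].
Qed.

Lemma t_act_zero x y : x \in gs (-1) -> y \in gl 0 -> t (mod_act x y) = mod_act x (mod_act Js y).
Proof.
by move=> xg y0; rewrite /t Js_swap Jl_from0 // addrAC subrr add0r.
Qed.

Lemma gl2_generated : (gl (-2) <= mod_brv (gs (-1)) (gl (-1)))%VS.
Proof.
by apply: (@ext_fundamental_sub (-1)) => // x y xg yg; exact: memv_br_mod.
Qed.

Lemma t_linear a y y' : y \in gl (-1) -> y' \in gl (-1) ->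
  t (a *: y + y') = a *: t y + t y'.
Proof.
by move=> y1 y'1; rewrite /t Jl_lin // mod_actDr mod_actZr scalerBr opprD addrACA.
Qed.

Lemma t_grade y : y \in gl (-1) -> t y \in gl (-1).
Proof.
by move=> y1; rewrite memvB ?Jl_grade // -[-1]add0r (grade_act l_graded) ?j0.
Qed.

(** [gl (-2)] is spanned by the [x . z] with [x] in [gs (-1)] and [z] in [gl (-1)]. Moving [a] past
    [x] leaves [[a, x]] of degree 0 and [a . z] in [gl 0], where the other relations for [t]
    apply. *)
Lemma t_from_gl2 a y : a \in gs 1 -> y \in gl (-2) ->
  t (mod_act a y) = mod_act a (mod_act Js y).
Proof.
move=> a1.
have [W WP] : exists W : {vspace l}, forall y, y \in W <-> y \in gl (-2) /\
    t (mod_act a y) = mod_act a (mod_act Js y).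
  have up z : z \in gl (-2) -> mod_act a z \in gl (-1).
    by move=> z2; exact: (grade_act l_graded a1 z2).
  apply: vspace_of_pred.
    by split; [exact: mem0v | rewrite !mod_act0r /t mod_act0r Jl_zero subrr].
  move=> c u v [u2 Hu] [v2 Hv]; split; first by rewrite memvD ?memvZ.
  by rewrite !mod_actDr !mod_actZr t_linear ?up // Hu Hv.
suff sW : (gl (-2) <= W)%VS by move=> /(subvP sW)/WP[].
apply: subv_trans gl2_generated _; apply/mod_brv_subP => x z xg z1; apply/WP.
split; first exact: (grade_act l_graded xg z1).
have ax : lie_br a x \in gs 0 by exact: (grade_br gr a1 xg).
have swap (w : l) : mod_act a (mod_act x w) = mod_act (lie_br a x) w + mod_act x (mod_act a w).
  by rewrite mod_actbr subrK.
have az : mod_act a z \in gl 0 by exact: (grade_act l_graded a1 z1).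
rewrite t_act; [|by left|by []].
rewrite !swap -(t_act (or_intror a1) z1) -t_act_zero // -t_act0 //.
rewrite -[X in t (X + _)]scale1r t_linear ?scale1r //.
  exact: (grade_act l_graded ax z1).
exact: (grade_act l_graded xg az).
Qed.

Lemma necessity_endomorphism : exists Phi : 'End(l), [/\ commutes_with_action Phi,
  lftr Phi = 0, forall y, y \in gl 0 -> Phi y = mod_act Js y
  & forall y, y \in gl (-2) -> Phi y = mod_act Js y].
Proof.
have j_comm a (y : l) : a \in gs 0 -> mod_act Js (mod_act a y) = mod_act a (mod_act Js y).
  by move=> a0; rewrite Js_swap jg0 // mod_act0l add0r.
have [Phi [cPhi Phi0 Phi1 Phi2]] := endomorphism_extension gr nd s_fundamental
  s_transitive l_graded l_irreducible gl2 j_comm t_grade j0 t_linear t_act0 t_act_zero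
  (fun x y xg => t_act (or_introl xg)) (fun x y xg => t_act (or_intror xg)) t_from_gl2.
exists Phi; split=> //.
pose psi := rho Js - Phi.
have psiE y : psi y = mod_act Js y - Phi y by rewrite add_lfunE opp_lfunE rhoE.
have : lftr psi = 0.
  apply: (lftr_imaginary gr nd s_fundamental s_transitive l_graded l_irreducible
    gl2 jg0 jgN1 jg1).
  - by move=> x y; rewrite !psiE Js_swap cPhi mod_actBr addrA.
  - move=> p y yp; rewrite psiE memvB ?(commutes_grade l_irreducible gr l_graded) //.
    by rewrite -[p]add0r (grade_act l_graded) ?j0.
  - by move=> y y2; rewrite psiE Phi2 // subrr.
by rewrite lftrB lftr_rho // sub0r => /eqP; rewrite oppr_eq0 => /eqP.
Qed.

End Endomorphism.

Lemma necessity : partial_Levi_Tanaka gs J gl ->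
  [/\ gl (-1) <> 0%VS, gl (-2) <> 0%VS
    & exists k : R, acts_as_ik Js (gl 0%R + gl (-2)%R)%VS k].
Proof.
move=> [_ trl [Jl sl_CR] fund ndeg].
have gl1 := necessity_gl1 trl fund; have gl2 := necessity_gl2 ndeg gl1.
split=> //; have [Phi [cPhi trPhi Phi0 Phi2]] := necessity_endomorphism fund gl2 sl_CR.
have PhiU y : y \in (gl 0 + gl (-2))%VS -> Phi y = mod_act Js y.
  by move=> /memv_addP[u u0 [v v2 ->]]; rewrite linearD /= mod_actDr Phi0 // Phi2.
(* The commutator vanishes on the nonzero space [gl (-2)], so Schur applies. *)
have central psi : commutes_with_action psi -> (Phi \o psi = psi \o Phi)%VF.
  move=> cpsi; apply/eqP; rewrite -subr_eq0; apply/eqP; apply: contrapT => com0.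
  have ccom : commutes_with_action ((Phi \o psi)%VF - (psi \o Phi)%VF).
    rewrite addrC -scaleN1r; apply: commutes_linear; exact: commutes_comp.
  have [z z2] := nonzero_pick gl2; apply; apply: (schur l_irreducible ccom com0).
  rewrite add_lfunE opp_lfunE !comp_lfunE Phi2; last first.
    exact: (commutes_grade l_irreducible gr l_graded).
  by rewrite Phi2 // cpsi subrr.
have dim0 : (\dim {:l})%:R != 0 :> R.
  by rewrite pnatr_eq0 dimv_eq0; apply/eqP; exact: l_irreducible.1.
have [[f f_iso [[a b] Phif]]|[ty [a Phia]]] :=
    endomorphism_type l_irreducible cPhi central.
  have [f_lin f1 fM _ _] := f_iso.
  have f0 : f 0 = 0.
    have := f_lin 1 0 0; rewrite !scale1r addr0 => /esym/eqP.
    by rewrite -subr_eq0 addrK => /eqP.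
  have PhiE : Phi = a *: \1%VF + b *: f (Complex 0 1).
    have -> : b *: f (Complex 0 1) = f (b *: (Complex 0 1 : Rcomplex R)).
      by rewrite -[b *: (_ : Rcomplex R)]addr0 f_lin f0 addr0.
    rewrite -f1 -f_lin Phif; congr f; apply/eqP; rewrite eq_complex /=.
    by rewrite !(mulr0, mulr1, addr0, add0r) !eqxx.
  have fi : (f (Complex 0 1) \o f (Complex 0 1))%VF = - \1%VF.
    have -> : - \1%VF = f (-1 *: 1 + 0) by rewrite f_lin f0 addr0 f1 scaleN1r.
    rewrite -fM; congr f; apply/eqP; rewrite eq_complex /=.
    by rewrite !(mulr0, mulr1, mul0r, addr0, add0r, sub0r) !eqxx.
  have a0 : a = 0.
    move: trPhi; rewrite PhiE lftrD !lftrZ (lftr_complex_structure fi) mulr0 addr0 lftr1.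
    by move/eqP; rewrite mulf_eq0 (negPf dim0) orbF => /eqP.
  exists b; left; exists f => // y yU.
  by rewrite -PhiU // PhiE a0 scale0r add0r scale_lfunE.
have a0 : a = 0.
  move: trPhi; rewrite Phia lftrZ lftr1 => /eqP.
  by rewrite mulf_eq0 (negPf dim0) orbF => /eqP.
exists 0; right; split=> // w w1 w2.
have Js0 y : y \in (gl 0 + gl (-2))%VS -> mod_act Js y = 0.
  by move=> yU; rewrite -PhiU // Phia a0 scale0r zero_lfunE.
by rewrite /cact /cscale /= !Js0 // !scale0r subrr addr0.
Qed.

End Necessity.

Theorem proposition3p19 (R : realType)
    (s : lieAlgebra R) (gs : int -> {vspace s}) (J : s -> s) (Js : s)
    (l : lieModule s) (gl : int -> {vspace l})
    (s_semisimple : semisimple s)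
    (s_CR : graded_CR gs J)
    (s_fundamental : fundamental_lie gs)
    (s_transitive : transitive_lie gs)
    (Js_def : CR_element gs J Js)
    (l_graded : graded_module gs gl)
    (l_irreducible : irreducible l)
    (l_effective : effective_on_degenerate l gs) :
  partial_Levi_Tanaka gs J gl
  <-> [/\ gl (-1) <> 0%VS,
          gl (-2) <> 0%VS
        & exists k : R, acts_as_ik Js (gl 0%R + gl (-2)%R)%VS k].
Proof.
split; first exact: necessity.
move=> [gl1 gl2 [k act]].
(* In the complex type [T] is [k] times the image of the imaginary unit. In the other types the
   equation at a real vector [(y, 0)] has first component [J_s y = 0], so [T = 0] serves. *)
have [T cT TU] : exists2 T : 'End(l), commutes_with_action T &
    forall y, y \in (gl 0%R + gl (-2)%R)%VS -> mod_act Js y = T y.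
  case: act => [[f [_ _ _ _ f_comm] fU]|[_ act]].
    exists (k *: f (Complex 0 1)) => [|y yU]; last by rewrite scale_lfunE fU.
    rewrite -[_ *: _]addr0; apply: commutes_linear.
      by apply/f_comm; exists (Complex 0 1).
    by move=> x y; rewrite !zero_lfunE mod_act0r.
  exists 0 => [x y|y yU]; first by rewrite !zero_lfunE mod_act0r.
  have := act (y, 0) yU (mem0v _); rewrite /cact /cscale /= => -[-> _].
  by rewrite scale0r scaler0 subrr zero_lfunE.
apply: (sufficiency s_CR s_fundamental s_transitive Js_def l_graded l_irreducible
  l_effective gl1 gl2 cT) => y yg; apply: TU.
  exact: (subvP (addvSl _ _)).
exact: (subvP (addvSr _ _)).
Qed.
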